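(* Let $d\le p$ be positive integers. Suppose $A\subset\mathbb{R}^p$ is a compact subset of a $d$-dimensional $C^1$ manifold with $\mathcal{H}_d(\partial A)=0$ (boundary relative to the manifold), and $w\in C(A\times A)$ is a nonnegative function with $w(x,x)>0$ for all $x\in A$. Then for every $s\ge d$, $$\lim_{N\to\infty}\frac{\mathcal{P}^w_s(A;N)}{\tau_{s,d}(N)}=\frac{\sigma_{s,d}}{[\mathcal{H}^{s,w}_d(A)]^{s/d}},$$ where for measurable $B\subset\mathbb{R}^p$, $\mathcal{H}^{s,w}_d(B):=\int_{B\cap A}w(x,x)^{-d/s}\,d\mathcal{H}_d(x)$. Moreover, if $\mathcal{H}_d(A)>0$, then for every asymptotically $(s,w)$-optimal sequence $\{\omega_N\}_{N\ge1}$ of $N$-point configurations in $A$, $$\nu(\omega_N)\xrightarrow{\ast}\frac{1}{\mathcal{H}^{s,w}_d(A)}\,\mathcal{H}^{s,w}_d\quad\text{as }N\to\infty.$$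
   Context: An $N$-point configuration $\omega_N=\{x_1,\dots,x_N\}\subset A$ is a multiset of $N$ points of $A$. For a weight $w:A\times A\to[0,\infty]$, $s>0$ and $B\subset A$: $U^w_s(y;\omega_N):=\sum_{j=1}^N w(y,x_j)|y-x_j|^{-s}$, $P^w_s(B;\omega_N):=\inf_{y\in B}U^w_s(y;\omega_N)$, and $\mathcal{P}^w_s(A;N):=\sup_{\omega_N\subset A}P^w_s(A;\omega_N)$. A sequence $\{\omega_N\}$ is asymptotically $(s,w)$-optimal if $\lim_{N\to\infty}P^w_s(A;\omega_N)/\mathcal{P}^w_s(A;N)=1$. $\tau_{s,d}(N):=N^{s/d}$ if $s>d$ and $\tau_{d,d}(N):=N\log N$. $\sigma_{s,d}$ for $s>d$ is $\lim_{N\to\infty}\mathcal{P}_s([0,1]^d;N)/N^{s/d}$ (with $w\equiv1$; this limit exists and is positive and finite), and $\sigma_{d,d}:=\mathrm{Vol}(\mathbb{B}^d)$, the volume of the unit ball in $\mathbb{R}^d$. $\mathcal{H}_d$ is $d$-dimensional Hausdorff measure normalized so that a $d$-dimensional unit cube has measure $1$. $\nu(\omega_N):=\frac1N\sum_{x\in\omega_N}\delta_x$. *)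

(* Defs.v *)
From HB Require Import structures.
From mathcomp Require Import all_boot all_order all_algebra.
From mathcomp Require Import all_classical all_reals all_analysis.
Set Implicit Arguments. Unset Strict Implicit. Unset Printing Implicit Defensive.
Import Order.TTheory GRing.Theory Num.Theory.
Import numFieldNormedType.Exports.
Local Open Scope classical_set_scope.
Local Open Scope ring_scope.

Section Defs.
Variable R : realType.

Definition edist (p : nat) (x y : 'rV[R]_p) : R :=
  Num.sqrt (\sum_(i < p) (x ord0 i - y ord0 i) ^+ 2).

(** The weighted Riesz kernel w(y,x) |y-x|^{-s}, with |0|^{-s} = +oo
    (and the extended-real convention 0 * +oo = 0). *)
Definition rkernel (p : nat) (w : 'rV[R]_p * 'rV[R]_p -> R) (s : R)
    (y x : 'rV[R]_p) : \bar R :=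
  ((w (y, x))%:E * (if y == x then +oo else (powR (edist y x) (- s))%:E))%E.

Definition Upot (p : nat) (w : 'rV[R]_p * 'rV[R]_p -> R) (s : R)
    (y : 'rV[R]_p) (N : nat) (omega : 'I_N -> 'rV[R]_p) : \bar R :=
  (\sum_(j < N) rkernel w s y (omega j))%E.

Definition Ppol (p : nat) (w : 'rV[R]_p * 'rV[R]_p -> R) (s : R)
    (B : set 'rV[R]_p) (N : nat) (omega : 'I_N -> 'rV[R]_p) : \bar R :=
  ereal_inf [set Upot w s y omega | y in B].

Definition configs (p : nat) (A : set 'rV[R]_p) (N : nat) : set ('I_N -> 'rV[R]_p) :=
  [set omega | forall j, A (omega j)].
Arguments configs {p} A N.

Definition Pmax (p : nat) (w : 'rV[R]_p * 'rV[R]_p -> R) (s : R)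
    (A : set 'rV[R]_p) (N : nat) : \bar R :=
  ereal_sup [set Ppol w s A omega | omega in configs A N].

Definition tau (s : R) (d N : nat) : R :=
  if d%:R < s then powR N%:R (s / d%:R) else N%:R * ln N%:R.

Definition unit_cube (d : nat) : set 'rV[R]_d :=
  [set x | forall i, 0 <= x ord0 i <= 1].
Arguments unit_cube : clear implicits.

Fixpoint ball_volume (d : nat) : R :=
  match d with
  | 0 => 1
  | 1 => 2
  | (k.+2) as n => 2 * pi / n%:R * ball_volume k
  end.

Definition sigma_sd (s : R) (d : nat) : R :=
  if d%:R < s then
    fine (lim ((fun N : nat => (Pmax (fun _ => 1%R) s (unit_cube d) N
                 * ((powR N%:R (s / d%:R))^-1)%:E)%E) @ \oo))
  else ball_volume d.

Definition diam (p : nat) (E : set 'rV[R]_p) : \bar R :=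
  ereal_sup [set (edist x y)%:E | x in E & y in E].

(** diam(E)^d, with diam(empty)^d = 0 *)
Definition hterm (p d : nat) (E : set 'rV[R]_p) : \bar R :=
  if diam E is r%:E then (r ^+ d)%:E
  else if diam E == -oo%E then 0%E else +oo%E.

Definition hdelta (p d : nat) (delta : R) (E : set 'rV[R]_p) : \bar R :=
  ereal_inf [set (\sum_(0 <= i <oo) hterm d (F i))%E
            | F in [set F : nat -> set 'rV[R]_p |
                    E `<=` \bigcup_i F i /\ forall i, (diam (F i) <= delta%:E)%E]].

Definition hraw (p d : nat) (E : set 'rV[R]_p) : \bar R :=
  ereal_sup [set hdelta d delta E | delta in [set delta : R | 0 < delta]].

Definition Hd (p d : nat) (E : set 'rV[R]_p) : \bar R :=
  (hraw d E * ((fine (hraw d (unit_cube d)))^-1)%:E)%E.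

(** d-dimensional embedded C^1 submanifold of R^p: locally the image of a
    C^1 immersion of an open subset of R^d which is a homeomorphism
    onto a relatively open piece of M. *)
Definition C1_submanifold (p d : nat) (M : set 'rV[R]_p) : Prop :=
  forall x, M x ->
  exists (U : set 'rV[R]_p) (V : set 'rV[R]_d) (phi : 'rV[R]_d -> 'rV[R]_p),
    open U /\ U x /\ open V /\ phi @` V = M `&` U /\
        (forall a b, V a -> V b -> phi a = phi b -> a = b) /\
        (forall W, open W -> W `<=` V -> exists O, open O /\ phi @` W = O `&` M) /\
        (forall i : 'I_d,
            (forall v, V v -> derivable phi v (delta_mx ord0 i)) /\
            {within V, continuous ('D_(delta_mx ord0 i) phi)}) /\
        (forall v, V v -> row_free (\matrix_(i < d) ('D_(delta_mx ord0 i) phi v))).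

Definition relint (p : nat) (M A : set 'rV[R]_p) : set 'rV[R]_p :=
  [set x | A x /\ exists U, open U /\ U x /\ U `&` M `<=` A].

Definition relbdry (p : nat) (M A : set 'rV[R]_p) : set 'rV[R]_p :=
  (closure A `&` M) `\` relint M A.

Definition borelRp (p : nat) := g_sigma_algebraType (@open 'rV[R]_p).

Definition limit_value (s : R) (d : nat) (H : \bar R) : \bar R :=
  if H == 0%E then +oo%E
  else (sigma_sd s d / powR (fine H) (s / d%:R))%:E.

End Defs.
Arguments configs {R p} A N.
Arguments unit_cube : clear implicits.

(* Main.v *)
(* For the cube [0,1]^d and w = 1, averaging the potential over the points of
   the cube that are not too close to the configuration bounds the polarization
   from above. If s > d, subdividing the cube into m^d copies of itself gives
   P(m^d n) >= m^s P(n), hence the existence of the limit sigma; if s = d, a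
   lattice configuration attains the averaging bound, because a ball of radius
   rho contains about Vol(B^d) rho^d lattice points.

   By the Vitali covering lemma, A is covered up to a small H_d-measure by
   disjoint images psi(Q) of small cubes under almost isometric charts, on each
   of which w is almost constant, so that psi(Q) behaves like a cube of volume
   w^{-d/s} |Q|. Say that a set B is l-coverable if n points of A can produce on
   B a potential of at least about sigma l^{-s/d} tau(n). Coverability constants
   are subadditive, the cubes psi(Q) are almost H_d^{s,w}(psi(Q))-coverable, and
   the uncovered part of A, covered by balls of radii r_i with sum r_i^d small,
   is c-coverable for a small c. This gives the lower bound.

   Conversely, in a configuration of N points with potential at least t tau(N)
   on A, the points lying in psi(Q) must essentially produce this potential on a
   slightly smaller cube by themselves, so at least a proportion
   (t / sigma)^{d/s} H_d^{s,w}(psi(Q)) of the points lies in psi(Q). Summing over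
   the cubes, the average of any continuous f >= 0 over the configuration is at
   least about (t / sigma)^{d/s} times its integral against H_d^{s,w}. The case
   f = 1 is the upper bound for the limit, and the cases K + f and K - f give
   the weak convergence of asymptotically optimal configurations. *)

From HB Require Import structures.
From mathcomp Require Import all_boot all_order all_algebra.
From mathcomp Require Import all_classical all_reals all_analysis.
From mathcomp Require Import measurable_realfun.
From mathcomp Require Import finmap ring lra zify.
Require Import Defs.
Set Implicit Arguments. Unset Strict Implicit. Unset Printing Implicit Defensive.
Import Order.TTheory GRing.Theory Num.Theory.
Import numFieldNormedType.Exports.
Local Open Scope classical_set_scope.
Local Open Scope ring_scope.

(** * Euclidean distance *)

(** Integrals over balls and cubes are replaced by counts of points in fine lattices. The volume of
    the ball enters through its recursion V_(d+2) = 2 pi / (d + 2) V_d: summing d-dimensional slices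
    over a planar disc gives pi times a Riemann sum of d x^(d-1) (1 - x^2), whose integral is 2 / (d
    + 2). The same counts give the positivity of the Hausdorff measure of the cube.

    Two properties of tau carry the passage from the cube to A. It is asymptotically homogeneous of
    degree s/d, so dividing the points in the proportion of the coverability constants equalizes the
    potentials on the parts; this is why these constants add up. And it dominates N, so points at a
    distance bounded below do not count.

    The obstacle is that A may be thin inside a chart. Full cubes exist only in its relative
    interior, which carries all of H_d(A); elsewhere a cruder constant, obtained with nearest points
    of A, is enough because little measure is left. Each comparison costs a fixed power of the
    bi-Lipschitz constant kappa of the charts, which can be taken close to 1. *)

Section EuclideanDistance.
Variables (R : realType) (p : nat).
Implicit Types (x y z : 'rV[R]_p) (a r h : R).

Lemma edist_ge0 x y : 0 <= edist x y.
Proof. exact: sqrtr_ge0. Qed.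

Lemma edistC x y : edist x y = edist y x.
Proof. by congr Num.sqrt; apply: eq_bigr => i _; rewrite -sqrrN opprB. Qed.

Lemma edist_sqr x y : edist x y ^+ 2 = \sum_(i < p) (x ord0 i - y ord0 i) ^+ 2.
Proof. by rewrite sqr_sqrtr// sumr_ge0// => i _; exact: sqr_ge0. Qed.

Lemma edistxx x : edist x x = 0.
Proof.
by rewrite /edist big1 ?sqrtr0// => i _; rewrite subrr expr0n.
Qed.

Lemma coord_le_edist x y i : `|x ord0 i - y ord0 i| <= edist x y.
Proof.
rewrite -(ler_pXn2r (n := 2))// ?nnegrE ?edist_ge0//.
rewrite edist_sqr real_normK ?num_real// (bigD1 i)//= lerDl.
by apply: sumr_ge0 => j _; exact: sqr_ge0.
Qed.

Lemma edist_eq0 x y : (edist x y == 0) = (x == y).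
Proof.
apply/eqP/eqP => [e0|->]; last exact: edistxx.
apply/rowP => i; apply/eqP; rewrite -subr_eq0 -normr_eq0 eq_le normr_ge0 andbT.
by rewrite -e0 coord_le_edist.
Qed.

Lemma edist_gt0 x y : x != y -> 0 < edist x y.
Proof. by move=> xy; rewrite lt_def edist_eq0 xy edist_ge0. Qed.

(** The crude factor [p] instead of its square root suffices: it only enters radii and constants
    that may depend on the dimension. *)
Lemma edist_le_coord x y h : 0 <= h ->
  (forall i, `|x ord0 i - y ord0 i| <= h) -> edist x y <= p%:R * h.
Proof.
move=> h0 xy; rewrite -(ler_pXn2r (n := 2))// ?nnegrE ?edist_ge0 ?mulr_ge0//.
rewrite edist_sqr; apply: (@le_trans _ _ (\sum_(i < p) h ^+ 2)).
  apply: ler_sum => i _; rewrite -[leLHS]real_normK ?num_real//.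
  by rewrite ler_pXn2r// nnegrE.
rewrite sumr_const card_ord -[leLHS]mulr_natl exprMn ler_wpM2r ?sqr_ge0//.
by rewrite -natrX ler_nat expnS expn1; case: (p) => // n; rewrite leq_pmulr.
Qed.

(** Lagrange's identity: the double sum of the squares of [u i * v j - u j * v i] is twice the
    defect in the Cauchy-Schwarz inequality. *)
Let CS (u v : 'I_p -> R) : (\sum_i u i * v i) ^+ 2 <=
  (\sum_i u i ^+ 2) * (\sum_i v i ^+ 2).
Proof.
have : 0 <= \sum_i \sum_j (u i * v j - u j * v i) ^+ 2.
  by apply: sumr_ge0 => i _; apply: sumr_ge0 => j _; exact: sqr_ge0.
under eq_bigr do under eq_bigr do rewrite sqrrB.
have -> : \sum_i \sum_j ((u i * v j) ^+ 2 - u i * v j * (u j * v i) *+ 2 +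
    (u j * v i) ^+ 2) = 2 * ((\sum_i u i ^+ 2) * (\sum_i v i ^+ 2)) -
    2 * (\sum_i u i * v i) ^+ 2.
  under eq_bigr do rewrite big_split /= sumrB.
  rewrite big_split /= sumrB.
  have -> : \sum_i \sum_j (u i * v j) ^+ 2 =
      (\sum_i u i ^+ 2) * (\sum_i v i ^+ 2).
    rewrite mulr_suml; apply: eq_bigr => i _; rewrite mulr_sumr.
    by apply: eq_bigr => j _; rewrite exprMn.
  have -> : \sum_i \sum_j (u j * v i) ^+ 2 =
      (\sum_i u i ^+ 2) * (\sum_i v i ^+ 2).
    rewrite mulr_suml exchange_big; apply: eq_bigr => i _; rewrite mulr_sumr.
    by apply: eq_bigr => j _; rewrite exprMn.
  have -> : \sum_i \sum_j u i * v j * (u j * v i) *+ 2 =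
      2 * (\sum_i u i * v i) ^+ 2.
    rewrite expr2 mulr_suml mulr_sumr; apply: eq_bigr => i _.
    rewrite !mulr_sumr; apply: eq_bigr => j _.
    by rewrite -[LHS]mulr_natl; ring.
  by ring.
by lra.
Qed.

Lemma edist_triangle x y z : edist x z <= edist x y + edist y z.
Proof.
rewrite -(ler_pXn2r (n := 2))// ?nnegrE ?addr_ge0 ?edist_ge0//.
rewrite sqrrD !edist_sqr.
pose u i := x ord0 i - y ord0 i; pose v i := y ord0 i - z ord0 i.
have -> : \sum_(i < p) (x ord0 i - z ord0 i) ^+ 2 =
   \sum_i u i ^+ 2 + (\sum_i u i * v i) *+ 2 + \sum_i v i ^+ 2.
  rewrite -sumrMnl -!big_split; apply: eq_bigr => i _ /=.
  by rewrite -sqrrD /u /v addrA subrK.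
rewrite -!edist_sqr lerD2r lerD2l lerMn2r/=.
apply: le_trans (ler_norm _) _; rewrite -(ler_pXn2r (n := 2))//.
  rewrite real_normK ?num_real// exprMn !edist_sqr; exact: CS.
by rewrite nnegrE mulr_ge0// edist_ge0.
Qed.

Lemma edistDr x y z : edist (x + z) (y + z) = edist x y.
Proof.
congr Num.sqrt; apply: eq_bigr => i _; rewrite !mxE; congr (_ ^+ 2).
by rewrite opprD addrACA subrr addr0.
Qed.

Lemma edistZ a x y : edist (a *: x) (a *: y) = `|a| * edist x y.
Proof.
rewrite /edist -sqrtr_sqr -sqrtrM ?sqr_ge0//; congr Num.sqrt.
by rewrite mulr_sumr; apply: eq_bigr => i _; rewrite !mxE -mulrBr exprMn.
Qed.

Lemma ballP x r y : 0 < r ->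
  ball x r y <-> forall i, `|x ord0 i - y ord0 i| < r.
Proof.
move=> r0; split => [[_ xy] i|xy]; first exact: xy.
by split => // i j; rewrite ord1; exact: xy.
Qed.

Definition eball x r : set 'rV[R]_p := [set y | edist x y < r].

Lemma eball_sub_ball x r : 0 < r -> eball x r `<=` ball x r.
Proof.
by move=> r0 y xy; apply/ballP => // i; apply: le_lt_trans xy; exact: coord_le_edist.
Qed.

(** [ball] is a ball of the sup norm. Dividing by [p + 1] instead of [p] keeps the inequality strict
    and covers [p = 0]. *)
Lemma ball_sub_eball x r : 0 < r -> ball x (r / (p%:R + 1)) `<=` eball x r.
Proof.
move=> r0 y; have p0 : 0 < p%:R + 1 :> R by rewrite ltr_wpDl.
move=> /ballP xy; rewrite /eball/=.
apply: (@le_lt_trans _ _ (p%:R * (r / (p%:R + 1)))).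
  apply: edist_le_coord => [|i]; first by rewrite divr_ge0// ltW.
  by apply: ltW; apply: xy; rewrite divr_gt0.
by rewrite mulrCA gtr_pMr// ltr_pdivrMr// mul1r ltrDl.
Qed.

Lemma nbhs_eball x r : 0 < r -> nbhs x (eball x r).
Proof.
move=> r0; apply/nbhs_ballP; exists (r / (p%:R + 1)) => /=.
  by rewrite divr_gt0// ltr_wpDl.
exact: ball_sub_eball.
Qed.

Lemma open_eball x r : open (eball x r).
Proof.
rewrite openE => y xy.
have e0 : 0 < r - edist x y by rewrite subr_gt0.
change (nbhs y (eball x r)); near=> z.
have yz : edist y z < r - edist x y by near: z; exact: nbhs_eball.
by rewrite /eball/= (le_lt_trans (edist_triangle x y z))// -ltrBrDl.
Unshelve. all: by end_near. Qed.

Lemma nbhs_eballP x (U : set 'rV[R]_p) : nbhs x U ->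
  exists2 r, 0 < r & eball x r `<=` U.
Proof.
move=> /nbhs_ballP[r /= r0 rU]; exists r => //.
exact: subset_trans (eball_sub_ball r0) rU.
Qed.

Lemma open_eballP (U : set 'rV[R]_p) x : open U -> U x ->
  exists2 r, 0 < r & eball x r `<=` U.
Proof. by move=> oU Ux; apply: nbhs_eballP; exact: open_nbhs_nbhs. Qed.

Lemma edist_continuous x : continuous (edist x).
Proof.
move=> y; apply/(@cvgrPdist_lt _ _ _ (nbhs y)) => e e0.
near=> z.
have yz : edist y z < e by near: z; exact: nbhs_eball.
rewrite ltr_norml; apply/andP; split.
  rewrite ltrNl opprB ltrBlDl (le_lt_trans (edist_triangle x y z))//.
  by rewrite ltrD2l.
rewrite ltrBlDl (le_lt_trans (edist_triangle x z y))// ltrD2l.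
by rewrite edistC.
Unshelve. all: by end_near. Qed.

Lemma compact_eball_cover (A : set 'rV[R]_p) (r : 'rV[R]_p -> R) :
  compact A -> (forall x, A x -> 0 < r x) ->
  exists s : seq 'rV[R]_p, (forall x, x \in s -> A x) /\
    forall y, A y -> exists2 x, x \in s & eball x (r x) y.
Proof.
rewrite compact_cover => cA r0.
have [|y Ay|D DA Acov] := cA _ A (fun x => eball x (r x)).
- by move=> x _; exact: open_eball.
- by exists y => //; rewrite /eball/= edistxx r0.
- exists (enum_fset D); split => [x xD|y /Acov[x xD xy]].
    by apply: set_mem; exact: DA.
  by exists x.
Qed.

Definition ccube x h : set 'rV[R]_p :=
  [set y | forall i, `|y ord0 i - x ord0 i| <= h].

Lemma compact_ccube x h : compact (ccube x h).
Proof.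
rewrite (_ : ccube x h = [set v : 'rV[R]_p | forall i,
    `[x ord0 i - h, x ord0 i + h]%classic (v ord0 i)]).
  apply: (@rV_compact _ _ (fun i => `[x ord0 i - h, x ord0 i + h]%classic)).
  by move=> i; exact: segment_compact.
apply/seteqP; split => y /= yx i; move: (yx i);
  by rewrite /= in_itv/= ler_distl.
Qed.

Lemma ccube_center x h : 0 <= h -> ccube x h x.
Proof. by move=> h0 i; rewrite subrr normr0. Qed.

Lemma ccube_edist x h y z : 0 <= h -> ccube x h y -> ccube x h z ->
  edist y z <= p%:R * (2 * h).
Proof.
move=> h0 xy xz; apply: edist_le_coord => [|i]; first by rewrite mulr_ge0.
rewrite -(subrKA (x ord0 i)) (le_trans (ler_normD _ _))// mulr_natl mulr2n.
by rewrite lerD// distrC.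
Qed.

Lemma sub_ccube x h h' : h <= h' -> ccube x h `<=` ccube x h'.
Proof. by move=> hh y xy i; exact: le_trans (xy i) hh. Qed.

End EuclideanDistance.

(** * Riesz potentials *)

Section RieszKernel.
Variable R : realType.
Implicit Types (s t L c : R).

(** The kernel as a function of the distance alone, so that points of different spaces can be
    compared; with the value [+oo] at 0 it is nonincreasing on all distances when [s >= 0]. *)
Definition riesz s t : \bar R := if t == 0 then +oo%E else (powR t (- s))%:E.

Lemma riesz_ge0 s t : (0 <= riesz s t)%E.
Proof. by rewrite /riesz; case: ifP => // _; rewrite lee_fin powR_ge0. Qed.

Lemma riesz_anti s t t' : 0 <= s -> 0 <= t -> t <= t' ->
  (riesz s t' <= riesz s t)%E.
Proof.
move=> s0 t0 tt'; rewrite /riesz.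
case: (eqVneq t 0) => [_|tn0]; first by rewrite leey.
have t_gt0 : 0 < t by rewrite lt_def tn0.
rewrite gt_eqF ?(lt_le_trans t_gt0)// lee_fin !powRN.
rewrite lef_pV2 ?posrE ?powR_gt0// ?(lt_le_trans t_gt0)//.
by rewrite ge0_ler_powR// nnegrE// (le_trans t0).
Qed.

Lemma rieszM s L t : 0 < L -> 0 <= t ->
  riesz s (L * t) = ((powR L (- s))%:E * riesz s t)%E.
Proof.
move=> L0 t0; rewrite /riesz mulf_eq0 gt_eqF//=; case: ifP => [_|_].
  by rewrite gt0_muley// lte_fin powR_gt0.
by rewrite powRM// ?EFinM// ltW.
Qed.

Lemma powR_inv (a x : R) : 0 < a -> powR a^-1 x = powR a (- x).
Proof.
move=> a0; rewrite powRN; apply: (mulIf (x := powR a x)).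
  by rewrite gt_eqF// powR_gt0.
by rewrite -powRM ?invr_ge0 ?ltW// !mulVf ?powR1// gt_eqF// powR_gt0.
Qed.

Lemma riesz_le_scale s L t t' : 0 <= s -> 0 < L -> 0 <= t -> t <= L * t' ->
  (riesz s t' <= (powR L s)%:E * riesz s t)%E.
Proof.
move=> s0 L0 t0 tt'; rewrite -[X in powR _ X](opprK s) -powR_inv//.
rewrite -rieszM// ?invr_gt0//.
apply: riesz_anti => //; first by rewrite mulr_ge0// invr_ge0 ltW.
by rewrite mulrC ler_pdivrMr// [leRHS]mulrC.
Qed.

Lemma rkernelE (p : nat) (w : 'rV[R]_p * 'rV[R]_p -> R) s y x :
  rkernel w s y x = ((w (y, x))%:E * riesz s (edist y x))%E.
Proof. by rewrite /rkernel /riesz edist_eq0. Qed.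

Lemma rkernel1E (p : nat) s (y x : 'rV[R]_p) :
  rkernel (fun=> 1%R) s y x = riesz s (edist y x).
Proof. by rewrite rkernelE mul1e. Qed.

Lemma rkernel_ge0 (p : nat) (w : 'rV[R]_p * 'rV[R]_p -> R) s y x :
  0 <= w (y, x) -> (0 <= rkernel w s y x)%E.
Proof. by move=> w0; rewrite rkernelE mule_ge0// riesz_ge0. Qed.

(** The two pairs of points may live in different dimensions: this is how potentials on [A] are
    compared with potentials on the cube. A factor [L] in the distances costs [L^s], which the
    weight has to pay for. *)
Lemma rkernel_ge (p q : nat) (w : 'rV[R]_p * 'rV[R]_p -> R) s L c y x
    (y' x' : 'rV[R]_q) : 0 <= s -> 0 < L -> 0 <= c ->
  edist y x <= L * edist y' x' -> c * powR L s <= w (y, x) ->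
  (c%:E * rkernel (fun=> 1%R) s y' x' <= rkernel w s y x)%E.
Proof.
move=> s0 L0 c0 dd cw; rewrite rkernel1E rkernelE.
apply: (@le_trans _ _ (c%:E * ((powR L s)%:E * riesz s (edist y x)))%E).
  apply: lee_wpmul2l; first by rewrite lee_fin.
  by apply: riesz_le_scale => //; exact: edist_ge0.
by rewrite muleA -EFinM; apply: lee_wpmul2r; rewrite ?riesz_ge0// lee_fin.
Qed.

Lemma rkernel_le (p q : nat) (w : 'rV[R]_p * 'rV[R]_p -> R) s L c y x
    (y' x' : 'rV[R]_q) : 0 <= s -> 0 < L -> 0 <= w (y, x) ->
  edist y' x' <= L * edist y x -> w (y, x) * powR L s <= c ->
  (rkernel w s y x <= c%:E * rkernel (fun=> 1%R) s y' x')%E.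
Proof.
move=> s0 L0 w0 dd wc; rewrite rkernel1E rkernelE.
apply: (@le_trans _ _ ((w (y, x))%:E *
    ((powR L s)%:E * riesz s (edist y' x')))%E).
  apply: lee_wpmul2l; first by rewrite lee_fin.
  by apply: riesz_le_scale => //; exact: edist_ge0.
by rewrite muleA -EFinM; apply: lee_wpmul2r; rewrite ?riesz_ge0// lee_fin.
Qed.

Lemma Upot_ge0 (p : nat) (w : 'rV[R]_p * 'rV[R]_p -> R) s y N
    (omega : 'I_N -> 'rV[R]_p) :
  (forall j, 0 <= w (y, omega j)) -> (0 <= Upot w s y omega)%E.
Proof. by move=> w0; apply: sume_ge0 => j _; exact: rkernel_ge0. Qed.

Lemma Upot1_ge0 (p : nat) s (y : 'rV[R]_p) N (omega : 'I_N -> 'rV[R]_p) :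
  (0 <= Upot (fun=> 1%R) s y omega)%E.
Proof. by apply: Upot_ge0 => j; rewrite ler01. Qed.

Lemma Upot_ge (p q : nat) (w : 'rV[R]_p * 'rV[R]_p -> R) s L c N y
    (omega : 'I_N -> 'rV[R]_p) (y' : 'rV[R]_q) (omega' : 'I_N -> 'rV[R]_q) :
  0 <= s -> 0 < L -> 0 <= c ->
  (forall j, edist y (omega j) <= L * edist y' (omega' j)) ->
  (forall j, c * powR L s <= w (y, omega j)) ->
  (c%:E * Upot (fun=> 1%R) s y' omega' <= Upot w s y omega)%E.
Proof.
move=> s0 L0 c0 dd cw; rewrite /Upot ge0_sume_distrr; last first.
  by move=> j _; apply: rkernel_ge0; rewrite ler01.
by apply: lee_sum => j _; apply: (rkernel_ge (L := L)).
Qed.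

Lemma Upot1_ge_scale (p q : nat) s L N (y : 'rV[R]_p)
    (omega : 'I_N -> 'rV[R]_p) (y' : 'rV[R]_q) (omega' : 'I_N -> 'rV[R]_q) :
  0 <= s -> 0 < L ->
  (forall j, edist y (omega j) <= L * edist y' (omega' j)) ->
  ((powR L (- s))%:E * Upot (fun=> 1%R) s y' omega' <= Upot (fun=> 1%R) s y omega)%E.
Proof.
move=> s0 L0 dd; apply: (Upot_ge (L := L)) => //; first exact: powR_ge0.
move=> j; by rewrite powRN mulVf// gt_eqF// powR_gt0.
Qed.

Lemma Ppol_le (p : nat) (w : 'rV[R]_p * 'rV[R]_p -> R) s (B : set 'rV[R]_p) N
    (omega : 'I_N -> 'rV[R]_p) y :
  B y -> (Ppol w s B omega <= Upot w s y omega)%E.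
Proof. by move=> By; apply: ereal_inf_lbound; exists y. Qed.

Lemma Ppol_ge (p : nat) (w : 'rV[R]_p * 'rV[R]_p -> R) s (B : set 'rV[R]_p) N
    (omega : 'I_N -> 'rV[R]_p) (a : \bar R) :
  (forall y, B y -> a <= Upot w s y omega)%E -> (a <= Ppol w s B omega)%E.
Proof. by move=> aU; apply: le_ereal_inf_tmp => _ [y By <-]; exact: aU. Qed.

Lemma Pmax_ge (p : nat) (w : 'rV[R]_p * 'rV[R]_p -> R) s (A : set 'rV[R]_p) N
    (omega : 'I_N -> 'rV[R]_p) :
  configs A N omega -> (Ppol w s A omega <= Pmax w s A N)%E.
Proof. by move=> Ao; apply: ereal_sup_ubound; exists omega. Qed.

Lemma Pmax_le (p : nat) (w : 'rV[R]_p * 'rV[R]_p -> R) s (A : set 'rV[R]_p) N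
    (a : \bar R) :
  (forall omega, configs A N omega -> Ppol w s A omega <= a)%E ->
  (Pmax w s A N <= a)%E.
Proof. by move=> aP; apply: ge_ereal_sup => _ [om Ao <-]; exact: aP. Qed.

Lemma Pmax_gt_ex (p : nat) (w : 'rV[R]_p * 'rV[R]_p -> R) s
    (A : set 'rV[R]_p) N (a : \bar R) : (a < Pmax w s A N)%E ->
  exists2 omega, configs A N omega &
    forall y, A y -> (a < Upot w s y omega)%E.
Proof.
move=> /ereal_sup_gt[_ [om Ao <-] ao]; exists om => // y Ay.
by apply: lt_le_trans ao _; exact: Ppol_le.
Qed.

End RieszKernel.

(** * Lattice points in balls *)

Section Layers.
Variables (R : realType) (T : finType) (r : T -> R) (h : R -> R) (u : nat -> R).

Let N (x : R) : R := \sum_t (r t <= x)%R%:R.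

(** If [u k < x <= u k.+1], the surviving terms telescope and the right-hand side is [h (u k)]: an
    upper step function of the decreasing [h], written with indicators so that summing over points
    produces counting functions. *)
Let layer_pt_upper m x :
  (forall j, (j < m)%N -> u j <= u j.+1) ->
  (forall x y, u 0%N <= x -> x <= y -> y <= u m -> h y <= h x) ->
  u 0%N <= x -> x <= u m ->
  h x <= h (u m) + \sum_(j < m) (h (u j) - h (u j.+1)) * (x <= u j.+1)%R%:R.
Proof.
elim: m => [|m IH] uS hS u0x xum.
  by rewrite big_ord0 addr0; have -> : x = u 0%N by apply/eqP; rewrite eq_le xum.
have u0m : forall m', (m' <= m.+1)%N -> u 0%N <= u m'.
  elim=> // m' IHm m'm; apply: le_trans (IHm (ltnW m'm)) (uS _ _) => //.
have um := uS _ (ltnSn m).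
rewrite big_ord_recr /= xum mulr1.
have [xm|xm] := leP x (u m).
  have := IH (fun j jm => uS j (ltnW jm))
    (fun a b ua ab bm => hS a b ua ab (le_trans bm um)) u0x xm.
  lra.
have hx : h x <= h (u m) by apply: hS => //; [exact: u0m|exact: ltW].
have S0 : 0 <= \sum_(j < m) (h (u j) - h (u j.+1)) * (x <= u j.+1)%R%:R.
  apply: sumr_ge0 => j _; apply: mulr_ge0 => //; rewrite subr_ge0.
  have jm := ltn_ord j.
  apply: hS; [apply: u0m; exact: leq_trans (ltnW jm) (leqnSn m)|exact/uS/ltnW|].
  have : forall i, (j.+1 <= i <= m.+1)%N -> u j.+1 <= u i.
    elim=> [|i IHi]; first by rewrite ltn0.
    move=> /andP[ji im]; move: ji; rewrite leq_eqVlt => /orP[/eqP->//|ji].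
    by apply: le_trans (IHi _) (uS _ im); rewrite -ltnS ji/= ltnW.
  by apply; rewrite leqnn andbT; exact: ltnW.
lra.
Qed.

(** The same telescoping, now with the value of [h] at the right end of the cell. *)
Let layer_pt_lower m x :
  (forall j, (j < m)%N -> u j <= u j.+1) ->
  (forall x y, u 0%N <= x -> x <= y -> y <= u m -> h y <= h x) ->
  u 0%N <= x -> x <= u m ->
  h (u m) + \sum_(j < m) (h (u j) - h (u j.+1)) * (x <= u j)%R%:R <= h x.
Proof.
elim: m => [|m IH] uS hS u0x xum.
  by rewrite big_ord0 addr0; have -> : x = u 0%N by apply/eqP; rewrite eq_le xum.
have um := uS _ (ltnSn m).
rewrite big_ord_recr /=.
have [xm|xm] := leP x (u m).
  have := IH (fun j jm => uS j (ltnW jm))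
    (fun a b ua ab bm => hS a b ua ab (le_trans bm um)) u0x xm.
  by rewrite mulr1; lra.
rewrite mulr0 addr0 big1 ?addr0; first exact: hS.
move=> j _; rewrite leNgt (le_lt_trans _ xm) ?mulr0//.
have : forall i, (j <= i <= m)%N -> u j <= u i.
  elim=> [|i IHi]; first by rewrite leqn0 andbT => /eqP->.
  move=> /andP[ji im]; move: ji; rewrite leq_eqVlt => /orP[/eqP->//|ji].
  by apply: le_trans (IHi _) (uS _ _); [rewrite -ltnS ji/= ltnW|exact: ltnW].
by apply; rewrite leqnn andbT; exact: ltnW.
Qed.

Let mono_u m : (forall j, (j < m)%N -> u j <= u j.+1) ->
  forall i j, (i <= j)%N -> (j <= m)%N -> u i <= u j.
Proof.
move=> uS i; elim=> [|j IHj]; first by rewrite leqn0 => /eqP->.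
rewrite leq_eqVlt => /orP[/eqP->//|ij] jm.
by apply: le_trans (IHj _ _) (uS _ _) => //; exact: ltnW.
Qed.

Let telescope_h m :
  h (u m) + \sum_(j < m) (h (u j) - h (u j.+1)) = h (u 0%N).
Proof.
elim: m => [|m IH]; first by rewrite big_ord0 addr0.
by rewrite big_ord_recr/= -IH; ring.
Qed.

Let sum_layers m (i : nat -> nat) :
  h (u m) * N (u m) + \sum_(j < m) (h (u j) - h (u j.+1)) * N (u (i j)) =
  \sum_t (h (u m) * (r t <= u m)%R%:R +
    \sum_(j < m) (h (u j) - h (u j.+1)) * (r t <= u (i j))%R%:R).
Proof.
rewrite big_split /= mulr_sumr; congr (_ + _).
by rewrite exchange_big/=; apply: eq_bigr => j _; rewrite mulr_sumr.
Qed.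

Lemma layer_upper m :
  (forall j, (j < m)%N -> u j <= u j.+1) ->
  (forall x y, u 0%N <= x -> x <= y -> y <= u m -> h y <= h x) ->
  0 <= h (u m) ->
  \sum_(t | u 0%N <= r t <= u m) h (r t) <=
  h (u m) * N (u m) + \sum_(j < m) (h (u j) - h (u j.+1)) * N (u j.+1).
Proof.
move=> uS hS hm; rewrite (sum_layers m S) [leLHS]big_mkcond.
apply: ler_sum => t _; have [/andP[u0 um]|_] := boolP (_ && _).
  by rewrite um mulr1; exact: layer_pt_upper.
apply: addr_ge0; first exact: mulr_ge0.
apply: sumr_ge0 => j _; apply: mulr_ge0 => //; rewrite subr_ge0.
by apply: hS; rewrite ?uS// (mono_u uS) // ltnW.
Qed.

(** A point with [r t < u 0] contributes the full telescoping sum [h (u 0)] on the left but is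
    missing from the sum on the right; the last term restores it. *)
Lemma layer_lower m :
  (forall j, (j < m)%N -> u j <= u j.+1) ->
  (forall x y, u 0%N <= x -> x <= y -> y <= u m -> h y <= h x) ->
  h (u m) * N (u m) + \sum_(j < m) (h (u j) - h (u j.+1)) * N (u j) <=
  \sum_(t | u 0%N <= r t <= u m) h (r t) + h (u 0%N) * \sum_t (r t < u 0%N)%R%:R.
Proof.
move=> uS hS; rewrite (sum_layers m id) mulr_sumr.
rewrite (big_mkcond (fun t => u 0%N <= r t <= u m)) -big_split.
apply: ler_sum => t _ /=.
have [u0|u0] := leP (u 0%N) (r t); rewrite ?mulr0 ?addr0 ?mulr1 ?add0r.
- have [um|um] := leP (r t) (u m); first by rewrite mulr1; exact: layer_pt_lower.
  rewrite mulr0 add0r big1// => j _; rewrite leNgt (le_lt_trans _ um) ?mulr0//.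
  by apply: (mono_u uS) => //; exact: ltnW.
- rewrite -(telescope_h m) (le_trans (ltW u0)) ?mulr1 ?(mono_u uS)//.
  rewrite lerD2l; apply: ler_sum => j _.
  by rewrite (le_trans (ltW u0)) ?mulr1// (mono_u uS)// ltnW.
Qed.

End Layers.

Section LatticeCount.
Variable R : realType.
Implicit Types (z : nat -> R) (q : R).

(** The centre is a sequence, so that forgetting its first coordinates is a mere shift of the index
    in inductions on [d]. *)
Definition lsq d M z (k : {ffun 'I_d -> 'I_M}) : R :=
  \sum_(i < d) ((k i)%:R - z i) ^+ 2.

(* Number of points of the box [{0, ..., M - 1}^d] at distance at most [sqrt q]
   from [z]. *)
Definition lcount d M z q : R := \sum_(k : {ffun 'I_d -> 'I_M}) (lsq z k <= q)%R%:R.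

Lemma lsq_ge0 d M z (k : {ffun 'I_d -> 'I_M}) : 0 <= lsq z k.
Proof. by apply: sumr_ge0 => i _; exact: sqr_ge0. Qed.

Lemma lcount_ge0 d M z q : 0 <= lcount d M z q.
Proof. by apply: sumr_ge0. Qed.

Lemma lcount_neg d M z q : q < 0 -> lcount d M z q = 0.
Proof.
by move=> q0; apply: big1 => k _; rewrite leNgt (lt_le_trans q0 (lsq_ge0 _ _)).
Qed.

Let fcons d M (ak : 'I_M * {ffun 'I_d -> 'I_M}) : {ffun 'I_d.+1 -> 'I_M} :=
  [ffun i => if unlift ord0 i is Some j then ak.2 j else ak.1].
Let funcons d M (k : {ffun 'I_d.+1 -> 'I_M}) : 'I_M * {ffun 'I_d -> 'I_M} :=
  (k ord0, [ffun j => k (lift ord0 j)]).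

Lemma lsum_recl d M z (Phi : R -> R) :
  \sum_(k : {ffun 'I_d.+1 -> 'I_M}) Phi (lsq z k) =
  \sum_(a < M) \sum_(k : {ffun 'I_d -> 'I_M})
    Phi ((a%:R - z 0%N) ^+ 2 + lsq (fun i => z i.+1) k).
Proof.
rewrite pair_big /= (reindex (@fcons d M)) /=.
  apply: eq_bigr => -[a k] _ /=; congr Phi; rewrite /lsq big_ord_recl /fcons.
  rewrite ffunE unlift_none; congr (_ + _); apply: eq_bigr => i _.
  by rewrite ffunE liftK.
exists (@funcons d M) => [[a k] _|k _].
  rewrite /funcons /fcons !ffunE unlift_none; congr (_, _).
  by apply/ffunP => j; rewrite !ffunE liftK.
apply/ffunP => i; rewrite !ffunE.
by case: unliftP => [j ->|->]//=; rewrite ffunE.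
Qed.

Lemma lsum0 M z (Phi : R -> R) :
  \sum_(k : {ffun 'I_0 -> 'I_M}) Phi (lsq z k) = Phi 0.
Proof.
rewrite (eq_bigr (fun=> Phi 0)); last by move=> k _; rewrite /lsq big_ord0.
rewrite sumr_const (_ : #|_| = 1%N) ?mulr1n//.
by rewrite [LHS]card_ffun !card_ord expn0.
Qed.

(** Two coordinates are split off at once to match the recursion of [ball_volume], which descends by
    two dimensions. *)
Lemma lsum_rec2 d M z (Phi : R -> R) :
  \sum_(k : {ffun 'I_d.+2 -> 'I_M}) Phi (lsq z k) =
  \sum_(k2 : {ffun 'I_2 -> 'I_M}) \sum_(k : {ffun 'I_d -> 'I_M})
    Phi (lsq z k2 + lsq (fun i => z i.+2) k).
Proof.
rewrite lsum_recl.
rewrite (lsum_recl _ _ z (fun v => \sum_(k : {ffun 'I_d -> 'I_M})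
    Phi (v + lsq (fun i => z i.+2) k))).
apply: eq_bigr => a _.
rewrite (lsum_recl _ _ _ (fun v => Phi (_ + v))).
rewrite (lsum_recl _ _ _ (fun v => \sum_(k : {ffun 'I_d -> 'I_M})
    Phi (_ + v + lsq (fun i => z i.+2) k))).
apply: eq_bigr => b _; rewrite (lsum0 _ _ (fun v => \sum_(k : {ffun 'I_d -> 'I_M})
    Phi (_ + (_ + v) + lsq (fun i => z i.+2) k))).
by apply: eq_bigr => k _; rewrite addr0 addrA.
Qed.

Lemma lcount_rec1 d M z q : lcount d.+1 M z q =
  \sum_(k1 : {ffun 'I_1 -> 'I_M}) lcount d M (fun i => z i.+1) (q - lsq z k1).
Proof.
rewrite /lcount (lsum_recl _ _ z (fun v => (v <= q)%R%:R)).
rewrite (lsum_recl _ _ z (fun v => \sum_(k : {ffun 'I_d -> 'I_M})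
   (lsq (fun i => z i.+1) k <= q - v)%R%:R)).
apply: eq_bigr => a _; rewrite (lsum0 _ _ (fun v => \sum_(k : {ffun 'I_d -> 'I_M})
   (lsq (fun i => z i.+1) k <= q - (_ + v))%R%:R)).
by apply: eq_bigr => k _; rewrite addr0 lerBrDl.
Qed.

Lemma lcount_rec2 d M z q : lcount d.+2 M z q =
  \sum_(k2 : {ffun 'I_2 -> 'I_M}) lcount d M (fun i => z i.+2) (q - lsq z k2).
Proof.
rewrite /lcount (lsum_rec2 _ _ z (fun v => (v <= q)%R%:R)).
by apply: eq_bigr => k2 _; apply: eq_bigr => k _; rewrite lerBrDl.
Qed.

Lemma count_interval_le M (a b : R) : a <= b ->
  \sum_(i < M) (a <= i%:R <= b)%R%:R <= b - a + 1.
Proof.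
move=> ab.
(* The bound by [M - a] is what the induction needs when the last integer is counted; the empty
   count is kept apart because [M - a] may be negative. *)
suff : \sum_(i < M) (a <= i%:R <= b)%R%:R = 0 :> R \/
   (\sum_(i < M) (a <= i%:R <= b)%R%:R <= b - a + 1 /\
    \sum_(i < M) (a <= i%:R <= b)%R%:R <= M%:R - a).
  by case=> [->|[]//]; lra.
elim: M => [|M IH]; first by left; rewrite big_ord0.
rewrite big_ord_recr /= -natr1; move: IH; set S := \sum_(_ < _) _ => IH.
have [/andP[aM Mb]|_] := boolP (_ && _); first by right; rewrite mulr1n; lra.
by rewrite addr0; case: IH => [->|[]]; [left|right; lra].
Qed.

Lemma count_interval_ge M (a b : R) : 0 <= a -> b <= M%:R - 1 ->
  b - a - 1 <= \sum_(i < M) (a <= i%:R <= b)%R%:R.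
Proof.
move=> a0 bM.
suff : M%:R - 1 - a <= \sum_(i < M) (a <= i%:R <= b)%R%:R \/
   b - 1 - a <= \sum_(i < M) (a <= i%:R <= b)%R%:R.
  by case; lra.
elim: M {bM} => [|M IH]; first by left; rewrite big_ord0; lra.
rewrite big_ord_recr /= -natr1; move: IH.
have : 0 <= \sum_(i < M) (a <= i%:R <= b)%R%:R :> R by apply: sumr_ge0.
set S := \sum_(_ < _) _ => S0 IH.
have [aM|aM] := leP a M%:R; have [Mb|Mb] := leP M%:R b => /=;
  rewrite ?addr0; by case: IH => IH; (try by left; lra); right; lra.
Qed.

Lemma lcount1E M z q : 0 <= q ->
  lcount 1 M z q = \sum_(i < M) (z 0%N - Num.sqrt q <= i%:R <= z 0%N + Num.sqrt q)%R%:R.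
Proof.
move=> q0; rewrite /lcount (lsum_recl _ _ z (fun v => (v <= q)%R%:R)).
apply: eq_bigr => a _.
rewrite (lsum0 _ _ (fun v => ((_ + v) <= q)%R%:R)) addr0; congr (_%:R).
rewrite -{1}(sqr_sqrtr q0) -[in LHS]real_normK ?num_real//.
rewrite ler_pXn2r ?nnegrE ?sqrtr_ge0//= ler_norml; congr (nat_of_bool _).
by apply/idP/idP => /andP[? ?]; apply/andP; split; lra.
Qed.

Lemma lcount1_le M z q : 0 <= q -> lcount 1 M z q <= 2 * Num.sqrt q + 1.
Proof.
move=> q0; rewrite lcount1E//; have := sqrtr_ge0 q => s0.
apply: le_trans (count_interval_le _ _) _; lra.
Qed.

Lemma lcount1_ge M z q : 0 <= q -> Num.sqrt q <= z 0%N ->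
  z 0%N + Num.sqrt q <= M%:R - 1 -> 2 * Num.sqrt q - 1 <= lcount 1 M z q.
Proof.
move=> q0 z1 z2; rewrite lcount1E//.
apply: le_trans (count_interval_ge _ _); lra.
Qed.

End LatticeCount.

(** * Riemann sums for the area of the disc *)

Section TrigSums.
Variable R : realType.

Lemma sin_le_id (x : R) : 0 <= x -> sin x <= x.
Proof.
move=> x0.
have [|c _] := @MVT_segment R sin cos 0 x x0 (fun y _ => is_derive_sin y).
  by apply: continuous_subspaceT => y; exact: continuous_sin.
rewrite sin0 !subr0 => ->; apply: le_trans (ler_wpM2r x0 (cos_le1 c)) _.
by rewrite mul1r.
Qed.

Lemma cos_ge_1B (x : R) : 0 <= x -> 1 - x ^+ 2 <= cos x.
Proof.
move=> x0.
have [|c] := @MVT_segment R cos (fun y => - sin y) 0 x x0 (fun y _ => is_derive_cos y).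
  by apply: continuous_subspaceT => y; exact: continuous_cos.
rewrite in_itv/= => /andP[c0 cx]; rewrite cos0 subr0 => E.
have : sin c * x <= x * x by apply: ler_wpM2r => //; exact: le_trans (sin_le_id c0) cx.
lra.
Qed.

Lemma sin_ge_idB (x : R) : 0 <= x -> x - x ^+ 3 <= sin x.
Proof.
move=> x0.
have [|c] := @MVT_segment R sin cos 0 x x0 (fun y _ => is_derive_sin y).
  by apply: continuous_subspaceT => y; exact: continuous_sin.
rewrite in_itv/= => /andP[c0 cx]; rewrite sin0 !subr0 => ->.
have c2 : c ^+ 2 <= x ^+ 2 by rewrite ler_pXn2r ?nnegrE.
have : (1 - x ^+ 2) * x <= cos c * x.
  by apply: ler_wpM2r => //; have := cos_ge_1B c0; lra.
lra.
Qed.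

Definition quarter_grid (m j : nat) : R := j%:R * (pi / 2 / m%:R).

Section Partition.
Variable m : nat.
Hypothesis m0 : (0 < m)%N.
Local Notation h := (pi / 2 / m%:R : R).
Local Notation th := (quarter_grid m).

Let mR : 0 < m%:R :> R. Proof. by rewrite ltr0n. Qed.
Let h0 : 0 <= h. Proof. by rewrite !divr_ge0// pi_ge0. Qed.
Let thS j : th j.+1 = th j + h. Proof. by rewrite /quarter_grid -natr1 mulrDl mul1r. Qed.
Let thm : th m = pi / 2.
Proof. by rewrite /quarter_grid mulrCA divff ?mulr1// gt_eqF. Qed.
Let th_range j : (j <= m)%N -> 0 <= th j <= pi / 2.
Proof.
move=> jm; rewrite /quarter_grid mulr_ge0//= -[leRHS]thm /quarter_grid; apply: ler_wpM2r => //.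
by rewrite ler_nat.
Qed.

Lemma grid_sin_ge0 j : (j <= m)%N -> 0 <= sin (th j).
Proof.
move=> jm; apply: sin_ge0_pi; have /andP[-> ?] := th_range jm.
have := pi_ge0 R; lra.
Qed.

Lemma grid_cos_ge0 j : (j <= m)%N -> 0 <= cos (th j).
Proof.
move=> jm; apply: cos_ge0_pihalf; have /andP[? ->] := th_range jm.
have := pi_ge0 R; lra.
Qed.

Lemma grid_cos_mono j : (j < m)%N -> cos (th j.+1) <= cos (th j).
Proof.
move=> jm; have /andP[a0 a1] := th_range (ltnW jm).
have /andP[b0 b1] := th_range jm; have := pi_ge0 R => p0.
rewrite leNgt ltr_cos; last 2 first.
- by rewrite in_itv/=; apply/andP; split; lra.
- by rewrite in_itv/=; apply/andP; split; lra.
by rewrite -leNgt thS lerDl.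
Qed.

Lemma grid_sin_mono j : (j < m)%N -> sin (th j) <= sin (th j.+1).
Proof.
move=> jm; have /andP[a0 a1] := th_range (ltnW jm).
have /andP[b0 b1] := th_range jm; have := pi_ge0 R => p0.
rewrite leNgt ltr_sin; last 2 first.
- by rewrite in_itv/=; apply/andP; split; lra.
- by rewrite in_itv/=; apply/andP; split; lra.
by rewrite -leNgt thS lerDl.
Qed.

Let sin_step j : (j < m)%N -> sin (th j.+1) - sin (th j) <= h.
Proof.
move=> jm; rewrite thS sinD.
have := sin_le_id h0; have := cos_le1 h; have := sin_max (th j).
have := cos_le1 (th j); have := grid_sin_ge0 (ltnW jm).
have := grid_cos_ge0 (ltnW jm).
have : 0 <= sin h by apply: sin_ge0_pi; rewrite h0/=; have := pi_ge0 R;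
  have := th_range jm; rewrite thS; have := th_range (ltnW jm); lra.
move=> sh c0 s0 c1 _ ch sh'.
have : sin (th j) * cos h <= sin (th j) by rewrite ler_piMr.
have : cos (th j) * sin h <= sin h by rewrite ler_piMl.
lra.
Qed.

Let telesc (F : nat -> R) n : \sum_(j < n) (F j.+1 - F j) = F n - F 0%N.
Proof.
elim: n => [|n IH]; first by rewrite big_ord0 subrr.
by rewrite big_ord_recr/= IH; ring.
Qed.

Let sum_cos : \sum_(j < m) (cos (th j) - cos (th j.+1)) = 1.
Proof.
have := telesc (fun j => - cos (th j)) m; rewrite thm cos_pihalf /quarter_grid mul0r cos0.
rewrite oppr0 sub0r opprK => E; rewrite -[RHS]E.
by apply: eq_bigr => j _; rewrite opprK addrC.
Qed.

(** An antiderivative of [2 sin^2]; the sums below approximate its integral [pi / 2] over the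
    quarter period. *)
Let F (x : R) := x - sin x * cos x.

Let sum_F : \sum_(j < m) (F (th j.+1) - F (th j)) = pi / 2.
Proof.
rewrite (telesc (fun j => F (th j))) /F thm cos_pihalf /quarter_grid mul0r sin0; lra.
Qed.

(** By [sin x <= x], each summand is at most an increment of [F] plus the product of the increments
    of sine and cosine. The former increment is at most [h] and the latter add up to 1, so the total
    error is at most [h]. *)
Lemma trig_sum_le :
  \sum_(j < m) (cos (th j) - cos (th j.+1)) * (2 * sin (th j.+1)) <= pi / 2 + h.
Proof.
rewrite -[X in _ <= _ + X]mulr1; move: sum_F sum_cos => /esym E1 /esym E2.
rewrite [X in _ <= X + _]E1 [X in _ * X]E2 mulr_sumr -big_split/=.
apply: ler_sum => j _; have jm := ltn_ord j.
have := grid_cos_mono jm; have := sin_step jm; rewrite /F.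
have : sin (th j.+1 - th j) <= th j.+1 - th j.
  by apply: sin_le_id; rewrite thS addrAC subrr add0r.
rewrite sinB; set a := sin (th j); set b := sin (th j.+1).
set c := cos (th j); set e := cos (th j.+1) => H1 H2 H3.
have : (b - a) * (c - e) <= h * (c - e) by apply: ler_wpM2r => //; lra.
lra.
Qed.

Lemma trig_sum_ge :
  pi / 2 - h - pi / 2 * h ^+ 2 <=
  \sum_(j < m) (cos (th j) - cos (th j.+1)) * (2 * sin (th j)).
Proof.
rewrite -[X in _ - X - _]mulr1; move: sum_F sum_cos => /esym E1 /esym E2.
rewrite [X in X - _ - _]E1 [X in _ - _ * X - _]E2.
(* The second error comes from [x - x^3 <= sin x] on each of the [m] cells, where
   [m * h = pi / 2]. *)
have -> : pi / 2 * h ^+ 2 = \sum_(j < m) h ^+ 3.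
  rewrite sumr_const card_ord -[RHS]mulr_natl -[X in X * _ ^+ 2]thm /quarter_grid.
  by set hh := _ / m%:R; ring.
rewrite mulr_sumr -!sumrB; apply: ler_sum => j _; have jm := ltn_ord j.
have := grid_cos_mono jm; have := sin_step jm; rewrite /F.
have E : th j.+1 - th j = h by rewrite thS addrAC subrr add0r.
have : h - h ^+ 3 <= sin (th j.+1 - th j) by rewrite E; exact: sin_ge_idB.
rewrite sinB; move: E; set a := sin (th j); set b := sin (th j.+1).
set c := cos (th j); set e := cos (th j.+1) => E H1 H2 H3.
have : (b - a) * (c - e) <= h * (c - e) by apply: ler_wpM2r => //; lra.
lra.
Qed.

End Partition.
End TrigSums.

(** * Riemann sums for the recursion of the ball volumes *)

Section RadialSums.
Variable R : realType.

(** Young's inequality for the exponents [(d + 2) / 2] and [(d + 2) / d]. It compares a Riemann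
    summand with an increment of the antiderivative [G] below. *)
Lemma young_power d (x y : R) : 0 <= x -> 0 <= y ->
  d.+2%:R * (x ^+ 2 * y ^+ d) <= 2 * x ^+ d.+2 + d%:R * y ^+ d.+2.
Proof.
move=> x0 y0; elim: d => [|d IH]; first by rewrite expr0; lra.
(* This product is the defect for [d + 1] minus [y] times the defect for [d]; both factors change
   sign at [x = y]. *)
have : 0 <= (x - y) * (2 * x ^+ d.+2 - y ^+ d.+1 * (x + y)).
  have [xy|xy] := leP y x.
    apply: mulr_ge0; first by rewrite subr_ge0.
    have : y ^+ d.+1 <= x ^+ d.+1 by rewrite lerXn2r ?nnegrE.
    have : 0 <= y ^+ d.+1 by rewrite exprn_ge0.
    by rewrite [x ^+ d.+2]exprS; nra.
  apply: mulr_le0; first by lra.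
  have : x ^+ d.+1 <= y ^+ d.+1 by rewrite lerXn2r ?nnegrE// ltW.
  have : 0 <= x ^+ d.+1 by rewrite exprn_ge0.
  by rewrite [x ^+ d.+2]exprS; nra.
have := ler_wpM2l y0 IH; rewrite -[d.+3%:R]natr1 -[d.+1%:R]natr1.
rewrite ![_ ^+ d.+3]exprS ![_ ^+ d.+2]exprS ![_ ^+ d.+1]exprS.
set X := x ^+ d; set Y := y ^+ d; set D := d.+2%:R.
rewrite (_ : d%:R = D - 2); last by rewrite /D -addn2 natrD addrK.
lra.
Qed.

(** In the unit ball, the radius left to the other coordinates when two of them use up the squared
    radius [j / m]. *)
Definition radial_grid (m j : nat) : R := Num.sqrt (1 - j%:R / m%:R).

Section Partition.
Variables (d m : nat).
Hypothesis m0 : (0 < m)%N.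
Hypothesis d0 : (0 < d)%N.
Local Notation X := (radial_grid m).

Let mR : 0 < m%:R :> R. Proof. by rewrite ltr0n. Qed.

Let X2 j : (j <= m)%N -> X j ^+ 2 = 1 - j%:R / m%:R.
Proof.
by move=> jm; rewrite /radial_grid sqr_sqrtr// subr_ge0 ler_pdivrMr// mul1r ler_nat.
Qed.

Let X0 j : 0 <= X j. Proof. exact: sqrtr_ge0. Qed.

Let telesc (F : nat -> R) n : \sum_(j < n) (F j - F j.+1) = F 0%N - F n.
Proof.
elim: n => [|n IH]; first by rewrite big_ord0 subrr.
by rewrite big_ord_recr/= IH; ring.
Qed.

Let Xz : X 0 = 1. Proof. by rewrite /radial_grid mul0r subr0 sqrtr1. Qed.
Let Xm : X m = 0. Proof. by rewrite /radial_grid divff ?subrr ?sqrtr0// gt_eqF. Qed.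

(** An antiderivative of [d x^(d-1) (1 - x^2)]; its increment [2 / (d + 2)] over the unit interval
    is the quotient of [V_(d+2)] by [pi V_d]. *)
Let G (x : R) := x ^+ d - d%:R / d.+2%:R * x ^+ d.+2.

Let sum_G : \sum_(j < m) (G (X j) - G (X j.+1)) = 2 / d.+2%:R.
Proof.
rewrite (telesc (fun j => G (X j))) Xz Xm /G !expr1n !expr0n/=.
rewrite gtn_eqF// mulr1 mulr0 !subr0 -addn2 natrD.
have : d%:R + 2 != 0 :> R by rewrite gt_eqF// ltr_wpDl.
by move=> ?; field.
Qed.

Let sum_X : \sum_(j < m) (X j ^+ d - X j.+1 ^+ d) = 1.
Proof.
by rewrite (telesc (fun j => X j ^+ d)) Xz Xm expr1n expr0n/= gtn_eqF// subr0.
Qed.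

Let D0 : 0 < d.+2%:R :> R. Proof. by rewrite ltr0n. Qed.

Lemma radial_sum_le :
  \sum_(j < m) (X j ^+ d - X j.+1 ^+ d) * (j.+1%:R / m%:R) <=
  2 / d.+2%:R + m%:R^-1.
Proof.
rewrite -[X in _ <= _ + X]mulr1; move: sum_G sum_X => /esym S1 /esym S2.
rewrite [X in _ <= X + _]S1 [X in _ * X]S2 mulr_sumr -big_split/=.
apply: ler_sum => j _; have jm := ltn_ord j.
have E1 := X2 jm; have E0 := X2 (ltnW jm).
have := young_power d (X0 j) (X0 j.+1).
have -> : j.+1%:R / m%:R = 1 - X j.+1 ^+ 2 by lra.
have -> : m%:R^-1 = X j ^+ 2 - X j.+1 ^+ 2.
  by rewrite E0 E1 -natr1 mulrDl mul1r; lra.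
rewrite /G; move: (X j) (X j.+1) => x y.
rewrite -(ler_pdivlMl _ _ D0) mulrDr [_ * (2 * _)]mulrA [_ * (d%:R * _)]mulrA.
rewrite ![_^-1 * _%:R]mulrC (_ : 2 / d.+2%:R = 1 - d%:R / d.+2%:R); last first.
  have := gt_eqF D0 => /negbT.
  by rewrite -(addn2 d) natrD => ?; field.
set c := d%:R / d.+2%:R.
rewrite ![_ ^+ d.+2]exprS ![_ ^+ d.+1]exprS; lra.
Qed.

Lemma radial_sum_ge :
  2 / d.+2%:R - m%:R^-1 <=
  \sum_(j < m) (X j ^+ d - X j.+1 ^+ d) * (j%:R / m%:R).
Proof.
rewrite -[X in _ - X <= _]mulr1; move: sum_G sum_X => /esym S1 /esym S2.
rewrite [X in X - _ <= _]S1 [X in _ * X]S2 mulr_sumr -sumrB/=.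
apply: ler_sum => j _; have jm := ltn_ord j.
have E1 := X2 jm; have E0 := X2 (ltnW jm).
have := young_power d (X0 j.+1) (X0 j).
have -> : j%:R / m%:R = 1 - X j ^+ 2 by lra.
have -> : m%:R^-1 = X j ^+ 2 - X j.+1 ^+ 2.
  by rewrite E0 E1 -natr1 mulrDl mul1r; lra.
rewrite /G; move: (X j) (X j.+1) => x y.
rewrite -(ler_pdivlMl _ _ D0) mulrDr [_ * (2 * _)]mulrA [_ * (d%:R * _)]mulrA.
rewrite ![_^-1 * _%:R]mulrC (_ : 2 / d.+2%:R = 1 - d%:R / d.+2%:R); last first.
  have := gt_eqF D0 => /negbT.
  by rewrite -(addn2 d) natrD => ?; field.
set c := d%:R / d.+2%:R.
rewrite ![_ ^+ d.+2]exprS ![_ ^+ d.+1]exprS; lra.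
Qed.

End Partition.
End RadialSums.

Section SumDiff.
Variable R : realType.
Lemma sum_diff (F : nat -> R) n : \sum_(j < n) (F j - F j.+1) = F 0%N - F n.
Proof.
elim: n => [|n IH]; first by rewrite big_ord0 subrr.
by rewrite big_ord_recr/= IH; ring.
Qed.
End SumDiff.

(** * Lattice points in discs *)

Section GaussCircle.
Variable R : realType.
Variables (M m : nat) (z : nat -> R) (q : R).
Hypotheses (q0 : 0 <= q) (m0 : (0 < m)%N).

Local Notation th := (quarter_grid R m).
Local Notation hm := (pi / 2 / m%:R : R).
(** With these levels the half-chord [h (u j)] is [sqrt q * cos (th j)] and [sqrt (u j)] is
    [sqrt q * sin (th j)], so the layer sum becomes [q] times a trigonometric sum. *)
Let u (j : nat) : R := q * sin (th j) ^+ 2.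
Let h (x : R) : R := Num.sqrt (q - x).

Let mR : 0 < m%:R :> R. Proof. by rewrite ltr0n. Qed.
Let th0 : th 0 = 0. Proof. by rewrite /quarter_grid mul0r. Qed.
Let thm : th m = pi / 2.
Proof. by rewrite /quarter_grid mulrCA divff ?gt_eqF// mulr1. Qed.
Let u0 : u 0 = 0.
Proof. by rewrite /u th0 sin0 expr0n mulr0. Qed.
Let um : u m = q.
Proof. by rewrite /u thm sin_pihalf expr1n mulr1. Qed.
Let uS j : (j < m)%N -> u j <= u j.+1.
Proof.
move=> jm; apply: ler_wpM2l => //; rewrite ler_pXn2r ?nnegrE ?grid_sin_ge0//.
- exact: grid_sin_mono.
- exact: ltnW.
Qed.
Let u_ge0 j : 0 <= u j. Proof. by rewrite mulr_ge0// sqr_ge0. Qed.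
Let u_le j : u j <= q.
Proof.
by rewrite /u ler_piMr.
Qed.
Let h_mono x y : u 0 <= x -> x <= y -> y <= u m -> h y <= h x.
Proof. by move=> _ xy _; apply: ler_wsqrtr; lra. Qed.
Let hu j : (j <= m)%N -> h (u j) = Num.sqrt q * cos (th j).
Proof.
move=> jm; rewrite /h /u (_ : q - _ = q * cos (th j) ^+ 2); last first.
  by rewrite cos2sin2; ring.
by rewrite sqrtrM// sqrtr_sqr ger0_norm// grid_cos_ge0.
Qed.
Let sqrt_u j : (j <= m)%N -> Num.sqrt (u j) = Num.sqrt q * sin (th j).
Proof. by move=> jm; rewrite sqrtrM// sqrtr_sqr ger0_norm// grid_sin_ge0. Qed.
Let hm0 : h (u m) = 0. Proof. by rewrite um /h subrr sqrtr0. Qed.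
Let s0 : 0 <= Num.sqrt q. Proof. exact: sqrtr_ge0. Qed.
Let qE : Num.sqrt q ^+ 2 = q. Proof. exact: sqr_sqrtr. Qed.

Let sum_cos : \sum_(j < m) (cos (th j) - cos (th j.+1)) = 1.
Proof. by rewrite (sum_diff (fun j => cos (th j))) th0 thm cos0 cos_pihalf subr0. Qed.

Lemma lcount2_le :
  lcount 2 M z q <= (pi + pi / m%:R) * q + 4 * Num.sqrt q + 1.
Proof.
pose r := @lsq R 1 M z.
(* Each slice is an interval of half-length [h (r k)], with at most [2 h (r k) + 1] integers; the
   ones add up to the number [lcount 1 M z q] of slices that can be nonempty. *)
have : lcount 2 M z q <= 2 * \sum_(k | u 0%N <= r k <= u m) h (r k) + lcount 1 M z q.
  rewrite (lcount_rec1 1) mulr_sumr (big_mkcond (fun k => u 0%N <= r k <= u m)).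
  rewrite -big_split; apply: ler_sum => k _ /=.
  rewrite u0 um lsq_ge0/=; have [rq|rq] := leP (r k) q.
    by apply: lcount1_le; rewrite subr_ge0.
  by rewrite lcount_neg ?subr_lt0// addr0.
have := layer_upper r uS h_mono; rewrite hm0 mul0r add0r => /(_ (lexx _)).
set S := \sum_(k | _) _ => HS H.
have HS' : S <= (pi / 2 + hm) * q + Num.sqrt q.
  apply: le_trans HS _.
  have -> : (pi / 2 + hm) * q + Num.sqrt q =
     q * (pi / 2 + hm) +
     Num.sqrt q * \sum_(j < m) (cos (th j) - cos (th j.+1)).
    by rewrite sum_cos mulrC mulr1.
  apply: le_trans (lerD (ler_wpM2l q0 (trig_sum_le R m0)) (lexx _)).
  rewrite !mulr_sumr -big_split; apply: ler_sum => j _ /=; have jm := ltn_ord j.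
  rewrite !hu//; last exact: ltnW.
  have c0 := grid_cos_mono R m0 jm.
  have N1 : lcount 1 M z (u j.+1) <= 2 * (Num.sqrt q * sin (th j.+1)) + 1.
    by rewrite -sqrt_u//; exact: lcount1_le.
  rewrite -mulrBr -[X in X * (_ * (2 * _))]qE.
  have : 0 <= Num.sqrt q * (cos (th j) - cos (th j.+1)).
    by rewrite mulr_ge0// subr_ge0.
  move=> /(ler_wpM2l)/(_ _ _ N1) => Hf; apply: le_trans Hf _; rewrite expr2; lra.
have N1 := lcount1_le M z q0.
have -> : pi / m%:R = 2 * hm :> R.
  by rewrite mulrA [2 * _]mulrC divfK ?pnatr_eq0.
lra.
Qed.

Lemma lcount2_ge :
  (forall i, (i < 2)%N -> Num.sqrt q <= z i /\ z i + Num.sqrt q <= M%:R - 1) ->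
  (pi - pi / m%:R - pi * hm ^+ 2) * q - 4 * Num.sqrt q - 1 <= lcount 2 M z q.
Proof.
move=> zr; pose r := @lsq R 1 M z.
have : 2 * \sum_(k | u 0%N <= r k <= u m) h (r k) - lcount 1 M z q <= lcount 2 M z q.
  rewrite (lcount_rec1 1) mulr_sumr (big_mkcond (fun k => u 0%N <= r k <= u m)).
  rewrite [X in _ - X <= _]/lcount -sumrB; apply: ler_sum => k _ /=.
  rewrite u0 um lsq_ge0/=; have [rq|rq] := leP (r k) q.
    have [z1 z2] := zr 1%N isT.
    have sr : Num.sqrt (q - r k) <= Num.sqrt q.
      by apply: ler_wsqrtr; have : 0 <= r k by [exact: lsq_ge0]; lra.
    apply: lcount1_ge; first by rewrite subr_ge0.
      exact: le_trans sr z1.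
    by apply: le_trans z2; rewrite lerD2l.
  by rewrite subr0 lcount_ge0.
have := layer_lower r uS h_mono; rewrite hm0 mul0r add0r.
have -> : \sum_t (r t < u 0%N)%R%:R = 0 :> R.
  by apply: big1 => k _; rewrite u0 ltNge lsq_ge0.
rewrite mulr0 addr0.
set S := \sum_(k | u 0%N <= r k <= u m) _ => HS H.
have HS' : (pi / 2 - hm - pi / 2 * hm ^+ 2) * q - Num.sqrt q <= S.
  apply: le_trans _ HS.
  have -> : (pi / 2 - hm - pi / 2 * hm ^+ 2) * q - Num.sqrt q =
     q * (pi / 2 - hm - pi / 2 * hm ^+ 2) -
     Num.sqrt q * \sum_(j < m) (cos (th j) - cos (th j.+1)).
    by rewrite sum_cos mulrC mulr1.
  apply: le_trans (lerB (ler_wpM2l q0 (trig_sum_ge R m0)) (lexx _)) _.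
  rewrite !mulr_sumr -sumrB; apply: ler_sum => j _ /=; have jm := ltn_ord j.
  rewrite !hu//; last exact: ltnW.
  have c0 := grid_cos_mono R m0 jm.
  have N1 : 2 * (Num.sqrt q * sin (th j)) - 1 <= lcount 1 M z (u j).
    rewrite -sqrt_u ?(ltnW jm)//; have [z1 z2] := zr 0%N isT.
    have su : Num.sqrt (u j) <= Num.sqrt q by apply: ler_wsqrtr.
    by apply: lcount1_ge => //; lra.
  rewrite -mulrBr -[X in X * (_ * (2 * _))]qE.
  have : 0 <= Num.sqrt q * (cos (th j) - cos (th j.+1)).
    by rewrite mulr_ge0// subr_ge0.
  move=> /(ler_wpM2l)/(_ _ _ N1) => Hf; apply: le_trans _ Hf; rewrite expr2; lra.
have N1 := lcount1_le M z q0.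
have -> : pi / m%:R = 2 * hm :> R.
  by rewrite mulrA [2 * _]mulrC divfK ?pnatr_eq0.
lra.
Qed.

End GaussCircle.

(** * Lattice points in balls of any dimension *)

Section LatticeAsymptotics.
Variable R : realType.

Lemma inv_nat_le (e : R) : 0 < e -> exists2 m, (0 < m)%N & m%:R^-1 <= e.
Proof.
move=> e0; exists (Num.bound e^-1).+1 => //.
rewrite -[leRHS]invrK lef_pV2 ?posrE ?invr_gt0//.
apply: le_trans (ltW (archi_boundP _)) _; first by rewrite invr_ge0 ltW.
by rewrite ler_nat.
Qed.

Lemma ball_volume_gt0 d : 0 < ball_volume R d.
Proof.
suff : 0 < ball_volume R d /\ 0 < ball_volume R d.+1 by case.
elim: d => [|d [IH1 IH2]]; first by split => /=.
split => //=; rewrite mulr_gt0// divr_gt0// mulr_gt0// ?pi_gt0//.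
Qed.

(** The errors of the induction step have orders [d] and 2, both below [d + 2]: beyond [T] they are
    absorbed by [e], before [T] by the constant. *)
Lemma mix_bound d (a b e : R) : (0 < d)%N -> 0 <= a -> 0 <= b -> 0 < e ->
  exists2 C, 0 <= C &
    forall t, 0 <= t -> a * t ^+ d + b * t ^+ 2 <= e * t ^+ d.+2 + C.
Proof.
move=> d0 a0 b0 e0; pose T := 1 + (a + b) / e.
have T1 : 1 <= T by rewrite lerDl divr_ge0 ?addr_ge0// ltW.
have T0 : 0 <= T by lra.
have eT : a + b <= e * T.
  by rewrite /T mulrDr mulr1 mulrC divfK ?gt_eqF// lerDr ltW.
exists (a * T ^+ d + b * T ^+ 2).
  by rewrite addr_ge0// mulr_ge0// exprn_ge0.
move=> t t0; have [tT|tT] := leP t T.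
  apply: (@le_trans _ _ (a * T ^+ d + b * T ^+ 2)).
    by apply: lerD; apply: ler_wpM2l => //; apply: lerXn2r; rewrite ?nnegrE.
  by rewrite lerDr mulr_ge0 ?exprn_ge0// ltW.
have t1 : 1 <= t by lra.
have td : T <= t ^+ d.
  by apply: le_trans (ltW tT) _; rewrite -[leLHS]expr1 ler_weXn2l.
have t2 : T <= t ^+ 2.
  by apply: le_trans (ltW tT) _; rewrite -[leLHS]expr1 ler_weXn2l.
have t2d : t ^+ d.+2 = t ^+ d * t ^+ 2 by rewrite -exprD addn2.
have P2 : 0 <= t ^+ 2 by rewrite exprn_ge0.
have Pd : 0 <= t ^+ d by rewrite exprn_ge0.
have H1 : T * t ^+ d <= t ^+ d.+2 by rewrite t2d mulrC; apply: ler_wpM2l.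
have H2 : T * t ^+ 2 <= t ^+ d.+2 by rewrite t2d; apply: ler_wpM2r.
have H0 : 0 <= a * T ^+ d + b * T ^+ 2.
  by rewrite addr_ge0// mulr_ge0// exprn_ge0.
have T_gt0 : 0 < T by lra.
apply: (@le_trans _ _ (e * t ^+ d.+2)); last by rewrite lerDl.
rewrite -(ler_pM2l T_gt0) mulrDr.
have : (a + b) * t ^+ d.+2 <= e * T * t ^+ d.+2.
  by apply: ler_wpM2r => //; rewrite exprn_ge0.
have := ler_wpM2l a0 H1; have := ler_wpM2l b0 H2; lra.
Qed.

Section Step.
Variables (d m M : nat) (z : nat -> R) (q V P C1 C2 : R).
Hypotheses (d0 : (0 < d)%N) (m0 : (0 < m)%N) (q0 : 0 <= q).
Hypotheses (V0 : 0 <= V) (P0 : 0 <= P) (C10 : 0 <= C1) (C20 : 0 <= C2).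

Local Notation X := (radial_grid R m).
Let u (j : nat) : R := q * (j%:R / m%:R).
Let h (x : R) : R := Num.sqrt (q - x) ^+ d.
Let mR : 0 < m%:R :> R. Proof. by rewrite ltr0n. Qed.
Let u0 : u 0 = 0. Proof. by rewrite /u mul0r mulr0. Qed.
Let um : u m = q. Proof. by rewrite /u divff ?mulr1// gt_eqF. Qed.
Let uS j : (j < m)%N -> u j <= u j.+1.
Proof.
by move=> jm; apply: ler_wpM2l => //; apply: ler_wpM2r; rewrite ?ler_nat.
Qed.
Let u_ge0 j : 0 <= u j. Proof. by rewrite mulr_ge0// divr_ge0// ltW. Qed.
Let h_mono x y : u 0 <= x -> x <= y -> y <= u m -> h y <= h x.
Proof.
move=> _ xy _; apply: lerXn2r; rewrite ?nnegrE ?sqrtr_ge0//.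
by apply: ler_wsqrtr; lra.
Qed.
Let hu j : h (u j) = Num.sqrt q ^+ d * X j ^+ d.
Proof.
rewrite /h /u (_ : q - _ = q * (1 - j%:R / m%:R)); last by ring.
by rewrite sqrtrM// exprMn.
Qed.
Let hm0 : h (u m) = 0.
Proof. by rewrite um /h subrr sqrtr0 expr0n gtn_eqF. Qed.
Let s0 : 0 <= Num.sqrt q ^+ d. Proof. by rewrite exprn_ge0// sqrtr_ge0. Qed.
Let qE : Num.sqrt q ^+ d.+2 = Num.sqrt q ^+ d * q.
Proof. by rewrite -addn2 exprD sqr_sqrtr. Qed.
Let X_mono j : (j < m)%N -> X j.+1 ^+ d <= X j ^+ d.
Proof.
move=> jm; apply: lerXn2r; rewrite ?nnegrE ?sqrtr_ge0//.
apply: ler_wsqrtr; rewrite lerD2l lerN2.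
by apply: ler_wpM2r; rewrite ?invr_ge0 ?ler_nat// ltW.
Qed.
Let sum_X : \sum_(j < m) (X j ^+ d - X j.+1 ^+ d) = 1.
Proof.
rewrite (sum_diff (fun j => X j ^+ d)) /radial_grid mul0r subr0 sqrtr1 expr1n.
by rewrite divff ?gt_eqF// subrr sqrtr0 expr0n gtn_eqF// subr0.
Qed.

(** The slices over the first two coordinates are [d]-dimensional balls of squared radius [q - r k].
    The layers at the levels [q * j / m] involve only planar counts, and [radial_sum_le] evaluates
    what remains. *)
Lemma lcount_step_le :
  (forall z q, 0 <= q -> lcount d M z q <= V * Num.sqrt q ^+ d + C1) ->
  (forall q', 0 <= q' -> lcount 2 M z q' <= P * q' + C2) ->
  lcount d.+2 M z q <=
    V * (P * (2 / d.+2%:R + m%:R^-1) * Num.sqrt q ^+ d.+2 +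
      C2 * Num.sqrt q ^+ d) + C1 * (P * q + C2).
Proof.
move=> Hd H2; pose r := @lsq R 2 M z.
have : lcount d.+2 M z q <=
    V * \sum_(k | u 0%N <= r k <= u m) h (r k) + C1 * lcount 2 M z q.
  rewrite (lcount_rec2 d) !mulr_sumr.
  rewrite (big_mkcond (fun k => u 0%N <= r k <= u m)).
  rewrite -big_split; apply: ler_sum => k _ /=.
  rewrite u0 um lsq_ge0/=; have [rq|rq] := leP (r k) q.
    by rewrite mulr1; apply: Hd; rewrite subr_ge0.
  by rewrite lcount_neg ?subr_lt0// mulr0 addr0.
have := layer_upper r uS h_mono; rewrite hm0 mul0r add0r => /(_ (lexx _)).
set S := \sum_(k | u 0%N <= r k <= u m) _ => HS H.
apply: le_trans H _; apply: lerD; last by apply: ler_wpM2l => //; exact: H2.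
apply: ler_wpM2l => //; apply: le_trans HS _.
apply: (@le_trans _ _ (Num.sqrt q ^+ d * (P * q * (\sum_(j < m)
    (X j ^+ d - X j.+1 ^+ d) * (j.+1%:R / m%:R)) + C2 *
    \sum_(j < m) (X j ^+ d - X j.+1 ^+ d)))); last first.
  rewrite sum_X mulr1 mulrDr qE; apply: lerD; last by rewrite mulrC.
  have := ler_wpM2l (mulr_ge0 (mulr_ge0 s0 P0) q0) (radial_sum_le R m0 d0).
  by set SS := \sum_(_ < _) _; set cc := _ / _ + _; lra.
rewrite !mulr_sumr -big_split mulr_sumr; apply: ler_sum => j _ /=.
have jm := ltn_ord j; rewrite !hu -mulrBr -[leLHS]mulrA; apply: ler_wpM2l => //.
have := H2 _ (u_ge0 j.+1) => /(ler_wpM2l (_ : 0 <= X j ^+ d - X j.+1 ^+ d)) H.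
by apply: le_trans (H _) _; rewrite ?subr_ge0 ?X_mono// /u; lra.
Qed.

(** The slice error [C1] is incurred once per lattice point of the planar disc; hence an upper bound
    of the planar count, with [P'] and [C2'], enters a lower bound. *)
Lemma lcount_step_ge (P' C2' : R) : 0 <= P' -> 0 <= C2' ->
  (forall i, (i < d.+2)%N -> Num.sqrt q <= z i /\ z i + Num.sqrt q <= M%:R - 1) ->
  (forall z q, 0 <= q ->
    (forall i, (i < d)%N -> Num.sqrt q <= z i /\ z i + Num.sqrt q <= M%:R - 1) ->
    V * Num.sqrt q ^+ d - C1 <= lcount d M z q) ->
  (forall q', 0 <= q' -> 
    (forall i, (i < 2)%N -> Num.sqrt q' <= z i /\ z i + Num.sqrt q' <= M%:R - 1) ->
   P * q' - C2 <= lcount 2 M z q') ->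
  lcount 2 M z q <= P' * q + C2' ->
  V * (P * (2 / d.+2%:R - m%:R^-1) * Num.sqrt q ^+ d.+2 -
      C2 * Num.sqrt q ^+ d) - C1 * (P' * q + C2') <= lcount d.+2 M z q.
Proof.
move=> P'0 C2'0 zr Hd H2 H2'; pose r := @lsq R 2 M z.
have : V * \sum_(k | u 0%N <= r k <= u m) h (r k) - C1 * lcount 2 M z q <=
    lcount d.+2 M z q.
  rewrite (lcount_rec2 d) !mulr_sumr.
  rewrite (big_mkcond (fun k => u 0%N <= r k <= u m)).
  rewrite -sumrB; apply: ler_sum => k _ /=.
  rewrite u0 um lsq_ge0/=; have [rq|rq] := leP (r k) q.
    rewrite mulr1; apply: Hd => [|i id]; first by rewrite subr_ge0.
    have [z1 z2] := zr i.+2 id.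
    have sr : Num.sqrt (q - r k) <= Num.sqrt q.
      by apply: ler_wsqrtr; have : 0 <= r k by [exact: lsq_ge0]; lra.
    by split; [exact: le_trans sr z1|apply: le_trans z2; rewrite lerD2l].
  by rewrite mulr0 subr0 lcount_ge0.
have := layer_lower r uS h_mono; rewrite hm0 mul0r add0r.
have -> : \sum_t (r t < u 0%N)%R%:R = 0 :> R.
  by apply: big1 => k _; rewrite u0 ltNge lsq_ge0.
rewrite mulr0 addr0.
set S := \sum_(k | u 0%N <= r k <= u m) _ => HS H.
apply: le_trans _ H; apply: lerB; last exact: ler_wpM2l.
apply: ler_wpM2l => //; apply: le_trans _ HS.
apply: (@le_trans _ _ (Num.sqrt q ^+ d * (P * q * (\sum_(j < m)
    (X j ^+ d - X j.+1 ^+ d) * (j%:R / m%:R)) - C2 *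
    \sum_(j < m) (X j ^+ d - X j.+1 ^+ d)))).
  rewrite sum_X mulr1 [leRHS]mulrBr qE; apply: lerB; last by rewrite mulrC.
  have := ler_wpM2l (mulr_ge0 (mulr_ge0 s0 P0) q0) (radial_sum_ge R m0 d0).
  by set SS := \sum_(_ < _) _; set cc := _ / _ - _; lra.
rewrite !mulr_sumr -sumrB mulr_sumr; apply: ler_sum => j _ /=.
have jm := ltn_ord j; rewrite !hu -mulrBr -[leRHS]mulrA; apply: ler_wpM2l => //.
have uq : Num.sqrt (u j) <= Num.sqrt q.
  apply: ler_wsqrtr; rewrite /u; apply: ler_piMr => //.
  by rewrite ler_pdivrMr// mul1r ler_nat ltnW.
have := H2 _ (u_ge0 j) => /(_ _)/(ler_wpM2l (_ : 0 <= X j ^+ d - X j.+1 ^+ d)) {}H.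
apply: le_trans (H _ _); rewrite ?subr_ge0 ?X_mono// /u; first by lra.
by move=> i i2; have [|z1 z2] := zr i; [lia|split; lra].
Qed.

End Step.

(** The constant is uniform in the box and the centre: the induction uses it for all slices at once,
    and later the centre is an arbitrary point of a configuration. *)
Definition lcount_upper d := forall e : R, 0 < e -> exists2 C, 0 <= C &
  forall M z q, 0 <= q ->
    lcount d M z q <= (ball_volume R d + e) * Num.sqrt q ^+ d + C.

Definition lcount_lower d := forall e : R, 0 < e -> exists2 C, 0 <= C &
  forall M z q, 0 <= q ->
    (forall i, (i < d)%N -> Num.sqrt q <= z i /\ z i + Num.sqrt q <= M%:R - 1) ->
    (ball_volume R d - e) * Num.sqrt q ^+ d - C <= lcount d M z q.

Let V2E : ball_volume R 2 = pi. Proof. by rewrite /= mulr1 mulrAC divff ?mul1r. Qed.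

Let sqrt_absorb (e t : R) : 0 < e -> 4 * t <= e * t ^+ 2 + 4 / e.
Proof.
move=> e0; have : 0 <= (e * t - 2) ^+ 2 / e by rewrite divr_ge0 ?sqr_ge0// ltW.
rewrite (_ : (e * t - 2) ^+ 2 / e = e * t ^+ 2 + 4 / e - 4 * t); first by lra.
by field; rewrite gt_eqF.
Qed.

Lemma lcount_asymp2 : lcount_upper 2 /\ lcount_lower 2.
Proof.
have p0 := pi_gt0 R.
split=> e e0.
  have [m m0 me] := @inv_nat_le (e / 2 / pi) ltac:(by rewrite !divr_gt0).
  exists (1 + 4 / (e / 2)); first by rewrite addr_ge0// !divr_ge0// ltW.
  move=> M z q q0; apply: le_trans (lcount2_le _ _ q0 m0) _.
  have := sqrt_absorb (Num.sqrt q) (_ : 0 < e / 2); rewrite divr_gt0// => /(_ isT).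
  rewrite V2E sqr_sqrtr// => H.
  have : pi / m%:R * q <= e / 2 * q.
    by apply: ler_wpM2r => //; rewrite mulrC -ler_pdivlMr.
  lra.
have [m m0 me] := @inv_nat_le (Num.min 1 (e / (2 * (pi + pi ^+ 3)))) ltac:(
  by rewrite lt_min ltr01 !divr_gt0// mulr_gt0// addr_gt0// exprn_gt0).
exists (1 + 4 / (e / 2)); first by rewrite addr_ge0// !divr_ge0// ltW.
move=> M z q q0 zr; apply: le_trans (lcount2_ge q0 m0 zr).
have := sqrt_absorb (Num.sqrt q) (_ : 0 < e / 2); rewrite divr_gt0// => /(_ isT).
rewrite V2E sqr_sqrtr// => H.
suff : (pi / m%:R + pi * (pi / 2 / m%:R) ^+ 2) * q <= e / 2 * q by lra.
apply: ler_wpM2r => //; move: me; rewrite le_min => /andP[].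
rewrite ler_pdivlMr; last by rewrite mulr_gt0// addr_gt0// exprn_gt0.
have : 0 <= m%:R^-1 :> R by rewrite invr_ge0.
move: (m%:R^-1) => x x0 x1 Hx.
have : pi ^+ 3 * (x * x) <= pi ^+ 3 * x.
  by apply: ler_wpM2l; [rewrite exprn_ge0// ltW|rewrite ler_piMr].
have : 0 <= pi ^+ 3 * x by rewrite mulr_ge0// exprn_ge0// ltW.
by rewrite !exprMn; lra.
Qed.

Lemma lcount_asymp1 : lcount_upper 1 /\ lcount_lower 1.
Proof.
split=> e e0; exists 1 => // M z q q0; rewrite expr1; have s0 := sqrtr_ge0 q.
  have := mulr_ge0 (ltW e0) s0; have := lcount1_le M z q0; rewrite /=; lra.
move=> /(_ 0%N isT)[z1 z2]; have := lcount1_ge q0 z1 z2.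
have := mulr_ge0 (ltW e0) s0; rewrite /=; lra.
Qed.

Let small_product (V p c e : R) : 0 < V -> 0 < p -> 0 < c -> 0 < e ->
  exists2 n : R, 0 < n & [/\ n <= V, n <= p,
    (V + n) * (p + n) * (c + n) <= V * p * c + e &
    V * p * c - e <= (V - n) * (p - n) * (c - n)].
Proof.
move=> V0 p0 c0 e0.
pose K := (V + 1) * (p + 1) * (c + 1).
have K0 : 0 < K by apply: mulr_gt0; [apply: mulr_gt0|]; lra.
pose n := Num.min (Num.min V p) (Num.min (Num.min c 1) (e / (3 * K))).
have n0 : 0 < n by rewrite !lt_min V0 p0 c0 ltr01 divr_gt0 //; lra.
exists n => //.
have : n <= n by [].
rewrite {2}/n !le_min => /andP[/andP[nV np]] /andP[/andP[nc n1]].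
have K3 : 0 < 3 * K by lra.
rewrite (ler_pdivlMr _ _ K3) => nK.
have VpK : V * p <= K.
  by apply: (@le_trans _ _ ((V + 1) * (p + 1) * 1)); [nra|apply: ler_wpM2l; nra].
have pcK : p * c <= K.
  have : 1 * (p * c) <= (V + 1) * ((p + 1) * (c + 1)).
    by apply: ler_pM => //; [nra|lra|nra].
  rewrite /K; lra.
have VcK : V * c <= K.
  have : 1 * (V * c) <= (p + 1) * ((V + 1) * (c + 1)).
    by apply: ler_pM => //; [nra|lra|nra].
  rewrite /K; lra.
split => //.
- have : (V + n) * (p + n) * (c + n) - V * p * c <= n * (3 * K).
    have H1 : (V + n) * (p + n) * n <= n * K.
      rewrite mulrC ler_wpM2l ?(ltW n0)//.
      apply: (@le_trans _ _ ((V + 1) * (p + 1) * 1)).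
        rewrite mulr1; apply: ler_pM; lra.
      by apply: ler_wpM2l; nra.
    have H2 : (V + n) * n * c <= n * K.
      rewrite mulrAC mulrC ler_wpM2l ?(ltW n0)//.
      apply: (@le_trans _ _ ((V + 1) * (c + 1))); first by apply: ler_pM; lra.
      have : 1 * ((V + 1) * (c + 1)) <= (p + 1) * ((V + 1) * (c + 1)).
        by apply: ler_wpM2r; nra.
      rewrite /K; lra.
    have H3 : n * p * c <= n * K by rewrite -mulrA ler_wpM2l// ltW.
    lra.
  lra.
- have H1 : n * (p * c) <= n * K by rewrite ler_wpM2l// ltW.
  have H2 : n * (V * c) <= n * K by rewrite ler_wpM2l// ltW.
  have H3 : n * (V * p) <= n * K by rewrite ler_wpM2l// ltW.
  have H4 : 0 <= n * n * (V + p + c - n).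
    by rewrite mulr_ge0 ?mulr_ge0 ?(ltW n0)//; lra.
  lra.
Qed.

Lemma lcount_asympSS d : (0 < d)%N -> lcount_upper d /\ lcount_lower d ->
  lcount_upper d.+2 /\ lcount_lower d.+2.
Proof.
move=> d0 [Ud Ld]; have [U2 L2] := lcount_asymp2.
have V0 := ball_volume_gt0 d; have p0 := pi_gt0 R.
set V := ball_volume R d in V0 *.
pose c : R := 2 / d.+2%:R; have c0 : 0 < c by rewrite divr_gt0.
have VE : ball_volume R d.+2 = V * pi * c by rewrite /= /c -/V; ring.
have suf (e : R) : 0 < e -> 0 < e / 2 by move=> ?; rewrite divr_gt0.
split=> e e0.
- have [n n0 [nV np Hn _]] := small_product V0 p0 c0 (suf _ e0).
  have Vn0 : 0 <= V + n by lra.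
  have pn0 : 0 <= pi + n by lra.
  have [C1 C10 H1] := Ud _ n0; have [C2 C20 H2] := U2 _ n0.
  have [m m0 mn] := inv_nat_le n0.
  have [C C0 HC] := @mix_bound d ((V + n) * C2) (C1 * (pi + n)) _ d0
    (mulr_ge0 Vn0 C20) (mulr_ge0 C10 pn0) (suf _ e0).
  exists (C + C1 * C2); first by rewrite addr_ge0 ?mulr_ge0.
  move=> M z q q0.
  have s0 := sqrtr_ge0 q.
  have := @lcount_step_le d m M z q (V + n) (pi + n) C1 C2 d0 m0 q0
    Vn0 pn0 C10
    (H1 M).
  have H2' q' : 0 <= q' -> lcount 2 M z q' <= (pi + n) * q' + C2.
    by move=> q'0; apply: le_trans (H2 _ _ _ q'0) _; rewrite V2E sqr_sqrtr.
  move=> /(_ H2') H; apply: le_trans H _; rewrite VE -/c.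
  have := HC _ s0; rewrite sqr_sqrtr//.
  have : (V + n) * (pi + n) * (c + m%:R^-1) * Num.sqrt q ^+ d.+2 <=
      (V * pi * c + e / 2) * Num.sqrt q ^+ d.+2.
    apply: ler_wpM2r; first by rewrite exprn_ge0.
    apply: le_trans _ Hn; apply: ler_wpM2l; last by rewrite lerD2l.
    exact: mulr_ge0.
  move: (Num.sqrt q ^+ d.+2) (Num.sqrt q ^+ d) => X Y; lra.
- have [n n0 [nV np _ Hn]] := small_product V0 p0 c0 (suf _ e0).
  have Vn0 : 0 <= V - n by lra.
  have pn0 : 0 <= pi + n by lra.
  have pn0' : 0 <= pi - n by lra.
  have [C1 C10 H1] := Ld _ n0; have [C2 C20 H2] := L2 _ n0.
  have [C3 C30 H3] := U2 _ n0.
  have [m m0 mn] := inv_nat_le n0.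
  have [C C0 HC] := @mix_bound d ((V - n) * C2) (C1 * (pi + n)) _ d0
    (mulr_ge0 Vn0 C20) (mulr_ge0 C10 pn0) (suf _ e0).
  exists (C + C1 * C3); first by rewrite addr_ge0 ?mulr_ge0.
  move=> M z q q0 zr.
  have s0 := sqrtr_ge0 q.
  have := @lcount_step_ge d m M z q (V - n) (pi - n) C1 C2 d0 m0 q0
    Vn0 pn0' C10 C20 (pi + n) C3 pn0 C30 zr (H1 M).
  have H2' q' : 0 <= q' ->
    (forall i, (i < 2)%N -> Num.sqrt q' <= z i /\ z i + Num.sqrt q' <= M%:R - 1) ->
    (pi - n) * q' - C2 <= lcount 2 M z q'.
    move=> q'0 zr'; have := H2 _ _ _ q'0 zr'; by rewrite V2E sqr_sqrtr.
  have H3' : lcount 2 M z q <= (pi + n) * q + C3.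
    by apply: le_trans (H3 _ _ _ q0) _; rewrite V2E sqr_sqrtr.
  move=> /(_ H2' H3') H; apply: le_trans _ H; rewrite VE -/c.
  have := HC _ s0; rewrite sqr_sqrtr//.
  have : (V * pi * c - e / 2) * Num.sqrt q ^+ d.+2 <=
     (V - n) * (pi - n) * (c - m%:R^-1) * Num.sqrt q ^+ d.+2.
    apply: ler_wpM2r; first by rewrite exprn_ge0.
    apply: le_trans Hn _; apply: ler_wpM2l; last by rewrite lerD2l lerN2.
    exact: mulr_ge0.
  move: (Num.sqrt q ^+ d.+2) (Num.sqrt q ^+ d) => X Y; lra.
Qed.

Lemma lcount_asymp d : (0 < d)%N -> lcount_upper d /\ lcount_lower d.
Proof.
case: d => // d _.
suff : (lcount_upper d.+1 /\ lcount_lower d.+1) /\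
       (lcount_upper d.+2 /\ lcount_lower d.+2) by case.
elim: d => [|d [IH1 IH2]]; first by split; [exact: lcount_asymp1|exact: lcount_asymp2].
by split => //; exact: lcount_asympSS.
Qed.

End LatticeAsymptotics.

(** * Polarization of the cube *)

Section FiniteConfigurations.
Variable R : realType.

(** Missing points are supplied by copies of [a0], which cannot lower the potential of a nonnegative
    weight. Configurations may thus be indexed by any finite type with at most [N] elements. *)
Lemma fin_config (p : nat) (A : set 'rV[R]_p) (T : finType) (f : T -> 'rV[R]_p)
    N a0 : A a0 -> (forall t, A (f t)) -> (#|T| <= N)%N ->
  exists2 omega : 'I_N -> 'rV[R]_p, configs A N omega &
    forall y w s, (forall x, A x -> 0 <= w (y, x)) ->
      (\sum_t rkernel w s y (f t) <= Upot w s y omega)%E.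
Proof.
move=> Aa0 Af TN.
pose T' := (T + 'I_(N - #|T|))%type.
have cT : #|{: T'}| = N by rewrite card_sum card_ord subnKC.
pose f' (t : T') := if t is inl t1 then f t1 else a0.
exists (fun j => f' (enum_val (cast_ord (esym cT) j))).
  by move=> j; rewrite /f'; case: (enum_val _).
move=> y w s w0; rewrite /Upot.
have -> : (\sum_(j < N) rkernel w s y (f' (enum_val (cast_ord (esym cT) j))) =
    \sum_(t : T') rkernel w s y (f' t))%E.
  rewrite [RHS](reindex (fun j => enum_val (cast_ord (esym cT) j)))//.
  exists (fun t => cast_ord cT (enum_rank t)) => [j|t] _.
    by rewrite enum_valK cast_ordKV.
  by rewrite cast_ordK enum_rankK.
rewrite big_sumType/=; apply: leeDl.
by apply: sume_ge0 => j _; apply: rkernel_ge0; exact: w0.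
Qed.

Lemma Pmax_mono (p : nat) (A : set 'rV[R]_p) w s n N a0 : A a0 ->
  (forall x y, A x -> A y -> 0 <= w (x, y)) ->
  (n <= N)%N -> (Pmax w s A n <= Pmax w s A N)%E.
Proof.
move=> Aa0 w0 nN; apply: Pmax_le => om Aom.
have [|om' Aom' H] := @fin_config p A 'I_n om N a0 Aa0 Aom; first by rewrite card_ord.
apply: le_trans (Pmax_ge _ _ Aom'); apply: Ppol_ge => y Ay.
apply: le_trans (Ppol_le _ _ _ Ay) (H y w s _) => x Ax; exact: w0.
Qed.

Lemma unit_cube0 d : unit_cube R d 0.
Proof. by move=> i; rewrite mxE lexx ler01. Qed.

Lemma Pmax_cube_ge0 d s n : (0 <= Pmax (fun=> 1%R) s (unit_cube R d) n)%E.
Proof.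
have H : configs (unit_cube R d) n (fun=> 0) by move=> j; exact: unit_cube0.
apply: le_trans (Pmax_ge _ _ H); apply: Ppol_ge => y _; exact: Upot1_ge0.
Qed.

Lemma Pmax_cube0 d s : Pmax (fun=> 1%R) s (unit_cube R d) 0 = 0%E.
Proof.
apply/eqP; rewrite eq_le Pmax_cube_ge0 andbT; apply: Pmax_le => om _.
apply: (@le_trans _ _ (Upot (fun=> 1%R) s (0 : 'rV[R]_d) om)).
  by apply: Ppol_le; exact: unit_cube0.
by rewrite /Upot big_ord0.
Qed.

End FiniteConfigurations.
Arguments unit_cube0 : clear implicits.

Section PowerFacts.
Variable R : realType.

Lemma powR_expn (a x : R) j : 0 <= a -> powR (a ^+ j) x = powR a x ^+ j.
Proof. by move=> a0; rewrite -powR_mulrn// powRAC powR_mulrn// powR_ge0. Qed.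

Lemma powR_natB (a s : R) d : 0 < a -> a ^+ d * powR a (- s) = powR a (d%:R - s).
Proof. by move=> a0; rewrite -powR_mulrn ?ltW// -powRD// (gt_eqF a0) implybT. Qed.

End PowerFacts.

(** * Lattice sums of the kernel *)

Section LatticePoints.
Variables (R : realType) (d M : nat).
Hypothesis M0 : (0 < M)%N.
Let MR : 0 < M%:R :> R. Proof. by rewrite ltr0n. Qed.

(** The offset [a] makes the lattice overhang the cube: it is 0 for the averaging and positive for
    the lattice configurations of the case [s = d]. *)
Definition lpoint (a : R) (k : {ffun 'I_d -> 'I_M}) (L : nat) : 'rV[R]_d :=
  \row_i (((k i)%:R - a) / L%:R).

(** A point in lattice units, padded with 0 beyond the dimension because [lsq] expects a
    sequence. *)
Definition lcoord (a : R) (L : nat) (x : 'rV[R]_d) (i : nat) : R :=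
  if insub i is Some j then L%:R * x ord0 j + a else 0.

Lemma lcoordE a L x (j : 'I_d) : lcoord a L x j = L%:R * x ord0 j + a.
Proof. by rewrite /lcoord valK. Qed.

Lemma edist_lpoint a L k x : (0 < L)%N ->
  edist (lpoint a k L) x = Num.sqrt (lsq (lcoord a L x) k) / L%:R.
Proof.
move=> L0; have LR : 0 < L%:R :> R by rewrite ltr0n.
rewrite -[L%:R^-1]ger0_norm ?invr_ge0 ?ler0n// -sqrtr_sqr -sqrtrM; last first.
  exact: lsq_ge0.
congr Num.sqrt; rewrite /lsq mulr_suml; apply: eq_bigr => i _.
rewrite mxE lcoordE -exprMn; congr (_ ^+ 2).
by field; rewrite gt_eqF.
Qed.

End LatticePoints.

Section LayeredSum.
Variables (R : realType) (d M m : nat) (z : nat -> R) (s rho lam B : R).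
Hypotheses (d0 : (0 < d)%N) (ds : d%:R <= s) (rho0 : 0 < rho) (lam1 : 1 < lam).

Let u (j : nat) : R := (rho * lam ^+ j) ^+ 2.
Let h (x : R) : R := powR (Num.sqrt x) (- s).
Local Notation E := (powR lam (d%:R - s)).
Let lam0 : 0 < lam. Proof. by apply: lt_trans lam1. Qed.
Let v0 j : 0 < rho * lam ^+ j. Proof. by rewrite mulr_gt0// exprn_gt0. Qed.
Let s0 : 0 <= s. Proof. by apply: le_trans ds. Qed.
Let sqrt_u j : Num.sqrt (u j) = rho * lam ^+ j.
Proof. by rewrite sqrtr_sqr ger0_norm// ltW. Qed.
Let uS j : (j < m)%N -> u j <= u j.+1.
Proof.
move=> _; apply: lerXn2r; rewrite ?nnegrE ?(ltW (v0 _))//.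
by rewrite ler_pM2l// exprS ler_peMl ?ltW// exprn_gt0.
Qed.
Let u_gt0 j : 0 < u j. Proof. by rewrite exprn_gt0. Qed.
Let u_mono i j : (i <= j)%N -> u i <= u j.
Proof.
move=> ij; apply: lerXn2r; rewrite ?nnegrE ?(ltW (v0 _))//.
by rewrite ler_pM2l// ler_weXn2l// ltW.
Qed.
Let h_mono x y : u 0 <= x -> x <= y -> y <= u m -> h y <= h x.
Proof.
move=> ux xy _; rewrite /h !powRN lef_pV2 ?posrE ?powR_gt0 ?sqrtr_gt0//.
- by apply: ge0_ler_powR; rewrite ?nnegrE ?sqrtr_ge0//; exact: ler_wsqrtr.
- by apply: lt_le_trans xy; exact: lt_le_trans ux.
- exact: lt_le_trans ux.
Qed.
Let hu j : h (u j) = powR rho (- s) * powR lam (- s) ^+ j.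
Proof.
by rewrite /h sqrt_u powRM ?(ltW rho0) ?exprn_ge0 ?(ltW lam0)// powR_expn// ltW.
Qed.
Let h_ge0 j : 0 <= h (u j). Proof. exact: powR_ge0. Qed.
Let hv j : h (u j) * (rho * lam ^+ j) ^+ d = powR rho (d%:R - s) * E ^+ j.
Proof.
rewrite hu exprMn mulrACA [_ * rho ^+ d]mulrC powR_natB// -!exprM; congr (_ * _).
by rewrite [(j * d)%N]mulnC !exprM -exprMn mulrC powR_natB.
Qed.

(** In the shell that starts at radius [rho * lam^j] the kernel is of order [(rho * lam^j)^(-s)] and
    the number of points of order [(rho * lam^j)^d], so its share is proportional to
    [lam^((d-s) j)]. These shares are geometric for [s > d] and all equal for [s = d], where the
    logarithm arises as the number [m] of shells. *)
Lemma layered_le : 0 <= B ->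
  (forall q, rho ^+ 2 <= q -> lcount d M z q <= B * Num.sqrt q ^+ d) ->
  \sum_(k : {ffun 'I_d -> 'I_M} | rho ^+ 2 <= lsq z k <= (rho * lam ^+ m) ^+ 2)
    powR (Num.sqrt (lsq z k)) (- s) <=
  B * powR rho (d%:R - s) *
    (E ^+ m + lam ^+ d * (1 - powR lam (- s)) * \sum_(j < m) E ^+ j).
Proof.
move=> B0 HN.
have u0 : u 0 = rho ^+ 2 by rewrite /u expr0 mulr1.
have ule j : rho ^+ 2 <= u j by rewrite -u0; exact: u_mono.
have := @layer_upper _ _ (@lsq R d M z) h u m uS h_mono (h_ge0 m).
rewrite u0 => H; apply: le_trans H _.
rewrite mulrDr; apply: lerD.
  have := ler_wpM2l (h_ge0 m) (HN _ (ule m)); rewrite sqrt_u => H.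
  by apply: le_trans H _; rewrite mulrCA hv mulrA.
rewrite !mulr_sumr; apply: ler_sum => j _; rewrite -/(lcount d M z (u j.+1)).
have jm := ltn_ord j.
have hj : 0 <= h (u j) - h (u j.+1).
  by rewrite subr_ge0; apply: h_mono; exact: u_mono.
apply: le_trans (ler_wpM2l hj (HN _ (ule j.+1))) _; rewrite sqrt_u.
have -> : h (u j) - h (u j.+1) = h (u j) * (1 - powR lam (- s)).
  by rewrite !hu exprS; ring.
have -> : (rho * lam ^+ j.+1) ^+ d = (rho * lam ^+ j) ^+ d * lam ^+ d.
  by rewrite -exprMn exprSr mulrA.
have -> : h (u j) * (1 - powR lam (- s)) *
    (B * ((rho * lam ^+ j) ^+ d * lam ^+ d)) =
  B * (h (u j) * (rho * lam ^+ j) ^+ d) * (lam ^+ d * (1 - powR lam (- s))).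
  by ring.
by rewrite hv; set X := powR rho _; set Y := powR lam (- s); set Z := E ^+ j; lra.
Qed.

(** Each shell contributes at least [B * (1 - lam^(-d))]. The term [B'] pays for the lattice points
    within [rho], which the layer formula counts but the sum omits. *)
Lemma layered_ge (B' : R) :
  s = d%:R ->
  (forall j, (j < m)%N -> B * Num.sqrt (u j) ^+ d <= lcount d M z (u j)) ->
  lcount d M z (rho ^+ 2) <= B' * rho ^+ d ->
  B * (1 - (lam ^+ d)^-1) * m%:R - B' <=
  \sum_(k : {ffun 'I_d -> 'I_M} | rho ^+ 2 <= lsq z k <= (rho * lam ^+ m) ^+ 2)
    powR (Num.sqrt (lsq z k)) (- s).
Proof.
move=> sd HN HN0.
have u0 : u 0 = rho ^+ 2 by rewrite /u expr0 mulr1.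
have ls : powR lam (- s) = (lam ^+ d)^-1.
  by rewrite powRN sd powR_mulrn// ltW.
have := @layer_lower _ _ (@lsq R d M z) h u m uS h_mono.
rewrite -/(lcount d M z (u m)) u0.
set S := \sum_(t | rho ^+ 2 <= _ <= _) _ => H.
have H0 : h (rho ^+ 2) * \sum_(t : {ffun 'I_d -> 'I_M}) (lsq z t < rho ^+ 2)%R%:R <= B'.
  apply: (@le_trans _ _ (h (rho ^+ 2) * (B' * rho ^+ d))).
    apply: ler_wpM2l; [exact: powR_ge0|apply: le_trans HN0].
    apply: ler_sum => k _.
    by have [lt1|] := ltP; rewrite ?(ltW lt1).
  have := hv 0; rewrite u0 expr0 !mulr1 sd subrr powRr0 => hv0.
  by rewrite mulrCA hv0 mulr1.
have Hm : 0 <= h (u m) * lcount d M z (u m).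
  by rewrite mulr_ge0// lcount_ge0.
have Hs : B * (1 - (lam ^+ d)^-1) * m%:R <=
   \sum_(j < m) (h (u j) - h (u j.+1)) * lcount d M z (u j).
  have -> : B * (1 - (lam ^+ d)^-1) * m%:R =
      \sum_(j < m) B * (1 - (lam ^+ d)^-1).
    by rewrite sumr_const card_ord mulr_natr.
  apply: ler_sum => j _; have jm := ltn_ord j.
  have hj : 0 <= h (u j) - h (u j.+1).
    by rewrite subr_ge0; apply: h_mono; exact: u_mono.
  apply: le_trans _ (ler_wpM2l hj (HN _ jm)); rewrite sqrt_u.
  have -> : h (u j) - h (u j.+1) = h (u j) * (1 - (lam ^+ d)^-1).
    by rewrite !hu exprS ls; ring.
  have := hv j; rewrite sd subrr !powRr0 expr1n mulr1 => hvj.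
  have -> : h (u j) * (1 - (lam ^+ d)^-1) * (B * (rho * lam ^+ j) ^+ d) =
      B * (1 - (lam ^+ d)^-1) * (h (u j) * (rho * lam ^+ j) ^+ d) by ring.
  by rewrite hvj mulr1.
have {}H : h (u m) * lcount d M z (u m) +
    \sum_(j < m) (h (u j) - h (u j.+1)) * lcount d M z (u j) <=
    S + h (rho ^+ 2) *
      \sum_(t : {ffun 'I_d -> 'I_M}) (lsq z t < rho ^+ 2)%R%:R by exact: H.
move: H H0 Hm Hs.
set a1 := h (u m) * _; set a2 := \sum_(j < m) _; set a3 := h (rho ^+ 2) * _.
change (a1 + a2 <= S + a3 -> a3 <= B' -> 0 <= a1 ->
  B * (1 - (lam ^+ d)^-1) * m%:R <= a2 ->
  B * (1 - (lam ^+ d)^-1) * m%:R - B' <= S); lra.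
Qed.

End LayeredSum.

(** * The averaging bound *)

Section CubeAveraging.
Variable R : realType.

(* Average the potential over the points of a fine lattice in the cube that
   are at distance more than [r] from every point of the configuration. *)
Lemma Pmax_cube_le d (s e r lam : R) (n m : nat) :
  (0 < d)%N -> d%:R <= s -> (0 < n)%N -> 0 < e -> 0 < r -> 1 < lam ->
  d%:R <= r * lam ^+ m -> n%:R * (ball_volume R d + e) * r ^+ d < 1 ->
  (Pmax (fun=> 1%R) s (unit_cube R d) n <=
   (n%:R * (ball_volume R d + e) * powR r (d%:R - s) *
     (powR lam (d%:R - s) ^+ m + lam ^+ d * (1 - powR lam (- s)) *
       \sum_(j < m) powR lam (d%:R - s) ^+ j) /
     (1 - n%:R * (ball_volume R d + e) * r ^+ d))%:E)%E.
Proof.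
move=> d0 ds n0 e0 r0 lam1 drm; set B := ball_volume R d + e.
set beta := n%:R * B * r ^+ d => beta1.
set Q := _ + _ * \sum_(j < m) _.
have B0 : 0 <= B by rewrite addr_ge0 ?ltW// ball_volume_gt0.
have [Hup _] := lcount_asymp R d0.
have [C C0 HC] := Hup (e / 2) ltac:(by rewrite divr_gt0).
(* The lattice is so fine that for all radii from [rho = r * M] on, in lattice units, the error [C]
   of the count is at most [e / 2] times the [d]-th power of the radius. *)
pose x := (1 + 2 * C / e) / r.
have Ce : 0 <= 2 * C / e by apply: divr_ge0; [lra|exact: ltW].
have x0 : 0 < x by apply: divr_gt0 => //; lra.
pose M := (Num.bound x).+1.
have M0 : (0 < M)%N by [].
have MR : 0 < M%:R :> R by rewrite ltr0n.
have xM : x <= M%:R.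
  apply: le_trans (ltW (archi_boundP (ltW x0))) _.
  by rewrite ler_nat.
pose rho := r * M%:R.
have rho0 : 0 < rho by rewrite mulr_gt0.
have rhoC : 1 + 2 * C / e <= rho by rewrite /rho [leRHS]mulrC -(ler_pdivrMr _ _ r0).
have rho1 : 1 <= rho by lra.
have HN z q : rho ^+ 2 <= q -> lcount d M z q <= B * Num.sqrt q ^+ d.
  move=> rq; have q0 : 0 <= q by apply: le_trans rq; rewrite exprn_ge0// ltW.
  apply: le_trans (HC _ _ _ q0) _; rewrite /B.
  have sq : rho <= Num.sqrt q.
    by rewrite -(ger0_norm (ltW rho0)) -sqrtr_sqr; exact: ler_wsqrtr.
  have : rho <= Num.sqrt q ^+ d.
    apply: (le_trans sq); rewrite -[leLHS]expr1 ler_weXn2l//.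
    exact: le_trans sq.
  move: (Num.sqrt q ^+ d) => y ry.
  have : C <= e / 2 * y.
    have : e / 2 * (2 * C / e) <= e / 2 * y.
      apply: ler_wpM2l; first by rewrite divr_ge0// ltW.
      by apply: le_trans ry; apply: le_trans rhoC; rewrite lerDr.
    by rewrite (_ : e / 2 * (2 * C / e) = C)//; field; rewrite gt_eqF.
  lra.
apply: Pmax_le => om Aom.
pose z j := lcoord 0 M (om j).
pose pt (k : {ffun 'I_d -> 'I_M}) := lpoint (0 : R) k M.
have ptA k : unit_cube R d (pt k).
  move=> i; rewrite mxE subr0 divr_ge0//= ler_pdivrMr// mul1r ler_nat.
  exact/ltnW/ltn_ord.
pose G (k : {ffun 'I_d -> 'I_M}) := [forall j : 'I_n, rho ^+ 2 < lsq (z j) k].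
pose c : R := \sum_k (G k)%:R.
have Md : \sum_(k : {ffun 'I_d -> 'I_M}) (1 : R) = M%:R ^+ d.
  by rewrite sumr_const card_ffun !card_ord natrX.
(* Union bound: each of the [n] points excludes at most [B * rho^d] lattice points, the fraction
   [beta / n] of all of them. *)
have cG : (1 - beta) * M%:R ^+ d <= c.
  have H : \sum_(k : {ffun 'I_d -> 'I_M}) (1 : R) -
      \sum_(j < n) lcount d M (z j) (rho ^+ 2) <= c.
    rewrite /lcount exchange_big -sumrB; apply: ler_sum => k _ /=.
    rewrite /G; have [_|] := boolP [forall j : 'I_n, rho ^+ 2 < lsq (z j) k].
      by rewrite lerBlDr lerDl; apply: sumr_ge0 => i _; exact: ler0n.
    rewrite negb_forall => /existsP[j]; rewrite -leNgt => hj.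
    rewrite (bigD1 j)//= hj mulr1n mulr0n.
    by rewrite opprD addrA subrr add0r oppr_le0; apply: sumr_ge0 => i _; exact: ler0n.
  apply: le_trans H; rewrite Md mulrBl mul1r lerD2l lerN2.
  apply: (@le_trans _ _ (\sum_(j < n) B * rho ^+ d)).
    apply: ler_sum => j _; have := HN (z j) _ (lexx _).
    by rewrite sqrtr_sqr ger0_norm// ltW.
  rewrite sumr_const card_ord -[leLHS]mulr_natl /rho exprMn /beta.
  by rewrite !mulrA.
have c0 : 0 < c.
  by apply: lt_le_trans cG; rewrite mulr_gt0// ?subr_gt0// exprn_gt0.
have distE k j : edist (pt k) (om j) = Num.sqrt (lsq (z j) k) / M%:R.
  exact: edist_lpoint.
pose W (k : {ffun 'I_d -> 'I_M}) : R := \sum_(j < n) powR (Num.sqrt (lsq (z j) k) / M%:R) (- s).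
have UE k : G k -> Upot (fun=> 1%R) s (pt k) om = (W k)%:E.
  move=> /forallP Gk; rewrite /Upot /W -sumEFin; apply: eq_bigr => j _.
  rewrite rkernel1E /riesz distE gt_eqF// divr_gt0// sqrtr_gt0.
  by apply: lt_trans (Gk j); rewrite exprn_gt0.
(* Distances in the cube are at most [d <= r * lam^m], so [m] shells reach every lattice point. *)
have lsq_ub j (k : {ffun 'I_d -> 'I_M}) : lsq (z j) k <= (rho * lam ^+ m) ^+ 2.
  have h1 i : ((k i)%:R - z j i) ^+ 2 <= M%:R ^+ 2.
    have zE : z j i = M%:R * om j ord0 i by rewrite [LHS]lcoordE addr0.
    rewrite -[leLHS]real_normK ?num_real// ler_pXn2r ?nnegrE// zE.
    have /andP[om0 om1] := Aom j i.
    have kM : (k i)%:R <= M%:R :> R by rewrite ler_nat; exact/ltnW/ltn_ord.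
    have : 0 <= M%:R * om j ord0 i by rewrite mulr_ge0.
    have : M%:R * om j ord0 i <= M%:R by rewrite ler_piMr.
    have : 0 <= (k i)%:R :> R by [].
    by move=> *; rewrite ler_norml; apply/andP; split; lra.
  apply: (@le_trans _ _ (\sum_(i < d) M%:R ^+ 2)); first exact: ler_sum.
  rewrite sumr_const card_ord -[leLHS]mulr_natl.
  apply: (@le_trans _ _ ((d%:R * M%:R) ^+ 2)).
    rewrite exprMn ler_wpM2r ?sqr_ge0// -natrX ler_nat expnS expn1.
    by rewrite leq_pmulr.
  have hM : d%:R * M%:R <= rho * lam ^+ m by rewrite /rho mulrAC ler_wpM2r.
  have hM0 : 0 <= d%:R * M%:R :> R by rewrite mulr_ge0.
  by apply: lerXn2r; rewrite ?nnegrE// (le_trans hM0).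
have sumW : \sum_(k | G k) W k <=
    n%:R * (powR M%:R s * (B * powR rho (d%:R - s) * Q)).
  rewrite /W exchange_big /=.
  have -> : n%:R * (powR M%:R s * (B * powR rho (d%:R - s) * Q)) =
      \sum_(j < n) powR M%:R s * (B * powR rho (d%:R - s) * Q).
    by rewrite sumr_const card_ord mulr_natl.
  apply: ler_sum => j _.
  have HL := @layered_le R d M m (z j) s rho lam B ds rho0 lam1 B0
    (fun q => HN (z j) q).
  have HL2 := ler_wpM2l (powR_ge0 M%:R s) HL.
  apply: (le_trans _ HL2).
  rewrite mulr_sumr [leLHS]big_mkcond [leRHS]big_mkcond.
  apply: ler_sum => k _; have [/forallP Gk|_] := boolP (G k).
    rewrite (ltW (Gk j)) lsq_ub /= powRM ?sqrtr_ge0 ?invr_ge0//.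
    by rewrite powR_inv// opprK mulrC.
  by case: ifP => // _; rewrite mulr_ge0 ?powR_ge0.
have [k0 Gk0] : exists k, G k.
  case: (boolP [exists k, G k]) => [/existsP//|]; rewrite negb_exists => /forallP H.
  by move: c0; rewrite /c big1 ?ltxx// => k _; rewrite (negbTE (H k)).
pose P := Ppol (fun=> 1%R) s (unit_cube R d) om; rewrite -/P.
have PW k : G k -> (P <= (W k)%:E)%E.
  by move=> Gk; rewrite -UE//; apply: Ppol_le; exact: ptA.
have P0 : (0 <= P)%E by apply: Ppol_ge => y _; exact: Upot1_ge0.
have Pfin : P \is a fin_num.
  by rewrite ge0_fin_numE//; apply: le_lt_trans (PW _ Gk0) (ltry _).
rewrite -(fineK Pfin) lee_fin.
have p0 : 0 <= fine P by rewrite fine_ge0.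
rewrite ler_pdivlMr ?subr_gt0// -(ler_pM2r (exprn_gt0 d MR)).
apply: (@le_trans _ _ (fine P * c)).
  by rewrite -mulrA; apply: ler_wpM2l.
apply: (@le_trans _ _ (\sum_(k | G k) W k)).
  rewrite /c mulr_sumr [leRHS]big_mkcond; apply: ler_sum => k _.
  case: ifP => Gk; last by rewrite mulr0.
  by rewrite mulr1 -lee_fin fineK// PW.
apply: le_trans sumW _.
have -> : powR rho (d%:R - s) = powR r (d%:R - s) * powR M%:R (d%:R - s).
  by rewrite /rho powRM ?ltW.
have -> : M%:R ^+ d = powR M%:R s * powR M%:R (d%:R - s) :> R.
  rewrite -powRD; last by rewrite (gt_eqF MR) implybT.
  by rewrite (_ : s + (d%:R - s) = d%:R) ?powR_mulrn//; ring.
set X := powR r _; set Y := powR M%:R s; set Z := powR M%:R (_ - _); lra.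
Qed.

End CubeAveraging.

Section CubeAsymptotics.
Variable R : realType.

(** In the application [n] is the number of points of an [N]-point configuration that fall in a
    cube. Uniformity in [n] and the allowance [C * N] matter for [s = d], where [ln n] is merely
    bounded by [ln N]. *)
Definition cube_upper (s : R) d (sig : R) := forall e : R, 0 < e ->
  exists2 C, 0 <= C & forall n N, (n <= N)%N -> (0 < N)%N ->
    (Pmax (fun=> 1%R) s (unit_cube R d) n <=
     ((sig + e) * powR (n%:R / N%:R) (s / d%:R) * tau s d N + C * N%:R)%:E)%E.

Definition cube_lower (s : R) d (sig : R) := forall e : R, 0 < e ->
  exists n0, forall n, (n0 <= n)%N ->
    (((sig - e) * tau s d n)%:E <= Pmax (fun=> 1%R) s (unit_cube R d) n)%E.

Lemma powR_near1 (s e : R) : 0 < s -> 0 < e ->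
  exists2 k : R, 1 < k & powR k s = 1 + e.
Proof.
move=> s0 e0; exists (powR (1 + e) s^-1).
  apply: (@le_lt_trans _ _ (powR 1 s^-1)); first by rewrite powR1.
  apply: gt0_ltr_powR; rewrite ?invr_gt0 ?nnegrE//; lra.
by rewrite -powRrM mulVf ?powRr1 ?gt_eqF//; lra.
Qed.

Lemma geo_sum_le (E : R) m : 0 <= E -> E < 1 -> \sum_(j < m) E ^+ j <= (1 - E)^-1.
Proof.
move=> E0 E1; have H := subrX1 E m.
rewrite -[leRHS]div1r ler_pdivlMr ?subr_gt0//.
have -> : (\sum_(j < m) E ^+ j) * (1 - E) = 1 - E ^+ m.
  by rewrite -[RHS]opprB H; ring.
by rewrite gerBl exprn_ge0.
Qed.

Lemma exists_pow_ge (a lam : R) : 1 < lam -> exists m, a <= lam ^+ m.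
Proof.
move=> lam1; have [a1|a1] := leP a 1; first by exists 0%N; rewrite expr0.
pose x := a / (lam - 1).
exists (Num.bound x).
have x0 : 0 <= x by rewrite divr_ge0; lra.
have l0 : 0 < lam - 1 by lra.
have : a <= (Num.bound x)%:R * (lam - 1).
  by rewrite -ler_pdivrMr//; apply/ltW/archi_boundP.
move: (Num.bound x) => m H.
have B : 1 + m%:R * (lam - 1) <= lam ^+ m.
  elim: m {H} => [|m IH]; first by rewrite expr0 mul0r addr0.
  rewrite exprS -natr1.
  have : 0 <= m%:R * (lam - 1) ^+ 2 by rewrite mulr_ge0// sqr_ge0.
  have := ler_wpM2l (ltW (lt_trans ltr01 lam1)) IH; lra.
lra.
Qed.

Lemma unit_cell m (y : R) : (0 < m)%N -> 0 <= y <= 1 ->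
  exists k : 'I_m, 0 <= m%:R * y - k%:R <= 1.
Proof.
move=> m0 /andP[y0 y1]; have mR : 0 < m%:R :> R by rewrite ltr0n.
have my0 : 0 <= m%:R * y by rewrite mulr_ge0.
have [ylt|yge] := ltP y 1.
  have /andP[t1 t2] := truncn_itv my0.
  have tm : (Num.truncn (m%:R * y) < m)%N.
    by rewrite -(ltr_nat R); apply: le_lt_trans t1 _; rewrite gtr_pMr.
  exists (Ordinal tm) => /=; rewrite -natr1 in t2; lra.
(* The right end point truncates to [m], one past the last cell, and is assigned to cell [m - 1]. *)
have -> : y = 1 by apply/eqP; rewrite eq_le y1.
have mm : (m.-1 < m)%N by case: (m) m0.
exists (Ordinal mm) => /=.
have : m.-1%:R + 1 = m%:R :> R by rewrite natr1 prednK.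
lra.
Qed.

(** * The limit for s > d *)

Section Supercritical.
Variables (d : nat) (s : R).
Hypotheses (d0 : (0 < d)%N) (ds : d%:R < s).
Local Notation g n := (Pmax (fun=> 1%R) s (unit_cube R d) n).
Let dR : 0 < d%:R :> R. Proof. by rewrite ltr0n. Qed.
Let s0 : 0 < s. Proof. exact: lt_trans ds. Qed.
Let sd0 : 0 < s / d%:R. Proof. exact: divr_gt0. Qed.

Lemma Pmax_cube_bounded :
  exists2 C, 0 <= C & forall n, (g n <= (C * powR n%:R (s / d%:R))%:E)%E.
Proof.
pose B := ball_volume R d + 1.
have B0 : 0 < B by rewrite addr_gt0// ball_volume_gt0.
pose E := powR 2 (d%:R - s).
have E0 : 0 <= E by exact: powR_ge0.
have E1 : E < 1.
  rewrite /E -opprB powRN invf_lt1 ?powR_gt0//.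
  apply: (@le_lt_trans _ _ (powR 1 (s - d%:R))); first by rewrite powR1.
  apply: gt0_ltr_powR; rewrite ?nnegrE ?subr_gt0//; lra.
pose K := 1 + 2 ^+ d * (1 - E)^-1.
have K0 : 0 <= K by rewrite addr_ge0// mulr_ge0 ?exprn_ge0// invr_ge0; lra.
exists (B * powR (2 * B) (s / d%:R - 1) * K * 2).
  by rewrite !mulr_ge0 ?powR_ge0// ltW.
case=> [|n]; first by rewrite Pmax_cube0 lee_fin powR0 ?mulr0// gt_eqF.
set N := n.+1; have N0 : 0 < N%:R :> R by rewrite ltr0n.
(* With [r^d = 1 / (2 * N * B)] the excluded balls take up at most half of the cube, and the bound
   is of order [N * r^(d-s)], that is [N^(s/d)]. *)
pose x := 2 * N%:R * B; have x0 : 0 < x by rewrite !mulr_gt0.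
pose r := powR x (- d%:R^-1).
have r0 : 0 < r by rewrite powR_gt0.
have rd : r ^+ d = x^-1.
  rewrite /r -powR_mulrn ?powR_ge0// -powRrM mulNr mulVf ?gt_eqF//.
  by rewrite powR_inv1// ltW.
have [m Hm] := @exists_pow_ge (d%:R / r) 2 ltac:(lra).
have bet : N%:R * B * r ^+ d = 2^-1.
  by rewrite rd /x; field; rewrite ?pnatr_eq0 ?andbT gt_eqF.
have drm : d%:R <= r * 2 ^+ m by rewrite mulrC -ler_pdivrMr.
have := @Pmax_cube_le R d s 1 r 2 N m d0 (ltW ds) isT ltr01 r0 ltac:(lra) drm.
rewrite -/B bet => /(_ ltac:(lra)) H; apply: le_trans H _.
rewrite lee_fin -/E (_ : 1 - 2^-1 = 2^-1); last by lra.
rewrite invrK.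
have -> : powR r (d%:R - s) = powR N%:R (s / d%:R - 1) * powR (2 * B) (s / d%:R - 1).
  rewrite -powRM ?mulr_ge0 ?(ltW B0)// -powRrM /x; congr powR; first by ring.
  by field; rewrite gt_eqF.
have -> : powR N%:R (s / d%:R) = N%:R * powR N%:R (s / d%:R - 1).
  rewrite -{2}[N%:R]powRr1// -powRD; last by rewrite (gt_eqF N0) implybT.
  by congr powR; ring.
have KQ : E ^+ m + 2 ^+ d * (1 - powR 2 (- s)) * \sum_(j < m) E ^+ j <= K.
  apply: lerD; first by rewrite exprn_ile1// ltW.
  rewrite -mulrA; apply: ler_wpM2l; first by rewrite exprn_ge0.
  apply: (@le_trans _ _ (1 * \sum_(j < m) E ^+ j)).
    apply: ler_wpM2r; first by apply: sumr_ge0 => j _; rewrite exprn_ge0.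
    by rewrite gerBl powR_ge0.
  by rewrite mul1r; exact: geo_sum_le.
set Q := _ + _ in KQ *; set X := powR N%:R _; set Y := powR (2 * B) _.
have W : 0 <= N%:R * B * (X * Y) * 2.
  by rewrite !mulr_ge0 ?powR_ge0// ltW.
have := ler_wpM2l W KQ; lra.
Qed.

Let gr n : R := fine (g n).

Let gE n : g n = (gr n)%:E.
Proof.
have [C C0 HC] := Pmax_cube_bounded.
rewrite fineK// ge0_fin_numE ?Pmax_cube_ge0//.
exact: le_lt_trans (HC n) (ltry _).
Qed.

Let gr_mono n N : (n <= N)%N -> gr n <= gr N.
Proof.
move=> nN; rewrite -lee_fin -(gE n) -(gE N).
by apply: (Pmax_mono s (unit_cube0 R d)) => // x y _ _; exact: ler01.
Qed.

Let gr_scale m n : (0 < m)%N -> powR m%:R s * gr n <= gr (m ^ d * n).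
Proof.
move=> m0; have mR : 0 < m%:R :> R by rewrite ltr0n.
rewrite leNgt; apply/negP; set b := gr _ => H.
(* The supremum may not be attained, so a contradiction is derived from a number strictly between
   the two sides. *)
pose x := (b + powR m%:R s * gr n) / 2.
have bx : b < x by rewrite /x; lra.
have xg : x < powR m%:R s * gr n by rewrite /x; lra.
have ms0 : 0 < powR m%:R s by rewrite powR_gt0.
have : ((x / powR m%:R s)%:E < g n)%E.
  by rewrite gE lte_fin ltr_pdivrMr// mulrC.
move=> /Pmax_gt_ex[om Aom HU].
pose f (kj : {ffun 'I_d -> 'I_m} * 'I_n) : 'rV[R]_d :=
  \row_i (((kj.1 i)%:R + om kj.2 ord0 i) / m%:R).
have Af kj : unit_cube R d (f kj).
  move=> i; rewrite mxE; have /andP[om0 om1] := Aom kj.2 i.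
  have km : (kj.1 i)%:R + 1 <= m%:R :> R by rewrite natr1 ler_nat.
  apply/andP; split; first by rewrite divr_ge0// addr_ge0.
  rewrite ler_pdivrMr// mul1r; lra.
have [|om' Aom' H'] := @fin_config R d (unit_cube R d) _ f (m ^ d * n) 0 (unit_cube0 R d) Af.
  by rewrite card_prod card_ffun !card_ord.
suff : (x%:E <= g (m ^ d * n))%E by rewrite gE lee_fin leNgt bx.
apply: le_trans (Pmax_ge _ _ Aom'); apply: Ppol_ge => y Ay.
apply: le_trans (H' y (fun=> 1%R) s _); last by move=> ? _; exact: ler01.
have /choice[k Hk] : forall i : 'I_d, exists k : 'I_m, 0 <= m%:R * y ord0 i - k%:R <= 1.
  by move=> i; apply: unit_cell => //; exact: Ay.
pose kf : {ffun 'I_d -> 'I_m} := [ffun i => k i].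
pose y' : 'rV[R]_d := \row_i (m%:R * y ord0 i - (k i)%:R).
have Ay' : unit_cube R d y' by move=> i; rewrite mxE.
(* Only the copy in the subcube that contains [y] is kept; [y'] is the position of [y] in that
   subcube. *)
apply: (@le_trans _ _ (\sum_(j < n) rkernel (fun=> 1%R) s y (f (kf, j)))%E).
  have -> : x%:E = ((powR m%:R s)%:E * (x / powR m%:R s)%:E)%E.
    by rewrite -EFinM mulrC divfK// gt_eqF.
  apply: (@le_trans _ _ ((powR m%:R s)%:E * Upot (fun=> 1%R) s y' om)%E).
    apply: lee_wpmul2l; first by rewrite lee_fin ltW.
    exact/ltW/HU.
  have -> : powR m%:R s = powR m%:R^-1 (- s) by rewrite powR_inv// opprK.
  apply: (@Upot1_ge_scale R d d s _ n y (fun j => f (kf, j)) y' om (ltW s0)) => [|j].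
    by rewrite invr_gt0.
  rewrite -[m%:R^-1 in leRHS]ger0_norm ?invr_ge0 ?ler0n// -edistZ.
  rewrite -(edistDr (m%:R^-1 *: y') _ (\row_i ((k i)%:R / m%:R))).
  rewrite le_eqVlt; apply/orP; left; apply/eqP; congr edist.
    by apply/rowP => i; rewrite !mxE; field; rewrite gt_eqF.
  by apply/rowP => i; rewrite !mxE ffunE; field; rewrite gt_eqF.
have -> : (\sum_t rkernel (fun=> 1%R) s y (f t) =
  \sum_k \sum_(j < n) rkernel (fun=> 1%R) s y (f (k, j)))%E.
  by rewrite pair_big; apply: eq_bigr => -[].
rewrite (bigD1 kf)//=; apply: leeDl.
by apply: sume_ge0 => ? _; apply: sume_ge0 => j _; apply: rkernel_ge0; rewrite ler01.
Qed.

Let ratios := [set gr n / powR n%:R (s / d%:R) | n in [set n | (0 < n)%N]].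
Let S := sup ratios.

Let powN n : (0 < n)%N -> 0 < powR n%:R (s / d%:R) :> R.
Proof. by move=> n0; rewrite powR_gt0// ltr0n. Qed.

Let has_sup_ratios : has_sup ratios.
Proof.
split; first by exists (gr 1 / powR 1%:R (s / d%:R)); exists 1%N.
have [C C0 HC] := Pmax_cube_bounded.
exists C => _ [n /= n0 <-]; rewrite ler_pdivrMr ?powN//.
by rewrite -lee_fin -gE.
Qed.

Let ratio_le n : (0 < n)%N -> gr n / powR n%:R (s / d%:R) <= S.
Proof. by move=> n0; apply: sup_upper_bound; [exact: has_sup_ratios|exists n]. Qed.

Let S_gt0 : 0 < S.
Proof.
apply: lt_le_trans (ratio_le (ltnSn 0)); rewrite divr_gt0 ?powN//.
apply: (@lt_le_trans _ _ (powR d%:R (- s))); first by rewrite powR_gt0.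
rewrite -lee_fin -gE.
have H : configs (unit_cube R d) 1 (fun=> 0) by move=> j; exact: unit_cube0.
apply: le_trans (Pmax_ge _ _ H); apply: Ppol_ge => y Ay.
rewrite /Upot big_ord1 rkernel1E.
apply: (@le_trans _ _ (riesz s d%:R)); first by rewrite /riesz gt_eqF.
apply: riesz_anti => //; [exact: ltW|exact: edist_ge0|].
rewrite -[leRHS]mulr1; apply: edist_le_coord => // i.
by rewrite mxE subr0 ger0_norm; have /andP[] := Ay i.
Qed.

(** A Fekete-type argument: [n1] nearly attains the supremum of the ratios, [m] is the integer part
    of [x = (n / n1)^(1/d)], and monotonicity leads from [m^d * n1] to [n]; the rounding factor
    [x / m] is close to 1 for large [n]. *)
Let lower e : 0 < e -> exists n0, forall n, (n0 <= n)%N ->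
  (S - e) * powR n%:R (s / d%:R) <= gr n.
Proof.
move=> e0; have [Se|Se] := leP (S - e) 0.
  exists 0%N => n _; apply: (@le_trans _ _ 0).
    by rewrite mulr_le0_ge0// powR_ge0.
  by rewrite fine_ge0// Pmax_cube_ge0.
have [_ [n1 /= n10 <-] Hn1] := sup_adherent (divr_gt0 e0 (ltr0n R 2)) has_sup_ratios.
rewrite -/S in Hn1.
pose ep := e / 2 / S; have ep0 : 0 < ep by rewrite !divr_gt0.
have [k k1 kE] := powR_near1 s0 ep0.
pose m0 := (Num.bound (k - 1)^-1).+1.
have n1R : 0 < n1%:R :> R by rewrite ltr0n.
exists (m0 ^ d * n1)%N => n nge.
pose x : R := powR (n%:R / n1%:R) d%:R^-1.
have xn : x ^+ d = n%:R / n1%:R.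
  rewrite /x -powR_mulrn ?powR_ge0// -powRrM mulVf ?(gt_eqF dR)//.
  by rewrite powRr1// divr_ge0.
have x0 : 0 <= x by exact: powR_ge0.
have m0x : m0%:R <= x.
  rewrite -(ler_pXn2r d0) ?nnegrE// xn ler_pdivlMr// -natrX -natrM ler_nat//.
have /andP[t1 t2] := truncn_itv x0.
set m := Num.truncn x in t1 t2.
have mm0 : (m0 <= m)%N.
  by rewrite -ltnS -(ltr_nat R); apply: le_lt_trans m0x t2.
have mpos : (0 < m)%N by apply: leq_trans mm0.
have mR : 0 < m%:R :> R by rewrite ltr0n.
have xk : x <= k * m%:R.
  have : (k - 1)^-1 <= m%:R.
    apply: le_trans (ltW (archi_boundP _)) _; first by rewrite invr_ge0; lra.
    by rewrite ler_nat; apply: leq_trans mm0; exact: leqnSn.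
  rewrite invf_ple ?posrE//; last by rewrite subr_gt0.
  move=> H; have : m%:R^-1 * m%:R <= (k - 1) * m%:R by apply: ler_wpM2r => //; exact: ltW.
  rewrite mulVf ?gt_eqF// => H1; rewrite -natr1 in t2; lra.
have mn : (m ^ d * n1 <= n)%N.
  rewrite -(ler_nat R) natrM natrX -ler_pdivlMr// -xn.
  by apply: lerXn2r; rewrite ?nnegrE.
apply: le_trans (gr_mono mn); apply: le_trans (gr_scale _ mpos).
have nE : powR n%:R (s / d%:R) = powR n1%:R (s / d%:R) * powR x s.
  have -> : n%:R = n1%:R * x ^+ d by rewrite xn mulrC divfK// gt_eqF.
  rewrite powRM ?exprn_ge0//; congr (_ * _).
  by rewrite -powR_mulrn// -powRrM mulrCA divff ?mulr1// gt_eqF.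
have xs : powR x s <= (1 + ep) * powR m%:R s.
  rewrite -kE -powRM ?(ltW mR)//; last by lra.
  apply: ge0_ler_powR; rewrite ?nnegrE ?(ltW s0)// mulr_ge0//; lra.
have H1 : (S - e / 2) * powR n1%:R (s / d%:R) <= gr n1.
  by rewrite -ler_pdivlMr ?powN// ltW.
have H2 : (S - e) * (1 + ep) <= S - e / 2.
  have : e * ep >= 0 by rewrite mulr_ge0 ?ltW.
  have : S * ep = e / 2 by rewrite /ep mulrC divfK// gt_eqF.
  lra.
rewrite nE; set a := powR n1%:R _ in H1 *; set b := powR x s in xs *.
set c := powR m%:R s in xs *.
have a0 : 0 <= a by exact: powR_ge0.
have c0 : 0 <= c by exact: powR_ge0.
have : (S - e) * a * b <= (S - e) * a * ((1 + ep) * c).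
  by apply: ler_wpM2l => //; rewrite mulr_ge0// ltW.
have : (S - e) * (1 + ep) * (a * c) <= (S - e / 2) * (a * c).
  by apply: ler_wpM2r => //; rewrite mulr_ge0.
have : c * ((S - e / 2) * a) <= c * gr n1 by apply: ler_wpM2l.
lra.
Qed.

Let sigmaE : sigma_sd s d = S.
Proof.
rewrite /sigma_sd ds.
have -> : (fun N : nat => (g N * ((powR N%:R (s / d%:R))^-1)%:E)%E) =
    EFin \o (fun N => gr N / powR N%:R (s / d%:R)).
  by apply/funext => N /=; rewrite gE -EFinM.
suff -> : lim (EFin \o (fun N => gr N / powR N%:R (s / d%:R)) @ \oo) = S%:E by [].
apply/cvg_lim => //; apply: cvg_EFin; first by near=> N.
apply/cvgrPdist_le => e e0; have [n0 Hn0] := lower e0.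
near=> N.
have N0 : (0 < N)%N by near: N; exact: nbhs_infty_gt.
have : (S - e) * powR N%:R (s / d%:R) <= gr N.
  by apply: Hn0; near: N; exact: nbhs_infty_ge.
rewrite -ler_pdivlMr ?powN// => H /=; have := ratio_le N0 => H2.
rewrite ger0_norm; lra.
Unshelve. all: by end_near. Qed.

Lemma cube_asymp_super : 0 < sigma_sd s d /\
  cube_upper s d (sigma_sd s d) /\ cube_lower s d (sigma_sd s d).
Proof.
rewrite sigmaE; split; first exact: S_gt0.
split=> e e0.
  exists 0 => // n N nN N0; rewrite mul0r addr0 /tau ds gE lee_fin.
  have NR : 0 < N%:R :> R by rewrite ltr0n.
  rewrite -mulrA -powRM ?divr_ge0// divfK ?gt_eqF//.
  case: n nN => [|n] nN.
    by rewrite /gr Pmax_cube0 /= mulr_ge0 ?powR_ge0// addr_ge0 ?ltW ?S_gt0.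
  have := @ratio_le n.+1 isT; rewrite ler_pdivrMr ?powN// => H.
  apply: le_trans H _; apply: ler_wpM2r; first exact: powR_ge0.
  by rewrite lerDl ltW.
have [n0 Hn0] := lower e0; exists n0 => n nn.
by rewrite gE lee_fin /tau ds; exact: Hn0.
Qed.

End Supercritical.
End CubeAsymptotics.

(** * The limit for s = d *)

Section LogFacts.
Variable R : realType.

Lemma ln_le_subr1 (x : R) : 0 < x -> ln x <= x - 1.
Proof. by move=> x0; rewrite -{1}(subrKC 1 x) le_ln1Dx; lra. Qed.

Lemma ln_ge_1Binv (x : R) : 0 < x -> 1 - x^-1 <= ln x.
Proof.
move=> x0; have := @ln_le_subr1 x^-1; rewrite invr_gt0 => /(_ x0).
by rewrite lnV ?posrE//; lra.
Qed.

(** The number of shells: [m] is [ln D / ln q] rounded up, and [q - 1 <= q * ln q]. *)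
Lemma exists_pow_close_ge (q D : R) : 1 < q -> 1 <= D ->
  exists2 m, D <= q ^+ m & (q - 1) * m%:R <= q * ln D + (q - 1).
Proof.
move=> q1 D1; have q0 : 0 < q by lra.
have lq : 0 < ln q by rewrite ln_gt0.
have lD : 0 <= ln D by exact: ln_ge0.
pose x := ln D / ln q; have x0 : 0 <= x by rewrite divr_ge0// ltW.
have /andP[t1 t2] := truncn_itv x0.
exists (Num.truncn x).+1.
  rewrite -ler_ln ?posrE ?exprn_gt0//; last by lra.
  by rewrite lnXn// -[leRHS]mulr_natl -ler_pdivrMr// ltW.
rewrite -natr1 mulrDr mulr1 lerD2r.
apply: (@le_trans _ _ ((q - 1) * x)); first by apply: ler_wpM2l => //; lra.
rewrite /x mulrA ler_pdivrMr// mulrAC; apply: ler_wpM2r => //.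
have := ler_wpM2l (ltW q0) (ln_ge_1Binv q0).
by rewrite mulrBr mulfV ?gt_eqF//; lra.
Qed.

(** Rounding down this time, with [ln q <= q - 1]. *)
Lemma exists_pow_close_le (q D : R) : 1 < q -> 1 <= D ->
  exists2 m, q ^+ m <= D & ln D / q - 1 <= (1 - q^-1) * m%:R.
Proof.
move=> q1 D1; have q0 : 0 < q by lra.
have lq : 0 < ln q by rewrite ln_gt0.
have lD : 0 <= ln D by exact: ln_ge0.
pose x := ln D / ln q; have x0 : 0 <= x by rewrite divr_ge0// ltW.
have /andP[t1 t2] := truncn_itv x0.
have qi : 0 < q^-1 by rewrite invr_gt0.
have qi1 : q^-1 < 1 by rewrite invf_lt1.
exists (Num.truncn x).
  rewrite -ler_ln ?posrE ?exprn_gt0//; last by lra.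
  by rewrite lnXn// -[leLHS]mulr_natl -ler_pdivlMr.
have : (1 - q^-1) * (x - 1) <= (1 - q^-1) * (Num.truncn x)%:R.
  by apply: ler_wpM2l; [lra|rewrite -natr1 in t2; lra].
apply: le_trans; rewrite mulrBr mulr1.
have : ln D / q <= (1 - q^-1) * x; last by lra.
rewrite /x mulrCA; apply: ler_wpM2l => //.
rewrite ler_pdivlMr//.
have := ler_wpM2l (ltW qi) (ln_le_subr1 q0).
by rewrite mulrBr mulVf ?gt_eqF//; lra.
Qed.

Lemma bernoulli_le (x : R) d : 0 <= x -> x <= 1 -> 1 - d%:R * x <= (1 - x) ^+ d.
Proof.
move=> x0 x1; elim: d => [|d IH]; first by rewrite expr0 mul0r subr0.
rewrite exprS -natr1.
have : 0 <= d%:R * x ^+ 2 by rewrite mulr_ge0// sqr_ge0.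
have := @ler_wpM2l _ (1 - x) _ _ _ IH; rewrite subr_ge0 => /(_ x1); lra.
Qed.

End LogFacts.

Section Critical.
Variables (R : realType) (d : nat).
Hypothesis d0 : (0 < d)%N.
Local Notation g n := (Pmax (fun=> 1%R) d%:R (unit_cube R d) n).
Local Notation BV := (ball_volume R d).
Let dR : 0 < d%:R :> R. Proof. by rewrite ltr0n. Qed.
Let BV0 : 0 < BV. Proof. exact: ball_volume_gt0. Qed.
Let tauE N : tau (d%:R : R) d N = N%:R * ln N%:R.
Proof. by rewrite /tau ltxx. Qed.

Lemma cube_upper_crit : cube_upper (d%:R : R) d BV.
Proof.
have V0 := BV0; set V := ball_volume R d in V0 *.
move=> e e0; pose B := V + e / 4.
have B0 : 0 < B by rewrite /B; lra.
pose q := (V + e / 2) / B.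
have q1 : 1 < q by rewrite ltr_pdivlMr// mul1r /B; lra.
have q0 : 0 < q by lra.
(* Later [r^d = th / n], and the excluded balls take up the share [B * th]. This [th] solves [(V +
   e) * (1 - B * th) = V + e / 2 = B * q], so that the denominator of the averaging bound is
   compensated exactly. *)
pose th := e / 2 / ((V + e) * B).
have VeB : 0 < (V + e) * B by rewrite mulr_gt0//; lra.
have th0 : 0 < th by rewrite !divr_gt0.
have Bth : B * th = 1 - (V + e / 2) / (V + e).
  by rewrite /th; field; rewrite !gt_eqF//; lra.
have Bth1 : B * th < 1.
  by rewrite Bth gtrBl divr_gt0//; lra.
have th1 : th * V < 1.
  by apply: le_lt_trans Bth1; rewrite mulrC; apply: ler_wpM2r; [exact: ltW|rewrite /B; lra].
pose L := ln (1 + d%:R ^+ d / th).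
have L0 : 0 <= L by apply: ln_ge0; rewrite lerDl divr_ge0 ?exprn_ge0 ?ltW.
exists ((V + e) * (1 + L)); first by rewrite mulr_ge0; lra.
move=> n N nN N0; rewrite divff ?gt_eqF// powRr1 ?divr_ge0// tauE.
have NR : 0 < N%:R :> R by rewrite ltr0n.
rewrite -[(V + e) * _ * _]mulrA [_ / _ * _]mulrA divfK ?gt_eqF//.
case: n nN => [|n'] nN.
  rewrite Pmax_cube0 lee_fin mul0r mulr0 add0r.
  by rewrite !mulr_ge0//; lra.
set n := n'.+1 in nN *; have nR : 1 <= n%:R :> R by rewrite ler1n.
pose r := powR (th / n%:R) d%:R^-1.
have thn : 0 < th / n%:R by rewrite divr_gt0//; lra.
have r0 : 0 < r by rewrite powR_gt0.
have rd : r ^+ d = th / n%:R.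
  by rewrite /r -powR_mulrn ?powR_ge0// -powRrM mulVf ?gt_eqF// powRr1// ltW.
(* [D] exceeds [(d / r)^d], so [lam^m] stretches the radius [r] beyond the diameter of the cube,
   while [ln D] exceeds [ln n] only by the constant [L]. *)
pose D := (1 + d%:R ^+ d / th) * n%:R.
have D1 : 1 <= D.
  rewrite -[leLHS]mulr1; apply: ler_pM => //.
  by rewrite lerDl divr_ge0 ?exprn_ge0 ?ltW.
have [m Dm Hm] := exists_pow_close_ge q1 D1.
pose lam := powR q d%:R^-1.
have lamd : lam ^+ d = q.
  by rewrite /lam -powR_mulrn ?powR_ge0// -powRrM mulVf ?gt_eqF// powRr1// ltW.
have lam1 : 1 < lam.
  apply: (@le_lt_trans _ _ (powR 1 d%:R^-1)); first by rewrite powR1.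
  by apply: gt0_ltr_powR; rewrite ?invr_gt0// ?nnegrE ?ltW.
have lam0 : 0 < lam by lra.
have drm : d%:R <= r * lam ^+ m.
  rewrite -(ler_pXn2r d0) ?nnegrE// ?mulr_ge0 ?exprn_ge0 ?(ltW r0) ?(ltW lam0)//.
  rewrite exprMn rd exprAC lamd; apply: (@le_trans _ _ (th / n%:R * D)); last first.
    by apply: ler_wpM2l => //; exact: ltW.
  have n0R : 0 < n%:R :> R by lra.
  have -> : th / n%:R * D = th + d%:R ^+ d.
    by rewrite /D; field; rewrite (gt_eqF th0) (gt_eqF n0R).
  by rewrite lerDr ltW.
have bet : n%:R * B * r ^+ d = B * th.
  by rewrite rd; field; rewrite gt_eqF//; lra.
have := @Pmax_cube_le R d d%:R (e / 4) r lam n m d0 (lexx _) isT ltac:(lra) r0 lam1 drm.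
rewrite -/B bet => /(_ Bth1) H; apply: le_trans H _; rewrite lee_fin.
rewrite subrr !powRr0 expr1n mulr1.
under eq_bigr do rewrite expr1n.
rewrite sumr_const card_ord powRN powR_mulrn ?(ltW lam0)// lamd.
rewrite mulrBr mulr1 mulfV ?gt_eqF//.
have den0 : 0 < 1 - B * th by lra.
rewrite ler_pdivrMr//.
have lnD : ln D = L + ln n%:R.
  have P1 : 0 < 1 + d%:R ^+ d / th.
    by rewrite ltr_wpDr// divr_ge0 ?exprn_ge0 ?(ltW th0).
  have P2 : 0 < n%:R :> R by lra.
  by rewrite /D lnM ?posrE.
have lnn : ln n%:R <= ln N%:R :> R by rewrite ler_ln ?posrE ?ltr0n// ler_nat.
have lnn0 : 0 <= ln n%:R :> R by exact: ln_ge0.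
have E1 : (V + e) * (1 - B * th) = B * q.
  by rewrite Bth /q; field; rewrite !gt_eqF//; lra.
have nNR : n%:R <= N%:R :> R by rewrite ler_nat.
have S1 : n%:R * B * (1 + (q - 1) * m%:R) <= n%:R * B * (q * (1 + L + ln n%:R)).
  by apply: ler_wpM2l; [rewrite mulr_ge0// ltW|rewrite lnD in Hm; lra].
apply: le_trans S1 _.
have -> : n%:R * B * (q * (1 + L + ln n%:R)) =
    (V + e) * (n%:R * (1 + L + ln n%:R)) * (1 - B * th).
  rewrite [RHS](_ : _ =
    n%:R * (1 + L + ln n%:R) * ((V + e) * (1 - B * th))); last by ring.
  by rewrite E1; ring.
apply: ler_wpM2r; first exact: ltW.
rewrite -mulrA -mulrDr; apply: ler_wpM2l; first by lra.
have : n%:R * (1 + L) <= N%:R * (1 + L) by apply: ler_wpM2r => //; lra.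
have : n%:R * ln n%:R <= n%:R * ln N%:R :> R by apply: ler_wpM2l => //; lra.
lra.
Qed.

Let clamp (x : R) := Num.max 0 (Num.min 1 x).

Let clamp_dist (y x : R) : 0 <= y <= 1 -> `|y - clamp x| <= `|y - x|.
Proof.
move=> /andP[y0 y1]; rewrite /clamp; have [x1|x1] := leP 1 x.
  by rewrite max_r ?ler01// !ler0_norm; lra.
have [x0|x0] := leP 0 x => //.
by rewrite subr0 !ger0_norm; lra.
Qed.

Let clamp_cube (x : R) : 0 <= clamp x <= 1.
Proof. by rewrite /clamp le_max lexx/= ge_max ler01 ge_min lexx. Qed.

(** [K] is the integer part of [n^(1/d) / (a + 3)]; for large [n] there is room on both sides: [(a +
    2) * K + 1 <= n^(1/d) <= (a + 4) * K]. *)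
Lemma box_size (a : nat) (c rho : R) : (0 < a)%N -> 1 <= rho ->
  exists n0, forall n, (n0 <= n)%N -> [/\ (0 < n)%N, c <= ln n%:R &
    exists K, [/\ (0 < K)%N, rho <= K%:R, (((a + 2) * K + 1) ^ d <= n)%N &
      n%:R <= ((a%:R + 4) * K%:R) ^+ d :> R]].
Proof.
move=> a_gt0 rho1; have aR : 0 < a%:R :> R by rewrite ltr0n.
have [N1 HN1] : exists N1, expR `|c| <= N1%:R.
  by exists (Num.bound (expR `|c|)); apply/ltW/archi_boundP/expR_ge0.
have P0 : 0 <= (a%:R + 4) * (a%:R + rho + 5) by apply: mulr_ge0; lra.
have [N2 HN2] : exists N2, ((a%:R + 4) * (a%:R + rho + 5)) ^+ d <= N2%:R.
  exists (Num.bound (((a%:R + 4) * (a%:R + rho + 5)) ^+ d : R)).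
  by apply/ltW/archi_boundP; rewrite exprn_ge0.
exists (N1 + N2 + 1)%N => n nn0.
have n0 : (0 < n)%N by apply: leq_trans nn0; rewrite leq_addl.
have nN1 : (N1 <= n)%N by apply: leq_trans nn0; rewrite -addnA leq_addr.
have nN2 : (N2 <= n)%N by apply: leq_trans nn0; rewrite addnAC leq_addl.
have nR : 0 < n%:R :> R by rewrite ltr0n.
split=> //.
  apply: le_trans (ler_norm _) _; rewrite -[leLHS]expRK.
  rewrite ler_ln ?posrE ?expR_gt0//.
  by apply: le_trans HN1 _; rewrite ler_nat.
pose xn : R := powR n%:R d%:R^-1.
have xn0 : 0 <= xn by exact: powR_ge0.
have xnd : xn ^+ d = n%:R.
  by rewrite /xn -powR_mulrn ?powR_ge0// -powRrM mulVf ?gt_eqF// powRr1.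
have xn_big : (a%:R + 4) * (a%:R + rho + 5) <= xn.
  rewrite -(ler_pXn2r d0) ?nnegrE//.
  by rewrite xnd; apply: le_trans HN2 _; rewrite ler_nat.
clearbody xn; clear HN1 HN2 nn0 nN1 nN2 N1 N2.
have a30 : 0 < a%:R + 3 :> R by lra.
pose y0 := xn / (a%:R + 3).
have y00 : 0 <= y0 by rewrite divr_ge0//; lra.
have y0E : xn = y0 * (a%:R + 3) by rewrite divfK// gt_eqF.
have /andP[K1 K2] := truncn_itv y00; rewrite -natr1 in K2.
have ybig : a%:R + rho + 5 <= y0.
  rewrite (ler_pdivlMr _ _ a30); apply: le_trans xn_big; rewrite mulrC.
  by apply: ler_wpM2r; lra.
move: (Num.truncn y0) K1 K2 => K; move: y0 y0E ybig {y00} => y y0E ybig K1 K2.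
have KR : rho <= K%:R by lra.
have Ka : a%:R + 3 <= K%:R :> R by lra.
have K0 : (0 < K)%N by rewrite -(ltr_nat R); lra.
exists K; split => //.
  rewrite -(ler_nat R) natrX -xnd; apply: lerXn2r; rewrite ?nnegrE//.
  rewrite natrD natrM natrD y0E.
  have := ler_wpM2r (ltW a30) K1; lra.
have aK4 : 0 <= (a%:R + 4) * K%:R :> R by apply: mulr_ge0 => //; lra.
rewrite -xnd; apply: lerXn2r; rewrite ?nnegrE//.
by rewrite y0E; have := ler_wpM2r (ltW a30) (ltW K2); lra.
Qed.

(* A lattice of mesh [1 / (a K)] covering the cube enlarged by [1 / a] in all
   directions, retracted onto the cube. *)
Lemma box_potential (a K m n : nat) (B B' C1 C2 rho lam : R) :
  (0 < a)%N -> (0 < K)%N -> (((a + 2) * K + 1) ^ d <= n)%N ->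
  0 < rho -> 1 < lam -> rho * lam ^+ m <= K%:R ->
  (forall v, rho <= v -> B * v ^+ d <= C1 * v ^+ d - C2) ->
  (forall M z q, 0 <= q ->
    (forall i, (i < d)%N -> Num.sqrt q <= z i /\ z i + Num.sqrt q <= M%:R - 1) ->
    C1 * Num.sqrt q ^+ d - C2 <= lcount d M z q) ->
  (forall M z, lcount d M z (rho ^+ 2) <= B' * rho ^+ d) ->
  (((a * K)%:R ^+ d * (B * (1 - (lam ^+ d)^-1) * m%:R - B'))%:E <= g n)%E.
Proof.
move=> a0 K0 Mn rho0 lam1 rlm HB HC2 HN0.
have lam0 : 0 < lam by apply: lt_trans lam1.
(* The overhang of [K] lattice units on each side keeps the balls of radius at most [K] about points
   of the cube inside the box, as the lower lattice count requires. *)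
pose M := ((a + 2) * K + 1)%N.
pose L := (a * K)%N.
have L0 : (0 < L)%N by rewrite muln_gt0 a0 K0.
have MR : M%:R - 1 = L%:R + 2 * K%:R :> R.
  by rewrite /M /L natrD !natrM natrD addrK; ring.
pose f (k : {ffun 'I_d -> 'I_M}) : 'rV[R]_d :=
  \row_i clamp (lpoint (K%:R : R) k L ord0 i).
have Af k : unit_cube R d (f k) by move=> i; rewrite mxE clamp_cube.
have [|om Aom HU] := @fin_config R d (unit_cube R d) _ f n 0 (unit_cube0 R d) Af.
  by rewrite card_ffun !card_ord.
apply: le_trans (Pmax_ge _ _ Aom); apply: Ppol_ge => y Ay.
apply: le_trans (HU y (fun=> 1%R) d%:R _); last by move=> ? _; exact: ler01.
pose z := lcoord (K%:R : R) L y.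
have HNj j : (j < m)%N -> B * Num.sqrt ((rho * lam ^+ j) ^+ 2) ^+ d <=
    lcount d M z ((rho * lam ^+ j) ^+ 2).
  move=> jm; set v := rho * lam ^+ j.
  have v1 : rho <= v by rewrite ler_peMr ?(ltW rho0)// exprn_ege1// ltW.
  have vK : v <= K%:R.
    by apply: le_trans rlm; rewrite ler_pM2l// ler_weXn2l ?(ltW lam1)// ltnW.
  have sv : Num.sqrt (v ^+ 2) = v.
    by rewrite sqrtr_sqr ger0_norm// (le_trans (ltW rho0)).
  have := HC2 M z (v ^+ 2) (sqr_ge0 _); rewrite sv => H.
  apply: le_trans (HB _ v1) (H _) => i id.
  have zE : z i = L%:R * y ord0 (Ordinal id) + K%:R.
    by rewrite -(lcoordE _ _ _ (Ordinal id)).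
  have /andP[y0' y1'] := Ay (Ordinal id).
  have : 0 <= L%:R * y ord0 (Ordinal id) by rewrite mulr_ge0.
  have : L%:R * y ord0 (Ordinal id) <= L%:R by rewrite ler_piMr.
  rewrite zE MR; by move: (L%:R * _) => t t1 t2; split; lra.
have := @layered_ge R d M m z d%:R rho lam B (lexx _) rho0 lam1 B' erefl HNj
  (HN0 M z).
set S := \sum_(k | _) _ => HS.
apply: (@le_trans _ _ (L%:R ^+ d * S)%:E).
  by rewrite lee_fin; apply: ler_wpM2l => //; rewrite exprn_ge0.
have -> : L%:R ^+ d * S = \sum_(k : {ffun 'I_d -> 'I_M} |
    rho ^+ 2 <= lsq z k <= (rho * lam ^+ m) ^+ 2)
    (L%:R ^+ d * powR (Num.sqrt (lsq z k)) (- d%:R)).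
  by rewrite mulr_sumr.
rewrite big_mkcond -sumEFin; apply: lee_sum => k _.
case: ifP => [/andP[rk _]|_]; last by rewrite rkernel_ge0// ler01.
rewrite rkernel1E.
have LR : 0 < L%:R :> R by rewrite ltr0n.
have lk : 0 < Num.sqrt (lsq z k).
  by rewrite sqrtr_gt0; apply: lt_le_trans rk; rewrite exprn_gt0.
have E : edist y (lpoint K%:R k L) = Num.sqrt (lsq z k) / L%:R.
  by rewrite edistC edist_lpoint.
apply: (@le_trans _ _ (riesz d%:R (edist y (lpoint K%:R k L)))).
  rewrite /riesz E gt_eqF ?divr_gt0// lee_fin.
  rewrite powRM ?(ltW lk) ?invr_ge0 ?(ltW LR)//.
  by rewrite powR_inv// opprK powR_mulrn ?(ltW LR)// mulrC.
apply: riesz_anti; rewrite ?edist_ge0//.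
rewrite -(ler_pXn2r (n := 2))// ?nnegrE ?edist_ge0// !edist_sqr.
apply: ler_sum => i _; rewrite -[leLHS]real_normK ?num_real//.
rewrite -[leRHS]real_normK ?num_real// ler_pXn2r ?nnegrE// mxE.
exact: clamp_dist.
Qed.

Lemma cube_lower_crit : cube_lower (d%:R : R) d BV.
Proof.
have V0 := BV0; set V := ball_volume R d in V0 *.
move=> e e0; have [Ve|Ve] := leP (V - e) 0.
  exists 1%N => n n1; rewrite tauE; apply: le_trans (Pmax_cube_ge0 _ _ _).
  by rewrite lee_fin mulr_le0_ge0// mulr_ge0// ln_ge0// ler1n.
pose B := V - e / 8; have B0 : 0 < B by rewrite /B; lra.
pose B' := V + e / 8; have B'0 : 0 < B' by rewrite /B'; lra.
pose q := B / (V - e / 4).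
have V4 : 0 < V - e / 4 by lra.
have q1 : 1 < q by rewrite ltr_pdivlMr// mul1r /B; lra.
have q0 : 0 < q by lra.
have BqE : B / q = V - e / 4.
  by rewrite /q invf_div mulrCA mulfV ?mulr1// (gt_eqF B0).
pose lam := powR q d%:R^-1.
have lamd : lam ^+ d = q.
  by rewrite /lam -powR_mulrn ?powR_ge0// -powRrM mulVf ?gt_eqF// powRr1// ltW.
have lam1 : 1 < lam.
  apply: (@le_lt_trans _ _ (powR 1 d%:R^-1)); first by rewrite powR1.
  by apply: gt0_ltr_powR; rewrite ?invr_gt0// ?nnegrE ?ltW.
have lam0 : 0 < lam by lra.
have [Hup Hlo] := lcount_asymp R d0.
have e16 : 0 < e / 16 by lra.
have [C1 C10 HC1] := Hup _ e16.
have [C2 C20 HC2] := Hlo _ e16; rewrite -/V in HC1 HC2.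
have [rho rho1 rhoC] : exists2 rho, 1 <= rho & C1 + C2 <= e / 16 * rho.
  exists (1 + (C1 + C2) / (e / 16)).
    by rewrite lerDl divr_ge0 ?addr_ge0// ltW.
  rewrite mulrDr mulr1 mulrCA divff ?gt_eqF// mulr1; lra.
have rho0 : 0 < rho by lra.
have rhod v : rho <= v -> C1 + C2 <= e / 16 * v ^+ d.
  move=> rv; apply: le_trans rhoC _; rewrite ler_pM2l//.
  apply: (le_trans rv); rewrite -[leLHS]expr1 ler_weXn2l//.
  exact: le_trans rv.
have HB v : rho <= v -> B * v ^+ d <= (V - e / 16) * v ^+ d - C2.
  by move=> /rhod; move: (v ^+ d) => w Hw; rewrite /B; lra.
have HN0 M z : lcount d M z (rho ^+ 2) <= B' * rho ^+ d.
  apply: le_trans (HC1 _ _ _ (sqr_ge0 _)) _.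
  rewrite sqrtr_sqr ger0_norm ?(ltW rho0)//.
  by have := rhod rho (lexx _); move: (rho ^+ d) => w Hw; rewrite /B'; lra.
(* [gam] is the tolerated loss due to the overhang: the lattice has [(a * K)^d] points per unit
   volume, at least [t^d * n] with [t = a / (a + 4)], and [a] is chosen to make [t^d >= 1 - gam]. *)
pose gam := (e / 4) / (V - e / 4).
have gam0 : 0 < gam by rewrite divr_gt0//; lra.
have [a a_gt0 a4] : exists2 a, (0 < a)%N & 4 * d%:R / gam <= a%:R + 4.
  have H0 : 0 <= 4 * d%:R / gam by apply: divr_ge0; [rewrite mulr_ge0|exact: ltW].
  exists (Num.bound (4 * d%:R / gam)).+1 => //.
  by have := archi_boundP H0; rewrite -natr1; lra.
have aR : 0 < a%:R :> R by rewrite ltr0n.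
pose t : R := a%:R / (a%:R + 4).
have a40 : 0 < a%:R + 4 :> R by lra.
have tE : t = 1 - 4 / (a%:R + 4) by rewrite /t; field; rewrite gt_eqF.
have t0 : 0 <= t by rewrite divr_ge0// ltW.
have t1 : t <= 1 by rewrite tE gerBl divr_ge0// ltW.
have td : 1 - gam <= t ^+ d.
  rewrite tE; apply: le_trans (bernoulli_le _ _ _).
  - rewrite lerD2l lerN2 mulrA ler_pdivrMr//.
    by move: a4; rewrite ler_pdivrMr// mulrC [gam * _]mulrC.
  - by rewrite divr_ge0// ltW.
  - by rewrite ler_pdivrMr// mul1r lerDr ltW.
have Vt : V - e / 2 <= t ^+ d * (B / q).
  rewrite BqE; apply: le_trans (ler_wpM2r (ltW V4) td).
  rewrite mulrBl mul1r /gam divfK ?gt_eqF//; lra.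
pose c1 := d%:R * ln (a%:R + 4) + d%:R * ln rho.
pose c3 := (B / q) * c1 + (B + B').
have [n0 Hn0] := box_size (2 * c3 / e) a_gt0 rho1.
exists n0 => n /Hn0[n_gt0 lnx1 [K [K0 Krho Mn Kn]]]; rewrite tauE.
have nR : 1 <= n%:R :> R by rewrite ler1n.
have KR : 0 < K%:R :> R by rewrite ltr0n.
have D1 : 1 <= (K%:R / rho) ^+ d by rewrite exprn_ege1// ler_pdivlMr// mul1r.
have [m qm Hm] := exists_pow_close_le q1 D1.
have rlm : rho * lam ^+ m <= K%:R.
  rewrite mulrC -ler_pdivlMr// -(ler_pXn2r d0) ?nnegrE ?exprn_ge0 ?(ltW lam0)//.
    by rewrite exprAC lamd.
  by rewrite divr_ge0// ltW.
apply: le_trans (box_potential a_gt0 K0 Mn rho0 lam1 rlm HB HC2 HN0).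
rewrite lamd lee_fin; set S := _ - B'.
have S1 : (B / q) * ln n%:R - c3 <= S.
  have lnK : ln n%:R - c1 <= ln ((K%:R / rho) ^+ d).
    rewrite lnXn ?divr_gt0// ln_div ?posrE// -[leRHS]mulr_natl mulrBr.
    have : ln n%:R <= ln (((a%:R + 4) * K%:R) ^+ d) :> R.
      by rewrite ler_ln ?posrE ?exprn_gt0 ?mulr_gt0// (lt_le_trans ltr01 nR).
    rewrite lnXn ?mulr_gt0// lnM ?posrE// -[X in _ <= X -> _]mulr_natl mulrDr /c1.
    by lra.
  have qi0 : 0 <= q^-1 by rewrite invr_ge0 ltW.
  have H1 : B * (ln ((K%:R / rho) ^+ d) / q - 1) <= B * ((1 - q^-1) * m%:R).
    by apply: ler_wpM2l => //; exact: ltW.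
  have H2 : B / q * (ln n%:R - c1) <= B / q * ln ((K%:R / rho) ^+ d).
    by apply: ler_wpM2l => //; rewrite mulr_ge0// ltW.
  rewrite /S /c3; move: H1 H2; set l1 := ln _; set l2 := ln _.
  by lra.
have Ld : t ^+ d * n%:R <= (a * K)%:R ^+ d.
  apply: le_trans (ler_wpM2l (exprn_ge0 d t0) Kn) _.
  rewrite -exprMn /t mulrA divfK ?gt_eqF// natrM.
  by [].
have tn0 : 0 <= t ^+ d * n%:R by rewrite mulr_ge0// exprn_ge0.
have td1 : t ^+ d <= 1 by rewrite exprn_ile1.
have lnn : 0 <= ln n%:R :> R by exact: ln_ge0.
have c3e : c3 <= e / 2 * ln n%:R.
  by move: lnx1; rewrite ler_pdivrMr//; lra.
have lnr0 : 0 <= ln rho by exact: ln_ge0.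
have lna0 : 0 <= ln (a%:R + 4) :> R by apply: ln_ge0; lra.
have c10 : 0 <= c1 by rewrite addr_ge0 ?mulr_ge0.
have Bq0 : 0 <= B / q by rewrite divr_ge0 ?(ltW B0) ?(ltW q0).
have c30 : 0 <= c3.
  by apply: addr_ge0 (mulr_ge0 Bq0 c10) (addr_ge0 (ltW B0) (ltW B'0)).
have S2 : (V - e / 2) * ln n%:R - c3 <= t ^+ d * ((B / q) * ln n%:R - c3).
  have : (V - e / 2) * ln n%:R <= t ^+ d * (B / q) * ln n%:R by apply: ler_wpM2r.
  have : t ^+ d * c3 <= 1 * c3 by apply: ler_wpM2r.
  by lra.
have S3 : n%:R * ((V - e / 2) * ln n%:R - c3) <=
    n%:R * (t ^+ d * ((B / q) * ln n%:R - c3)) by apply: ler_wpM2l.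
have S4 : t ^+ d * n%:R * ((B / q) * ln n%:R - c3) <= t ^+ d * n%:R * S.
  exact: ler_wpM2l.
have S5 : n%:R * c3 <= n%:R * (e / 2 * ln n%:R) by apply: ler_wpM2l.
have S0 : 0 <= S.
  apply: le_trans S1; rewrite subr_ge0; apply: le_trans c3e _.
  apply: ler_wpM2r => //; rewrite BqE; lra.
have S6 : t ^+ d * n%:R * S <= (a * K)%:R ^+ d * S by apply: ler_wpM2r.
move: S3 S4 S5 S6; set X := t ^+ d; set Y := (a * K)%:R ^+ d; set l := ln _.
by lra.
Qed.

End Critical.

Lemma cube_asymp (R : realType) (d : nat) (s : R) : (0 < d)%N -> d%:R <= s ->
  0 < sigma_sd s d /\
  cube_upper s d (sigma_sd s d) /\ cube_lower s d (sigma_sd s d).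
Proof.
move=> d0; rewrite le_eqVlt => /orP[/eqP<-|ds]; last exact: cube_asymp_super.
rewrite /sigma_sd ltxx; split; first exact: ball_volume_gt0.
by split; [exact: cube_upper_crit|exact: cube_lower_crit].
Qed.

(** * Hausdorff measure *)

Section Diameter.
Variables (R : realType) (p : nat).
Implicit Types (E F : set 'rV[R]_p).

Lemma diam_le_bound E r : (forall x y, E x -> E y -> edist x y <= r) ->
  (diam E <= r%:E)%E.
Proof.
move=> H; apply: ge_ereal_sup => _ [x Ex [y Ey <-]].
by rewrite lee_fin; exact: H.
Qed.

Lemma edist_le_diam E x y : E x -> E y -> ((edist x y)%:E <= diam E)%E.
Proof. by move=> Ex Ey; apply: ereal_sup_ubound; exists x => //; exists y. Qed.

Lemma sub_diam E F : E `<=` F -> (diam E <= diam F)%E.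
Proof.
move=> EF; apply: ge_ereal_sup => _ [x Ex [y Ey <-]].
by apply: edist_le_diam; exact: EF.
Qed.

Lemma diam0 : diam (set0 : set 'rV[R]_p) = -oo%E.
Proof. by apply/eqP; rewrite -leeNy_eq; apply: ge_ereal_sup => _ [x []]. Qed.

Lemma diam_ge0 E : E !=set0 -> (0 <= diam E)%E.
Proof. by move=> [x Ex]; apply: le_trans (edist_le_diam Ex Ex); rewrite edistxx. Qed.

Lemma hterm0 d : hterm d (set0 : set 'rV[R]_p) = 0%E.
Proof. by rewrite /hterm diam0. Qed.

Lemma hterm_ge0 d E : (0 <= hterm d E)%E.
Proof.
rewrite /hterm; have [->|/set0P/diam_ge0] := eqVneq E set0; first by rewrite diam0.
by case: (diam E) => // r r0; rewrite lee_fin exprn_ge0.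
Qed.

Lemma hterm_le d E r : 0 <= r -> (diam E <= r%:E)%E -> (hterm d E <= (r ^+ d)%:E)%E.
Proof.
move=> r0; rewrite /hterm; have [->|/set0P/diam_ge0] := eqVneq E set0.
  by rewrite diam0/= => _; rewrite lee_fin exprn_ge0.
case: (diam E) => // t; rewrite !lee_fin => t0 tr.
by apply: lerXn2r; rewrite ?nnegrE.
Qed.

Lemma hterm_fin d E : E !=set0 -> (hterm d E < +oo)%E ->
  exists2 r, 0 <= r & diam E = r%:E /\ hterm d E = (r ^+ d)%:E.
Proof.
move=> /diam_ge0; rewrite /hterm; case: (diam E) => // r r0 _.
by exists r.
Qed.

End Diameter.

Section HausdorffLipschitz.
Variable R : realType.
Variable d : nat.

Lemma hterm_lip (p q : nat) (g : 'rV[R]_p -> 'rV[R]_q) L (E : set 'rV[R]_p) :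
  0 < L -> (forall x y, E x -> E y -> edist (g x) (g y) <= L * edist x y) ->
  (hterm d (g @` E) <= (L ^+ d)%:E * hterm d E)%E.
Proof.
move=> L0 gL; have [->|/set0P E0] := eqVneq E set0.
  by rewrite image_set0 !hterm0 mule0.
have Ld : 0 < L ^+ d by rewrite exprn_gt0.
have [|hfin] := leP +oo%E (hterm d E).
  by rewrite leye_eq => /eqP->; rewrite gt0_muley ?lte_fin// leey.
have [r r0 [dE hE]] := hterm_fin E0 hfin.
rewrite hE -EFinM -exprMn; apply: hterm_le; first by rewrite mulr_ge0// ltW.
apply: diam_le_bound => _ _ [x Ex <-] [y Ey <-].
apply: le_trans (gL _ _ Ex Ey) _; rewrite ler_pM2l// -lee_fin -dE.
exact: edist_le_diam.
Qed.

Lemma diam_lip (p q : nat) (g : 'rV[R]_p -> 'rV[R]_q) L (E : set 'rV[R]_p) r :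
  0 < L -> (forall x y, E x -> E y -> edist (g x) (g y) <= L * edist x y) ->
  (diam E <= r%:E)%E -> (diam (g @` E) <= (L * r)%:E)%E.
Proof.
move=> L0 gL Er; apply: diam_le_bound => _ _ [x Ex <-] [y Ey <-].
apply: le_trans (gL _ _ Ex Ey) _; rewrite ler_pM2l// -lee_fin.
by apply: le_trans Er; exact: edist_le_diam.
Qed.

Lemma hdelta_le (p : nat) delta (E : set 'rV[R]_p) (F : nat -> set 'rV[R]_p) :
  E `<=` \bigcup_i F i -> (forall i, (diam (F i) <= delta%:E)%E) ->
  (hdelta d delta E <= \sum_(0 <= i <oo) hterm d (F i))%E.
Proof. by move=> EF dF; apply: ereal_inf_lbound; exists F. Qed.

Lemma hdelta_ge0 (p : nat) delta (E : set 'rV[R]_p) : (0 <= hdelta d delta E)%E.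
Proof.
apply: le_ereal_inf_tmp => _ [F _ <-].
by apply: nneseries_ge0 => i _ _; exact: hterm_ge0.
Qed.

Lemma hdelta_le_hraw (p : nat) delta (E : set 'rV[R]_p) : 0 < delta ->
  (hdelta d delta E <= hraw d E)%E.
Proof. by move=> d0; apply: ereal_sup_ubound; exists delta. Qed.

Lemma hraw_ge0 (p : nat) (E : set 'rV[R]_p) : (0 <= hraw d E)%E.
Proof. exact: le_trans (hdelta_ge0 1 E) (hdelta_le_hraw E ltr01). Qed.

Lemma hraw_lip (p q : nat) (g : 'rV[R]_p -> 'rV[R]_q) L (E : set 'rV[R]_p) :
  0 < L -> (forall x y, E x -> E y -> edist (g x) (g y) <= L * edist x y) ->
  (hraw d (g @` E) <= (L ^+ d)%:E * hraw d E)%E.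
Proof.
move=> L0 gL; have Ld : 0 < L ^+ d by rewrite exprn_gt0.
apply: ge_ereal_sup => _ [delta /= d0 <-].
apply: (@le_trans _ _ ((L ^+ d)%:E * hdelta d (delta / L) E)%E); last first.
  apply: lee_wpmul2l; first by rewrite lee_fin ltW.
  by apply: hdelta_le_hraw; rewrite divr_gt0.
rewrite -lee_pdivrMl//; apply: le_ereal_inf_tmp => _ [F [EF dF] <-].
rewrite lee_pdivrMl// -nneseriesZl; last by move=> i _; exact: hterm_ge0.
(* The covering sets are first cut down to [E], the only place where [g] is known to be
   Lipschitz. *)
apply: (@le_trans _ _ (\sum_(0 <= i <oo) hterm d (g @` (F i `&` E)))%E).
  apply: hdelta_le => [_ [x Ex <-]|i].
    have [i _ Fx] := EF _ Ex; exists i => //; exists x => //; by split.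
  have -> : delta = L * (delta / L) by rewrite mulrC divfK// gt_eqF.
  apply: diam_lip => // [x y [_ Ex] [_ Ey]|]; first exact: gL.
  by apply: le_trans (dF i); apply: sub_diam => x [].
apply: lee_nneseries => [i _ _|i _]; first exact: hterm_ge0.
apply: (@le_trans _ _ ((L ^+ d)%:E * hterm d (F i `&` E))%E).
  by apply: hterm_lip => // x y [_ Ex] [_ Ey]; exact: gL.
apply: lee_wpmul2l; first by rewrite lee_fin ltW.
have [->|/set0P FE0] := eqVneq (F i `&` E) set0; first by rewrite hterm0 hterm_ge0.
have [|hfin] := leP +oo%E (hterm d (F i)); first by rewrite leye_eq => /eqP->; rewrite leey.
have F0 : F i !=set0 by case: FE0 => x [Fx _]; exists x.
have [r r0 [dE hE]] := hterm_fin F0 hfin.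
by rewrite hE; apply: hterm_le => //; rewrite -dE; apply: sub_diam => x [].
Qed.

Lemma sub_hraw (p : nat) (E F : set 'rV[R]_p) : E `<=` F ->
  (hraw d E <= hraw d F)%E.
Proof.
move=> EF; apply: ge_ereal_sup => _ [delta /= d0 <-].
apply: le_trans (hdelta_le_hraw F d0).
apply: le_ereal_inf_tmp => _ [G [FG dG] <-]; apply: hdelta_le => //.
exact: subset_trans FG.
Qed.

End HausdorffLipschitz.

Section HausdorffCovers.
Variable R : realType.

Lemma expr_perturb d (r : R) : 0 <= r -> exists2 C, 0 < C &
  forall t, 0 <= t <= 1 -> (r + t) ^+ d <= r ^+ d + t * C.
Proof.
move=> r0; elim: d => [|d [C C0 IH]].
  by exists 1 => // t /andP[t0 _]; rewrite !expr0 mulr1 lerDl.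
exists ((r + 1) * C + r ^+ d).
  by rewrite ltr_wpDr ?exprn_ge0// mulr_gt0// ltr_wpDl.
move=> t /andP[t0 t1]; have rt : 0 <= r + t by rewrite addr_ge0.
have t01 : 0 <= t <= 1 by rewrite t0.
have H := ler_wpM2l rt (IH t t01); rewrite !exprS; apply: le_trans H _.
have : t * C * t <= t * C * 1 by apply: ler_wpM2l => //; rewrite mulr_ge0// ltW.
by move: (r ^+ d) => x; lra.
Qed.

Lemma sum_uniq_nat_le (f : nat -> R) (s : seq nat) : (forall i, 0 <= f i) ->
  uniq s -> exists n, \sum_(i <- s) f i <= \sum_(i < n) f i.
Proof.
move=> f0 us; pose n := (\max_(i <- s) i).+1; exists n.
have -> : \sum_(i <- s) f i = \sum_(i <- [seq i <- iota 0 n | i \in s]) f i.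
  apply: perm_big; apply: uniq_perm => //; first by rewrite filter_uniq// iota_uniq.
  move=> i; rewrite mem_filter mem_iota add0n; case: (boolP (i \in s)) => //= si.
  by rewrite /n ltnS (bigD1_seq i) //= leq_maxl.
rewrite -(big_mkord xpredT f) /index_iota subn0.
by rewrite big_filter big_mkcond; apply: ler_sum => i _; case: ifP.
Qed.

Lemma geo_half_sum (x : R) n : 0 <= x -> \sum_(i < n) x / 2 ^+ i.+1 <= x.
Proof.
move=> x0; suff -> : \sum_(i < n) x / 2 ^+ i.+1 = x - x / 2 ^+ n.
  by rewrite gerBl divr_ge0.
elim: n => [|n IH]; first by rewrite big_ord0 expr0 divr1 subrr.
rewrite big_ord_recr/= IH exprS; field.
by rewrite expf_neq0.
Qed.

(** A covering set that meets [K] lies in an open ball about one of its points in [K], of radius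
    slightly above its diameter; the [i]-th term grows by at most [g / 2^(i+1)], where [g] is the
    room left below [x]. Compactness then leaves finitely many balls. *)
Lemma compact_hcover (p d : nat) (K : set 'rV[R]_p) (delta x : R) :
  compact K -> 0 < delta -> (hdelta d delta K < x%:E)%E ->
  exists s : seq ('rV[R]_p * R),
    [/\ forall c, c \in s -> K c.1 /\ 0 < c.2 <= 2 * delta,
        forall y, K y -> exists2 c, c \in s & eball c.1 c.2 y &
        \sum_(c <- s) c.2 ^+ d <= x].
Proof.
move=> cK delta0 /ereal_inf_lt[_ [F [KF dF] <-] Fx].
set tot := (\sum_(0 <= i <oo) hterm d (F i))%E in Fx.
have h0 i : (0 <= hterm d (F i))%E by exact: hterm_ge0.
have tot0 : (0 <= tot)%E by apply: nneseries_ge0.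
have totfin : tot \is a fin_num by rewrite ge0_fin_numE// (lt_trans Fx)// ltry.
pose g := x - fine tot.
have g0 : 0 < g by rewrite subr_gt0 -lte_fin fineK.
have part n : (\sum_(0 <= i < n) hterm d (F i) <= tot)%E.
  exact: nneseries_lim_ge.
have hfin i : (hterm d (F i) < +oo)%E.
  apply: le_lt_trans (lt_trans Fx (ltry x)); apply: le_trans (part i.+1).
  by rewrite big_nat_recr//= leeDr// sume_ge0.
pose P i := F i `&` K !=set0.
have /choice[c Hc] : forall i, exists c : 'rV[R]_p * R, P i ->
   [/\ K c.1, 0 < c.2 <= 2 * delta, F i `<=` eball c.1 c.2 &
    c.2 ^+ d <= fine (hterm d (F i)) + g / 2 ^+ i.+1].
  move=> i; have [Pi|nPi] := pselect (P i); last by exists (0, 0).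
  have [a [Fa Ka]] := Pi.
  have [r r0 [dE hE]] := hterm_fin (ex_intro _ a Fa) (hfin i).
  have [C C0 HC] := expr_perturb d r0.
  have gi : 0 < g / 2 ^+ i.+1 by rewrite divr_gt0// exprn_gt0.
  pose t := Num.min (Num.min 1 delta) (g / 2 ^+ i.+1 / C).
  have t0 : 0 < t by rewrite !lt_min ltr01 delta0 divr_gt0.
  have : t <= t by [].
  rewrite {2}/t !le_min => /andP[/andP[t1 td] tC].
  have rd : r <= delta by rewrite -lee_fin -dE.
  exists (a, r + t) => _; split => //=.
  - by rewrite ltr_wpDl//=; lra.
  - move=> y Fy; rewrite /eball/=; apply: (@le_lt_trans _ _ r); last by rewrite ltrDl.
    by rewrite -lee_fin -dE; exact: edist_le_diam.
  - rewrite hE/=; apply: le_trans (HC t _) _; first by rewrite ltW.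
    by rewrite lerD2l -ler_pdivlMr.
have : compact K := cK; rewrite compact_cover => /(_ nat P (fun i => eball (c i).1 (c i).2)).
case=> [i _|y Ky|D DP Dcov]; first exact: open_eball.
  have [i _ Fy] := KF _ Ky; have Pi : P i by exists y.
  by exists i => //; have [_ _ H _] := Hc i Pi; exact: H.
have DPi i : i \in D -> P i by move=> /DP/set_mem.
exists [seq c i | i <- enum_fset D]; split.
- move=> _ /mapP[i iD ->]; by have [] := Hc i (DPi _ iD).
- move=> y /Dcov[i iD Hy]; exists (c i) => //.
  by apply/mapP; exists i.
rewrite big_map; apply: (@le_trans _ _ (\sum_(i <- enum_fset D)
   (fine (hterm d (F i)) + g / 2 ^+ i.+1))).
  rewrite big_seq [leRHS]big_seq; apply: ler_sum => i iD.
  by have [] := Hc i (DPi _ iD).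
have fnn i : 0 <= fine (hterm d (F i)) + g / 2 ^+ i.+1.
  by rewrite addr_ge0 ?fine_ge0// divr_ge0 ?exprn_ge0// ltW.
have [n Hn] := sum_uniq_nat_le fnn (fset_uniq D).
apply: le_trans Hn _; rewrite big_split/=.
have H1 : \sum_(i < n) fine (hterm d (F i)) <= fine tot.
  rewrite -lee_fin fineK// -sumEFin; apply: le_trans (part n).
  rewrite big_mkord; apply: lee_sum => i _; rewrite fineK//.
  by rewrite ge0_fin_numE.
have := geo_half_sum n (ltW g0); rewrite /g in H1 *; lra.
Qed.

Lemma hdelta_finite (p d : nat) (T : finType) (G : T -> set 'rV[R]_p)
    (E : set 'rV[R]_p) (r delta : R) :
  E `<=` \bigcup_t G t -> 0 <= r -> r <= delta ->
  (forall t, (diam (G t) <= r%:E)%E) ->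
  (hdelta d delta E <= (#|T|%:R * r ^+ d)%:E)%E.
Proof.
move=> EG r0 rd dG.
pose F (i : nat) : set 'rV[R]_p :=
  if insub i is Some j then G (@enum_val T predT j) else set0.
have dF i : (diam (F i) <= r%:E)%E.
  by rewrite /F; case: insubP => [j _ _|_]//; rewrite diam0 leNye.
apply: le_trans (hdelta_le d (_ : E `<=` \bigcup_i F i) (_ : forall i, _)) _.
- move=> y /EG[t _ Gy]; exists (enum_rank t) => //.
  by rewrite /F valK enum_rankK.
- by move=> i; apply: le_trans (dF i) _; rewrite lee_fin.
apply: lime_le; first by apply: is_cvg_nneseries => i _ _; exact: hterm_ge0.
apply: nearW => n; apply: (@le_trans _ _
   (\sum_(0 <= i < n) ((i < #|T|)%N%:R * r ^+ d)%:E)%E).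
  apply: lee_sum => i _; rewrite /F; case: insubP => [j ij _|ij].
    by rewrite ij mul1r; apply: hterm_le.
  by rewrite hterm0 (negbTE ij) mul0r.
rewrite sumEFin lee_fin -mulr_suml; apply: ler_wpM2r; first by rewrite exprn_ge0.
rewrite -natr_sum ler_nat.
elim: n => [|n IH]; first by rewrite big_nil.
suff : (\sum_(0 <= i < n.+1) (i < #|T|)%N)%N = minn n.+1 #|T| by lia.
elim: n.+1 => [|k IHk]; first by rewrite big_nil min0n.
by rewrite big_nat_recr//= IHk; case: ltnP; lia.
Qed.

End HausdorffCovers.

Section HausdorffCube.
Variables (R : realType) (d : nat).
Hypothesis d0 : (0 < d)%N.
Let dR : 0 < d%:R :> R. Proof. by rewrite ltr0n. Qed.

Lemma hraw_cube_fin : (hraw d (unit_cube R d) <= (d%:R ^+ d)%:E)%E.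
Proof.
apply: ge_ereal_sup => _ [delta /= delta0 <-].
have [m m0 mle] := @inv_nat_le R (delta / d%:R) (divr_gt0 delta0 dR).
have mR : 0 < m%:R :> R by rewrite ltr0n.
pose G (k : {ffun 'I_d -> 'I_m}) : set 'rV[R]_d :=
  [set y | forall i, 0 <= m%:R * y ord0 i - (k i)%:R <= 1].
have := @hdelta_finite R d d _ G (unit_cube R d) (d%:R * m%:R^-1) delta.
have -> : #|{: {ffun 'I_d -> 'I_m}}|%:R * (d%:R * m%:R^-1) ^+ d = d%:R ^+ d :> R.
  rewrite card_ffun !card_ord exprMn natrX mulrCA -exprMn divff ?gt_eqF//.
  by rewrite expr1n mulr1.
apply.
- move=> y Ay; have /choice[k Hk] : forall i : 'I_d, exists k : 'I_m,
      0 <= m%:R * y ord0 i - k%:R <= 1.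
    by move=> i; apply: unit_cell => //; exact: Ay.
  by exists [ffun i => k i] => // i; rewrite ffunE.
- by rewrite mulr_ge0.
- by rewrite mulrC -ler_pdivlMr.
- move=> k; apply: diam_le_bound => x y Gx Gy.
  apply: edist_le_coord => [|i]; first by rewrite invr_ge0.
  have /andP[x1 x2] := Gx i; have /andP[y1 y2] := Gy i.
  rewrite -(ler_pM2l mR) mulfV ?gt_eqF// -{1}(ger0_norm (ltW mR)) -normrM mulrBr.
  by rewrite ler_norml; apply/andP; split; lra.
Qed.

(** Lattice points stand in for Lebesgue measure: finitely many balls that cover the cube contain
    all [m^d] points of a lattice, while a ball of radius [rho] has at most
    [(V + 1) * (rho * m)^d + C] of them. If the sum of the [rho^d] is at most [1 / (2 (V + 1))],
    this fails for large [m]. *)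
Lemma hraw_cube_gt0 : (0 < hraw d (unit_cube R d))%E.
Proof.
have V0 := ball_volume_gt0 R d; set V := ball_volume R d in V0 *.
pose c : R := (2 * (V + 1))^-1.
have c0 : 0 < c by rewrite invr_gt0; lra.
suff : (c%:E <= hdelta d 1 (unit_cube R d))%E.
  by move=> H; apply: lt_le_trans (hdelta_le_hraw d _ ltr01); apply: lt_le_trans H.
rewrite leNgt; apply/negP => H.
have cQ : compact (unit_cube R d).
  rewrite (_ : unit_cube R d = [set v : 'rV[R]_d | forall i, `[0, 1]%classic (v ord0 i)]).
    apply: (@rV_compact _ _ (fun=> `[(0 : R), (1 : R)]%classic)).
    by move=> i; exact: segment_compact.
  by apply/seteqP; split => v Hv i; have := Hv i; rewrite /= in_itv/=.
have [s [Hs scov ssum]] := compact_hcover cQ ltr01 H.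
have [Hup _] := lcount_asymp R d0.
have [C C0 HC] := Hup 1 ltr01; rewrite -/V in HC.
have [m m0 Hm] : exists2 m, (0 < m)%N & 4 * (C * (size s)%:R) <= m%:R.
  exists (Num.bound (4 * (C * (size s)%:R))).+1 => //.
  have /archi_boundP : 0 <= 4 * (C * (size s)%:R) by rewrite !mulr_ge0.
  by rewrite -natr1; lra.
have mR : 0 < m%:R :> R by rewrite ltr0n.
have m1 : 1 <= m%:R :> R by rewrite ler1n.
have md : m%:R <= m%:R ^+ d :> R by rewrite -[leLHS]expr1 ler_weXn2l.
have : m%:R ^+ d <= \sum_(c <- s) ((V + 1) * c.2 ^+ d * m%:R ^+ d + C).
  apply: (@le_trans _ _ (\sum_(c <- s) lcount d m (lcoord 0 m c.1) ((c.2 * m%:R) ^+ 2))).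
    rewrite exchange_big/=.
    have -> : m%:R ^+ d = \sum_(k : {ffun 'I_d -> 'I_m}) (1 : R).
      by rewrite sumr_const card_ffun !card_ord natrX.
    apply: ler_sum => k _.
    pose y := lpoint (0 : R) k m.
    have Qy : unit_cube R d y.
      move=> i; rewrite mxE subr0 divr_ge0//= ler_pdivrMr// mul1r ler_nat.
      exact/ltnW/ltn_ord.
    have [e es ey] := scov _ Qy.
    rewrite (big_rem e)//=; have [_ /andP[e20 _]] := Hs _ es.
    have -> : (lsq (lcoord 0 m e.1) k <= (e.2 * m%:R) ^+ 2) = true.
      have := ey; rewrite /eball/= edistC edist_lpoint// ltr_pdivrMr// => /ltW Hk.
      rewrite -[leLHS]sqr_sqrtr ?lsq_ge0//.
      by apply: lerXn2r; rewrite ?nnegrE ?sqrtr_ge0// mulr_ge0// ltW.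
    by rewrite lerDl sumr_ge0.
  rewrite big_seq [leRHS]big_seq; apply: ler_sum => e es.
  have [_ /andP[e20 _]] := Hs _ es.
  have em0 : 0 <= e.2 * m%:R by rewrite mulr_ge0// ltW.
  apply: le_trans (HC _ _ _ (sqr_ge0 _)) _.
  by rewrite sqrtr_sqr ger0_norm// exprMn mulrA.
rewrite big_split/= -mulr_suml -mulr_sumr big_const_seq count_predT iter_addr_0.
rewrite -[C *+ _]mulr_natr.
have : (V + 1) * \sum_(c <- s) c.2 ^+ d <= 2^-1.
  apply: (@le_trans _ _ ((V + 1) * c)); first by apply: ler_wpM2l => //; lra.
  by rewrite /c invfM mulrCA divff ?mulr1// gt_eqF//; lra.
move: (\sum_(c <- s) _) => S HS.
have : (V + 1) * S * m%:R ^+ d <= 2^-1 * m%:R ^+ d.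
  by apply: ler_wpM2r => //; rewrite exprn_ge0.
move: (m%:R ^+ d) md => X; move: (C * _) Hm => Y; lra.
Qed.

Local Notation c0 := (fine (hraw d (unit_cube R d))).

Lemma hraw_cubeE : hraw d (unit_cube R d) = c0%:E /\ 0 < c0.
Proof.
have h0 := hraw_cube_gt0; have hf := hraw_cube_fin.
have fin : hraw d (unit_cube R d) \is a fin_num.
  by rewrite ge0_fin_numE ?(ltW h0)//; apply: le_lt_trans hf (ltry _).
by rewrite fineK//; split => //; rewrite -lte_fin fineK.
Qed.

Lemma sub_Hd (p : nat) (E F : set 'rV[R]_p) : E `<=` F -> (Hd d E <= Hd d F)%E.
Proof.
move=> EF; apply: lee_wpmul2r; last exact: sub_hraw.
by rewrite lee_fin invr_ge0 fine_ge0// hraw_ge0.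
Qed.

Lemma Hd_lip (p q : nat) (g : 'rV[R]_p -> 'rV[R]_q) L (E : set 'rV[R]_p)
    (F : set 'rV[R]_q) : 0 < L -> F `<=` g @` E ->
  (forall x y, E x -> E y -> edist (g x) (g y) <= L * edist x y) ->
  (Hd d F <= (L ^+ d)%:E * Hd d E)%E.
Proof.
move=> L0 FE gL; rewrite /Hd muleA; apply: lee_wpmul2r.
  by rewrite lee_fin invr_ge0 fine_ge0// hraw_ge0.
exact: le_trans (sub_hraw d FE) (hraw_lip d L0 gL).
Qed.

Lemma Hd_unit_cube : Hd d (unit_cube R d) = 1%E.
Proof.
have [E c00] := hraw_cubeE; rewrite /Hd {1}E -EFinM divff ?gt_eqF//.
Qed.

Lemma Hd_ccube (a : 'rV[R]_d) h : 0 < h -> Hd d (ccube a h) = ((2 * h) ^+ d)%:E.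
Proof.
move=> h0; have h20 : 0 < 2 * h by rewrite mulr_gt0.
pose b : 'rV[R]_d := a - const_mx h.
have bE i : b ord0 i = a ord0 i - h by rewrite !mxE.
apply/eqP; rewrite eq_le; apply/andP; split.
  rewrite -[leRHS]mule1 -Hd_unit_cube.
  apply: (@Hd_lip _ _ (fun x => (2 * h) *: x + b)) => // [y Hy|x y _ _].
    exists ((2 * h)^-1 *: (y - b)).
      move=> i; have := Hy i; rewrite !mxE ler_norml => /andP[y1 y2].
      rewrite mulrC ler_pdivlMr// ler_pdivrMr// mul0r mul1r.
      by apply/andP; split; lra.
    by rewrite scalerA mulfV ?gt_eqF// scale1r subrK.
  by rewrite edistDr edistZ ger0_norm// ltW.
rewrite -[leLHS]mule1 -Hd_unit_cube -lee_pdivlMl ?exprn_gt0// -exprVn.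
apply: (@Hd_lip _ _ (fun x => (2 * h)^-1 *: x + - ((2 * h)^-1 *: b))).
- by rewrite invr_gt0.
- move=> y Hy; exists ((2 * h) *: y + b).
    move=> i; have /andP[y1 y2] := Hy i; rewrite !mxE.
    have : 0 <= (2 * h) * y ord0 i by rewrite mulr_ge0// ltW.
    have : (2 * h) * y ord0 i <= 2 * h by rewrite ler_piMr// ltW.
    by rewrite ler_norml => ? ?; apply/andP; split; lra.
  by rewrite scalerDr addrK scalerA mulVf ?gt_eqF// scale1r.
- by move=> x y _ _; rewrite edistDr edistZ ger0_norm// invr_ge0 ltW.
Qed.

End HausdorffCube.

(** * Bi-Lipschitz charts *)

Section Orthonormalization.
Variable R : realType.

Lemma edist_mx p (x y : 'rV[R]_p) :
  edist x y ^+ 2 = ((x - y) *m (x - y)^T) ord0 ord0.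
Proof.
rewrite edist_sqr mxE; apply: eq_bigr => i _.
by rewrite !mxE expr2.
Qed.

Lemma edist_isometry d p (Q : 'M[R]_(d, p)) (u v : 'rV[R]_d) :
  Q *m Q^T = 1%:M -> edist (u *m Q) (v *m Q) = edist u v.
Proof.
move=> QQ; apply: (pexpIrn (n := 2)) => //; rewrite ?nnegrE ?edist_ge0//.
by rewrite !edist_mx -mulmxBl trmx_mul mulmxA -[_ *m Q *m Q^T]mulmxA QQ mulmx1.
Qed.

Lemma rV_dot_gt0 p (x : 'rV[R]_p) : x != 0 -> 0 < (x *m x^T) ord0 ord0.
Proof.
move=> x0; have := edist_mx x 0; rewrite subr0 => <-.
by rewrite exprn_gt0// edist_gt0.
Qed.

(** Gram-Schmidt on the rows of [G], recorded as a left factor [T] so that it can be moved to the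
    parameters of a chart. *)
Lemma orthonormalize d p (G : 'M[R]_(d, p)) : row_free G ->
  exists2 T, T \in unitmx & (T *m G) *m (T *m G)^T = 1%:M.
Proof.
elim: d G => [G _|d IH]; first by exists 1%:M; [exact: unitmx1|apply/matrixP => -[]].
rewrite -[d.+1]/(1 + d)%N => G freeG.
pose g := usubmx G; pose G' := dsubmx G.
have GE : G = col_mx g G' by rewrite vsubmxK.
have inj (u : 'rV_(1 + d)) : u *m G = 0 -> u = 0.
  by move=> uG; apply: (row_free_inj freeG); rewrite uG mul0mx.
have freeG' : row_free G'.
  apply: inj_row_free => v vG; have := inj (row_mx 0 v).
  rewrite GE mul_row_col mul0mx add0r vG => /(_ erefl) H.
  by have := congr1 rsubmx H; rewrite row_mxKr linear0.
have [T' T'u TT] := IH _ freeG'.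
pose Q := T' *m G'; pose c := g *m Q^T; pose g' := g - c *m Q.
(* Otherwise the first row would be a combination of the others, against [row_free]. *)
have g'0 : g' != 0.
  apply/eqP => H; have := inj (row_mx 1%:M (- (c *m T'))).
  rewrite GE mul_row_col mul1mx mulNmx -mulmxA -/Q -/g' H => /(_ erefl) E.
  have := congr1 lsubmx E; rewrite row_mxKl linear0 => /matrixP/(_ ord0 ord0).
  by rewrite !mxE/= => /eqP; rewrite oner_eq0.
have n2 := rV_dot_gt0 g'0; set n := (g' *m g'^T) ord0 ord0 in n2.
pose r := (Num.sqrt n)^-1.
have r0 : 0 < r by rewrite invr_gt0 sqrtr_gt0.
have r2n : r * r * n = 1.
  have nE : Num.sqrt n ^+ 2 = n by rewrite sqr_sqrtr// ltW.
  rewrite -[X in _ * X = _]nE /r expr2.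
  have s0 : Num.sqrt n != 0 by rewrite gt_eqF// sqrtr_gt0.
  by field.
have g'Q : g' *m Q^T = 0.
  by rewrite /g' mulmxBl -mulmxA TT mulmx1 subrr.
have Qg' : Q *m g'^T = 0.
  by apply: trmx_inj; rewrite trmx_mul trmxK g'Q trmx0.
pose T : 'M[R]_(1 + d) := block_mx r%:M (- (r *: (c *m T'))) 0 T'.
have TG : T *m G = col_mx (r *: g') Q.
  rewrite GE /T mul_block_col mul0mx add0r mul_scalar_mx mulNmx -scalemxAl -mulmxA.
  by rewrite -/Q /g' scalerBr.
exists T.
  by move: T'u; rewrite !unitmxE det_ublock det_scalar unitrM expr1 !unitfE (gt_eqF r0).
rewrite TG tr_col_mx mul_col_row linearZ/= -scalemxAl -!scalemxAr -scalemxAl.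
rewrite g'Q Qg' !scaler0 TT scalerA [RHS]scalar_mx_block.
congr block_mx; apply/matrixP => i j; rewrite !ord1 [LHS]mxE [RHS]mxE eqxx mulr1n.
exact: r2n.
Qed.

Lemma edist_mulmx_le d p (T : 'M[R]_(d, p)) : exists2 C, 0 < C &
  forall u v : 'rV[R]_d, edist (u *m T) (v *m T) <= C * edist u v.
Proof.
pose S := \sum_i \sum_j `|T i j|.
have S0 : 0 <= S by apply: sumr_ge0 => i _; apply: sumr_ge0.
exists (p%:R * S + 1) => [|u v]; first by rewrite ltr_wpDl// mulr_ge0.
rewrite mulrDl mul1r -mulrA; apply: (@le_trans _ _ (p%:R * (S * edist u v))).
  apply: edist_le_coord => [|j]; first by rewrite mulr_ge0// edist_ge0.
  have -> : (u *m T) ord0 j - (v *m T) ord0 j =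
      \sum_i (u ord0 i - v ord0 i) * T i j.
    by rewrite !mxE -sumrB; apply: eq_bigr => i _; rewrite mulrBl.
  apply: le_trans (ler_norm_sum _ _ _) _; rewrite mulr_suml.
  apply: ler_sum => i _; rewrite normrM mulrC; apply: ler_pM => //.
    by rewrite (bigD1 j)//= lerDl sumr_ge0.
  exact: coord_le_edist.
by rewrite lerDl edist_ge0.
Qed.

Lemma open_of_eball p (U : set 'rV[R]_p) :
  (forall x, U x -> exists2 r, 0 < r & eball x r `<=` U) -> open U.
Proof.
move=> H; rewrite openE => x /H[r r0 rU]; change (nbhs x U); near=> y.
by apply: rU; near: y; exact: nbhs_eball.
Unshelve. all: by end_near. Qed.

Lemma open_mulmx_image d (T : 'M[R]_d) (W : set 'rV[R]_d) : T \in unitmx ->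
  open W -> open [set u *m T | u in W].
Proof.
move=> Tu oW; apply: open_of_eball => _ [u Wu <-].
have [r r0 rW] := open_eballP oW Wu.
have [C C0 HC] := edist_mulmx_le (invmx T).
exists (r / C); first by rewrite divr_gt0.
move=> y; rewrite /eball/= ltr_pdivlMr// => Hy.
exists (y *m invmx T); last by rewrite mulmxKV.
apply: rW; rewrite /eball/=; have := HC (u *m T) y; rewrite mulmxK// => H.
by apply: le_lt_trans H _; rewrite mulrC.
Qed.

End Orthonormalization.

Section LinearApproximation.
Variables (R : realType) (d p : nat).
Implicit Types (phi : 'rV[R]_d -> 'rV[R]_p) (w : 'rV[R]_d).

Definition upd w (k : 'I_d) (t : R) : 'rV[R]_d :=
  \row_i (if i == k then t else w ord0 i).

Lemma line_derive phi w k j t :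
  derivable phi (upd w k t) (delta_mx ord0 k) ->
  is_derive t 1 (fun s => phi (upd w k s) ord0 j : R)
    ('D_(delta_mx ord0 k) phi (upd w k t) ord0 j).
Proof.
move=> D; have D' := D; move/derivable_mxP : D' => /(_ ord0 j) Dj.
rewrite (derive_mx D) mxE.
have E : (fun h : R => h^-1 *: (((fun s => phi (upd w k s) ord0 j) \o shift t) (h *: (1 : R)) -
    phi (upd w k t) ord0 j)) =
  (fun h : R => h^-1 *: (((fun x => phi x ord0 j) \o shift (upd w k t)) (h *: delta_mx ord0 k) -
    phi (upd w k t) ord0 j)).
  apply/funext => h /=; congr (_ *: (phi _ _ _ - _)).
  apply/rowP => i; rewrite !mxE eqxx/=; have [_|_] := eqVneq i k.
    by [].
  by rewrite mulr0 add0r.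
by apply: DeriveDef; rewrite /derivable /derive E.
Qed.

Lemma MVT_affine_bound (g dg : R -> R) (c e a b : R) :
  (forall t, Num.min a b <= t <= Num.max a b -> is_derive t 1 g (dg t)) ->
  (forall t, Num.min a b <= t <= Num.max a b -> `|dg t - c| <= e) ->
  `|g b - g a - (b - a) * c| <= e * `|b - a|.
Proof.
suff wl (x y : R) : x <= y ->
    (forall t, x <= t <= y -> is_derive t 1 g (dg t)) ->
    (forall t, x <= t <= y -> `|dg t - c| <= e) ->
    `|g y - g x - (y - x) * c| <= e * `|y - x|.
  case: (leP a b) => [ab H1 H2|ba H1 H2]; first exact: wl.
  have := wl b a (ltW ba) H1 H2.
  rewrite [in X in X -> _]distrC; congr (_ <= _).
    by congr `|_|; ring.
  by rewrite (distrC a b).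
move=> xy H1 H2.
have [||t] := @MVT_segment R g dg x y xy.
- move=> t /[!in_itv]/= /andP[t1 t2]; apply: H1.
  by rewrite !ltW.
- apply: derivable_within_continuous => t /[!in_itv]/= txy.
  by have [] := H1 t txy.
rewrite in_itv/= => txy ->; rewrite [dg t * _]mulrC -mulrBr normrM mulrC.
by apply: ler_wpM2r => //; exact: H2.
Qed.

(** Strict differentiability at [v0]: continuity of the partial derivatives controls [phi u - phi v]
    for any two points near [v0], which a bi-Lipschitz chart requires. *)
Lemma linear_approx phi (V : set 'rV[R]_d) v0 (e : R) :
  open V -> V v0 -> 0 < e ->
  (forall i : 'I_d,
     (forall v, V v -> derivable phi v (delta_mx ord0 i)) /\
     {within V, continuous ('D_(delta_mx ord0 i) phi)}) ->
  exists2 r, 0 < r & ball v0 r `<=` V /\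
    forall u v, ball v0 r u -> ball v0 r v ->
      edist (phi u - phi v)
        ((u - v) *m \matrix_(i < d) 'D_(delta_mx ord0 i) phi v0) <= e * edist u v.
Proof.
move=> oV Vv0 e0 H.
pose J := \matrix_(i < d) 'D_(delta_mx ord0 i) phi v0.
have pd0 : 0 < p%:R * d%:R + 1 :> R by rewrite ltr_wpDl// mulr_ge0.
have [e1 e10 e1E] : exists2 e1, 0 < e1 & e1 * (p%:R * d%:R + 1) = e.
  by exists (e / (p%:R * d%:R + 1)); [rewrite divr_gt0|rewrite divfK// gt_eqF].
have near_i (i : 'I_d) : \forall v \near v0,
    forall j : 'I_p, `|'D_(delta_mx ord0 i) phi v ord0 j - J i j| <= e1.
  have [_ ci] := H i; rewrite continuous_open_subspace// in ci.
  have := ci v0 (mem_set Vv0) => /cvgrPdist_le/(_ e1 e10).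
  apply: filterS => v Hv j; apply: le_trans Hv.
  rewrite [X in _ <= X]/Num.norm/= mx_normrE distrC.
  have -> : J i j - 'D_(delta_mx ord0 i) phi v ord0 j =
     ('D_(delta_mx ord0 i) phi v0 - 'D_(delta_mx ord0 i) phi v) ord0 j.
    by rewrite !mxE.
  exact: (le_bigmax _ (fun ij : 'I_1 * 'I_p => `|_ ij.1 ij.2|) (ord0, j)).
have : \forall v \near v0, V v /\ forall i (j : 'I_p),
    `|'D_(delta_mx ord0 i) phi v ord0 j - J i j| <= e1.
  have A : \forall v \near v0, forall i (j : 'I_p),
     `|'D_(delta_mx ord0 i) phi v ord0 j - J i j| <= e1.
    exact: filter_forall near_i.
  have B : nbhs v0 V by exact: open_nbhs_nbhs.
  exact: filterI B A.
move=> /nbhs_ballP[r /= r0 rH]; exists r => //; split; first by move=> v /rH[].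
move=> u v Bu Bv.
have /(ballP _ _ r0) Cu := Bu; have /(ballP _ _ r0) Cv := Bv.
apply: (@le_trans _ _ (p%:R * (d%:R * e1 * edist u v))); last first.
  rewrite !mulrA; apply: ler_wpM2r; first exact: edist_ge0.
  by move: e10 e1E; lra.
apply: edist_le_coord => [|j].
  by rewrite !mulr_ge0 ?edist_ge0// ltW.
(* A path from [v] to [u] that changes one coordinate at a time; it stays in the ball because [ball]
   is a cube. *)
pose path (k : nat) : 'rV[R]_d := \row_i (if (i < k)%N then u ord0 i else v ord0 i).
have pathd : path d = u by apply/rowP => i; rewrite mxE ltn_ord.
have path0 : path 0%N = v by apply/rowP => i; rewrite mxE.
have pathS (k : 'I_d) : path k.+1 = upd (path k) k (u ord0 k).
  apply/rowP => i; rewrite !mxE ltnS leq_eqVlt.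
  have [->|ik] := eqVneq i k; first by rewrite eqxx.
  by rewrite -[(i == k :> nat)]/(i == k) (negbTE ik).
have pathE (k : 'I_d) : path k = upd (path k) k (v ord0 k).
  apply/rowP => i; rewrite !mxE; have [->|//] := eqVneq i k.
  by rewrite ltnn.
have tele : phi u ord0 j - phi v ord0 j =
    \sum_(k < d) (phi (path k.+1) ord0 j - phi (path k) ord0 j).
  have := @sum_diff R (fun k => - phi (path k) ord0 j) d.
  rewrite pathd path0 => E.
  have -> : phi u ord0 j - phi v ord0 j = - phi v ord0 j - - phi u ord0 j by ring.
  by rewrite -E; apply: eq_bigr => k _; ring.
have -> : (phi u - phi v) ord0 j - ((u - v) *m J) ord0 j =
  \sum_(k < d) (phi (path k.+1) ord0 j - phi (path k) ord0 j -
     (u ord0 k - v ord0 k) * J k j).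
  rewrite sumrB -tele !mxE; congr (_ - _).
  by apply: eq_bigr => k _; rewrite !mxE.
apply: le_trans (ler_norm_sum _ _ _) _.
have -> : d%:R * e1 * edist u v = \sum_(k < d) e1 * edist u v.
  by rewrite sumr_const card_ord -[RHS]mulr_natl mulrA.
apply: ler_sum => k _; rewrite pathS {2}pathE.
have inball t : Num.min (v ord0 k) (u ord0 k) <= t <= Num.max (v ord0 k) (u ord0 k) ->
    ball v0 r (upd (path k) k t).
  move=> Ht; apply/ballP => // i; rewrite !mxE; case: eqP => [->|_]; last first.
    by case: ifP => _; [exact: Cu|exact: Cv].
  have := Cu k; have := Cv k; rewrite !ltr_distlC => /andP[a1 a2] /andP[b1 b2].
  by move: Ht; case: (leP (v ord0 k) (u ord0 k)) => _ /andP[t1 t2]; apply/andP; split; lra.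
have := @MVT_affine_bound (fun t => phi (upd (path k) k t) ord0 j)
  (fun t => 'D_(delta_mx ord0 k) phi (upd (path k) k t) ord0 j) (J k j) e1
  (v ord0 k) (u ord0 k).
move=> HM; apply: le_trans (HM _ _) _.
- move=> t Ht; apply: line_derive; have [D _] := H k; apply: D.
  by have [] := rH _ (inball t Ht).
- move=> t Ht; by have [_] := rH _ (inball t Ht).
- by apply: ler_wpM2l; [exact: ltW|exact: coord_le_edist].
Qed.

End LinearApproximation.

Section Charts.
Variables (R : realType) (p d : nat).

(* [psi] is a [kappa]-bi-Lipschitz parametrization of a relatively open piece
   of [M], with [psi a = x]. *)
Definition chart_at (M : set 'rV[R]_p) (kappa : R) (x : 'rV[R]_p)
    (psi : 'rV[R]_d -> 'rV[R]_p) (V : set 'rV[R]_d) (a : 'rV[R]_d) :=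
  [/\ open V, V a /\ psi a = x, (forall u, V u -> M (psi u)),
    (forall u v, V u -> V v ->
       edist (psi u) (psi v) <= kappa * edist u v /\
       edist u v <= kappa * edist (psi u) (psi v)) &
    (forall W, open W -> W `<=` V -> exists O, open O /\ psi @` W = O `&` M)].

(** Composing [phi] with the matrix [T] that orthonormalizes its differential at the point makes
    this differential isometric, and near the point [psi] is as close to it as desired. *)
Lemma C1_chart (M : set 'rV[R]_p) (kappa : R) x :
  C1_submanifold d M -> 1 < kappa -> M x ->
  exists psi V a, chart_at M kappa x psi V a.
Proof.
move=> CM k1 Mx; have k0 : 0 < kappa by lra.
have [U [V [phi [oU [Ux [oV [phiV [_ [phiO [Hd Hfree]]]]]]]]]] := CM x Mx.
have : (M `&` U) x by []. rewrite -phiV => -[v0 Vv0 phiv0].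
have Hfree0 := Hfree v0 Vv0; set J := \matrix_(i < d) _ in Hfree0.
have [T Tu TT] := orthonormalize Hfree0.
have [C C0 HC] := edist_mulmx_le T.
(* [1 - del = kappa^-1] yields the lower Lipschitz bound and [1 + del <= kappa] the upper one. *)
pose del := 1 - kappa^-1.
have ki : kappa^-1 < 1 by rewrite invf_lt1.
have ki0 : 0 < kappa^-1 by rewrite invr_gt0.
have del0 : 0 < del by rewrite subr_gt0.
have delk : 1 + del <= kappa.
  have : kappa * kappa^-1 = 1 by rewrite mulfV ?gt_eqF.
  by rewrite /del; nra.
have [r r0 [rV Hr]] := linear_approx oV Vv0 (divr_gt0 del0 C0) Hd.
pose psi u := phi (u *m T).
pose V' : set 'rV[R]_d := [set u | ball v0 r (u *m T)].
have oV' : open V'.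
  apply: open_of_eball => u /= Hu.
  have ob : open (ball v0 r).
    exact: ball_open.
  have [s s0 sV] := open_eballP ob Hu.
  exists (s / C); first by rewrite divr_gt0.
  move=> v; rewrite /eball/= ltr_pdivlMr// => Hv; apply: sV.
  by rewrite /eball/=; apply: le_lt_trans (HC u v) _; rewrite mulrC.
exists psi, V', (v0 *m invmx T); split => //.
- split; last by rewrite /psi mulmxKV.
  by rewrite /V'/= mulmxKV//; exact: ballxx.
- move=> u Hu; have : (phi @` V) (psi u) by exists (u *m T) => //; exact: rV.
  by rewrite phiV => -[].
- move=> u v Hu Hv.
  have := Hr _ _ Hu Hv; rewrite -/J -mulmxBl -mulmxA => H.
  have I : edist (u *m (T *m J)) (v *m (T *m J)) = edist u v by exact: edist_isometry.
  have E1 : edist (psi u - psi v) 0 = edist (psi u) (psi v).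
    by rewrite -(edistDr _ _ (psi v)) subrK add0r.
  have E2 : edist ((u - v) *m (T *m J)) 0 = edist u v.
    by rewrite mulmxBl -(edistDr _ _ (v *m (T *m J))) subrK add0r.
  have H' : edist (psi u - psi v) ((u - v) *m (T *m J)) <= del * edist u v.
    apply: le_trans H _; rewrite -mulrA; apply: ler_wpM2l; first exact: ltW.
    by rewrite ler_pdivrMl.
  have T1 := edist_triangle (psi u - psi v) ((u - v) *m (T *m J)) 0.
  have T2 := edist_triangle ((u - v) *m (T *m J)) (psi u - psi v) 0.
  rewrite [X in _ <= X + _]edistC in T2; rewrite E1 E2 in T1 T2.
  have duv := edist_ge0 u v; split.
    apply: (@le_trans _ _ ((1 + del) * edist u v)); first by lra.
    exact: ler_wpM2r.
  rewrite -ler_pdivrMl// -[X in X * _]opprK.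
  have : - - kappa^-1 = 1 - del by rewrite /del; ring.
  by move=> ->; lra.
- move=> W oW WV.
  have WTV : [set u *m T | u in W] `<=` V.
    by move=> _ [u Wu <-]; apply: rV; exact: WV.
  have [W' [oW' EW']] := phiO _ (open_mulmx_image Tu oW) WTV.
  by exists W'; split => //; rewrite -EW' image_comp.
Qed.

End Charts.

(** * Covering a compact set by disjoint small cubes *)

Section LipschitzMaps.
Variable R : realType.

Lemma lip_continuous (p q : nat) (g : 'rV[R]_p -> 'rV[R]_q) L (S : set 'rV[R]_p) :
  0 < L -> (forall x y, S x -> S y -> edist (g x) (g y) <= L * edist x y) ->
  {within S, continuous g}.
Proof.
move=> L0 gL; apply/subspace_continuousP => x Sx U /nbhs_eballP[r r0 rU].
have : \forall y \near x, S y -> U (g y).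
  near=> y => Sy; apply: rU; rewrite /eball/=.
  apply: le_lt_trans (gL _ _ Sx Sy) _; rewrite mulrC -ltr_pdivlMr//.
  by near: y; apply: nbhs_eball; exact: divr_gt0.
by [].
Unshelve. all: by end_near. Qed.

(** The finite Vitali lemma: a ball of largest radius is kept, and the balls meeting it, being no
    larger, lie in its threefold dilation. The induction continues with the balls that do not meet
    it. *)
Lemma vitali_eball (p : nat) (r : 'rV[R]_p -> R) (s : seq 'rV[R]_p) :
  (forall x, x \in s -> 0 < r x) ->
  exists t : seq 'rV[R]_p, [/\ uniq t, {subset t <= s},
    forall x y, x \in t -> y \in t -> x != y ->
      eball x (r x) `&` eball y (r y) = set0 &
    forall x, x \in s -> exists2 y, y \in t & eball x (r x) `<=` eball y (3 * r y)].
Proof.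
move: {2}(size s) (leqnn (size s)) => n; elim: n s => [|n IH] s.
  by rewrite leqn0 => /nilP-> _; exists [::].
move=> sn r0; case: (altP (s =P [::])) => [->|sn0]; first by exists [::].
have [y ys ymax] : exists2 y, y \in s & forall x, x \in s -> r x <= r y.
  elim: s sn0 {sn r0} => // a s IHs _; have [->|s0] := eqVneq s [::].
    by exists a; rewrite ?mem_head// => x; rewrite inE => /eqP->.
  have [y ys ymax] := IHs s0; have [ay|ya] := leP (r a) (r y).
    exists y; first by rewrite inE ys orbT.
    by move=> x; rewrite inE => /orP[/eqP->//|/ymax].
  exists a; first exact: mem_head.
  move=> x; rewrite inE => /orP[/eqP->//|/ymax xy].
  exact: le_trans xy (ltW ya).
pose far x := `[< eball x (r x) `&` eball y (r y) = set0 >].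
have yy : ~~ far y.
  apply/asboolP => /seteqP[+ _] => /(_ y); apply.
  by split; rewrite /eball/= edistxx r0.
have sz : (size (seq.filter far s) <= n)%N.
  rewrite -ltnS; apply: leq_trans sn; rewrite size_filter -(count_predC far s).
  by rewrite -addn1 leq_add2l -has_count; apply/hasP; exists y.
have [|t [ut ts tdisj tcov]] := IH (seq.filter far s) sz.
  by move=> x; rewrite mem_filter => /andP[_]; exact: r0.
have yt : y \notin t.
  by apply/negP => /ts; rewrite mem_filter (negbTE yy).
exists (y :: t); split.
- by rewrite /= yt.
- move=> x; rewrite inE => /orP[/eqP->//|/ts]; by rewrite mem_filter => /andP[].
- move=> x z; rewrite !inE => /orP[/eqP->|xt] /orP[/eqP->|zt] xz.
  + by rewrite eqxx in xz.
  + by have := ts _ zt; rewrite mem_filter => /andP[/asboolP + _]; rewrite setIC.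
  + by have := ts _ xt; rewrite mem_filter => /andP[/asboolP + _].
  + exact: tdisj.
- move=> x xs; case: (boolP (far x)) => [fx|/asboolP/eqP/set0P[z [xz yz]]].
    have [|z zt Hz] := tcov x; first by rewrite mem_filter fx.
    by exists z => //; rewrite inE zt orbT.
  exists y; first exact: mem_head.
  move=> v; rewrite /eball/= => xv; rewrite /eball/= in xz yz.
  have := ymax _ xs; have := edist_triangle y z v; have := edist_triangle z x v.
  rewrite (edistC z x); lra.
Qed.

End LipschitzMaps.

(** * Cubes in charts *)

Section CubePieces.
Variables (R : realType) (p d : nat).

(* A piece is a cube of centre [pctr] and half-side [prad] in the domain [pdom]
   of a chart [pmap]; [pimg c k] is the image of this cube dilated by [k]. *)
Record piece := Piece {
  pmap : 'rV[R]_d -> 'rV[R]_p; pdom : set 'rV[R]_d;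
  pctr : 'rV[R]_d; prad : R }.

Definition pcenter (c : piece) : 'rV[R]_p := pmap c (pctr c).

Definition pimg (c : piece) (k : R) : set 'rV[R]_p :=
  pmap c @` ccube (pctr c) (k * prad c).

(** The twofold dilation has to stay in the chart domain and in [G], so that pieces can be enlarged
    or shrunk by factors close to 1 while chart and weight remain under control. *)
Definition good_piece (M : set 'rV[R]_p) kappa (rad : 'rV[R]_p -> R)
    (G : set 'rV[R]_p) (c : piece) :=
  [/\ chart_at M kappa (pcenter c) (pmap c) (pdom c) (pctr c), 0 < prad c,
      ccube (pctr c) (2 * prad c) `<=` pdom c &
      pimg c 2 `<=` G `&` eball (pcenter c) (rad (pcenter c))].

(** Recursion on the list replaces membership, since a piece consists of functions and sets and
    carries no decidable equality. *)
Fixpoint pall (P : piece -> Prop) (s : seq piece) : Prop :=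
  if s is c :: s' then P c /\ pall P s' else True.

Fixpoint pcover (s : seq piece) : set 'rV[R]_p :=
  if s is c :: s' then pimg c 1 `|` pcover s' else set0.

Fixpoint pdisj (s : seq piece) : Prop :=
  if s is c :: s' then pimg c 1 `&` pcover s' = set0 /\ pdisj s' else True.

Lemma pall_impl (P Q : piece -> Prop) s :
  (forall c, P c -> Q c) -> pall P s -> pall Q s.
Proof. by move=> PQ; elim: s => //= c s IH [Pc /IH]; split => //; exact: PQ. Qed.

Lemma pall_cat P s t : pall P s -> pall P t -> pall P (s ++ t).
Proof. by elim: s => //= c s IH [Pc Ps] Pt; split => //; exact: IH. Qed.

Lemma pcover_cat s t : pcover (s ++ t) = pcover s `|` pcover t.
Proof. by elim: s => [|c s IH] /=; rewrite ?set0U// IH setUA. Qed.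

Lemma pdisj_cat s t : pdisj s -> pdisj t -> pcover s `&` pcover t = set0 ->
  pdisj (s ++ t).
Proof.
elim: s => //= c s IH [cs ds] dt H.
have sub B : B `<=` pimg c 1 `|` pcover s -> B `&` pcover t = set0.
  by move=> BS; apply/seteqP; split => // y [/BS By ty]; rewrite -H; split.
split; last by apply: IH => //; apply: sub; exact: subsetUr.
by rewrite pcover_cat setIUr cs set0U; apply: sub; exact: subsetUl.
Qed.

Lemma pimg_sub c k k' : 0 <= prad c -> k <= k' -> pimg c k `<=` pimg c k'.
Proof.
move=> c0 kk; apply: image_subset; apply: sub_ccube; exact: ler_wpM2r.
Qed.

Section Good.
Variables (M : set 'rV[R]_p) (kappa : R) (rad : 'rV[R]_p -> R) (G : set 'rV[R]_p).
Variable c : piece.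
Hypotheses (k1 : 1 < kappa) (gc : good_piece M kappa rad G c).

Let k0 : 0 < kappa. Proof. by apply: lt_trans k1. Qed.

Lemma pdom_ccube k : k <= 2 -> ccube (pctr c) (k * prad c) `<=` pdom c.
Proof.
move=> k2; have [_ c0 cV _] := gc; apply: subset_trans cV; apply: sub_ccube.
by apply: ler_wpM2r => //; exact: ltW.
Qed.

Lemma pmap_lip u v : pdom c u -> pdom c v ->
  edist (pmap c u) (pmap c v) <= kappa * edist u v.
Proof. by move=> Vu Vv; have [[_ _ _ L _] _ _ _] := gc; have [] := L u v Vu Vv. Qed.

Lemma pmap_colip u v : pdom c u -> pdom c v ->
  edist u v <= kappa * edist (pmap c u) (pmap c v).
Proof. by move=> Vu Vv; have [[_ _ _ L _] _ _ _] := gc; have [] := L u v Vu Vv. Qed.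

Lemma pmap_inj u v : pdom c u -> pdom c v -> pmap c u = pmap c v -> u = v.
Proof.
move=> Vu Vv uv; apply/eqP; rewrite -edist_eq0 eq_le edist_ge0 andbT.
by have := pmap_colip Vu Vv; rewrite uv edistxx mulr0.
Qed.

Lemma compact_pimg k : k <= 2 -> compact (pimg c k).
Proof.
move=> k2; apply: continuous_compact; last exact: compact_ccube.
apply: (lip_continuous k0) => x y Hx Hy.
by apply: pmap_lip; exact: pdom_ccube k2 _ _.
Qed.

Lemma Hd_pimg : (0 < d)%N ->
  (Hd d (pimg c 1) <= ((kappa * (2 * prad c)) ^+ d)%:E)%E /\
  (((kappa^-1 * (2 * prad c)) ^+ d)%:E <= Hd d (pimg c 1))%E.
Proof.
move=> d0; have [_ c0 _ _] := gc.
have HQ : Hd d (ccube (pctr c) (1 * prad c)) = ((2 * prad c) ^+ d)%:E.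
  by rewrite mul1r Hd_ccube.
have k12 : 1 <= 2 :> R by rewrite ler1n.
split.
  rewrite exprMn EFinM -HQ; apply: (@Hd_lip _ _ _ _ (pmap c)) => // x y Hx Hy.
  by apply: pmap_lip; exact: pdom_ccube k12 _ _.
rewrite exprMn EFinM exprVn lee_pdivrMl ?exprn_gt0// -HQ.
have /choice[g Hg] : forall y, exists u, pimg c 1 y ->
    ccube (pctr c) (1 * prad c) u /\ pmap c u = y.
  move=> y; have [[u Hu uy]|ny] := pselect (pimg c 1 y); first by exists u.
  by exists 0.
apply: (@Hd_lip _ _ _ _ g) => // [u Hu|].
  have Pu : pimg c 1 (pmap c u) by exists u.
  exists (pmap c u) => //; have [H1 H2] := Hg _ Pu.
  by apply: pmap_inj H2; exact: pdom_ccube k12 _ _.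
move=> x y Px Py; have [H1 H2] := Hg _ Px; have [H3 H4] := Hg _ Py.
rewrite -{2}H2 -{2}H4; apply: pmap_colip; exact: pdom_ccube k12 _ _.
Qed.

End Good.
End CubePieces.

(** * Vitali coverings by pieces *)

Section BorelHausdorff.
Variables (R : realType) (p d : nat).
Implicit Types A M O C : set 'rV[R]_p.

Lemma open_measurable_borel O : open O -> measurable (O : set (borelRp R p)).
Proof. by move=> oO; exact: sub_sigma_algebra. Qed.

Lemma closed_measurable_borel C : closed C -> measurable (C : set (borelRp R p)).
Proof.
move=> cC; rewrite -(setCK C); apply: measurableC.
by apply: open_measurable_borel; exact: closed_openC.
Qed.

Lemma compact_measurable_borel C : compact C -> measurable (C : set (borelRp R p)).
Proof.
by move=> cC; apply: closed_measurable_borel; exact: compact_closed (@norm_hausdorff _ _) cC.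
Qed.

Hypothesis d0 : (0 < d)%N.

(** Upper regularity of [Hd] on [M], which lets the Vitali argument bound the dilated balls. The
    ball pulls back into a cube of half-side [2 * r], of measure [(4 * r)^d], and the chart costs
    another [2^d]. *)
Lemma Hd_chart_ball M kappa x psi (V : set 'rV[R]_d) a : 1 < kappa -> kappa <= 2 ->
  chart_at M kappa x psi V a ->
  exists2 rho, 0 < rho &
    forall y r, M y -> 0 < r -> eball y r `<=` eball x rho ->
      (Hd d (M `&` eball y r) <= ((8 * r) ^+ d)%:E)%E.
Proof.
move=> k1 k2 [oV [Va ax] VM L Vo].
have [Q [oQ VO]] := Vo V oV (fun u Vu => Vu).
have px : (psi @` V) x by exists a.
have Qx : Q x by rewrite VO in px; case: px.
have [rho rho0 rO] := open_eballP oQ Qx.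
exists rho => // y r My r0 yx.
have yr : eball y r y by rewrite /eball/= edistxx.
have : (psi @` V) y by rewrite VO; split => //; apply: rO; exact: (yx _ yr).
move=> [b Vb by_].
have -> : (8 * r) ^+ d = 2 ^+ d * (2 * (2 * r)) ^+ d :> R.
  by rewrite -exprMn; congr (_ ^+ d); ring.
have r20 : 0 < 2 * r by rewrite mulr_gt0.
rewrite EFinM -(Hd_ccube d0 b r20).
apply: (le_trans _ (y := ((2 ^+ d)%:E * Hd d (V `&` ccube b (2 * r)))%E)); last first.
  apply: lee_wpmul2l; last by apply: sub_Hd => //; exact: subIsetr.
  by rewrite lee_fin exprn_ge0.
have k0 : 0 <= kappa by apply: ltW; apply: lt_trans k1.
apply: (@Hd_lip _ _ _ _ psi) => // [z [Mz yz]|u v [Vu _] [Vv _]]; last first.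
  have [H _] := L u v Vu Vv; apply: le_trans H _.
  by apply: ler_wpM2r => //; exact: edist_ge0.
have : (psi @` V) z by rewrite VO; split => //; apply: rO; exact: (yx _ yz).
move=> [u Vu uz]; exists u => //; split=> // i.
apply: le_trans (coord_le_edist _ _ i) _.
have [_ H] := L u b Vu Vb; apply: le_trans H _; rewrite uz by_ edistC.
apply: ler_pM => //; [exact: edist_ge0|exact: ltW].
Qed.

Variables (A M : set 'rV[R]_p) (mu : {measure set (borelRp R p) -> \bar R}).
Hypotheses (CM : C1_submanifold d M) (cA : compact A) (AM : A `<=` M).
Hypothesis muE : forall B : set (borelRp R p), measurable B -> mu B = Hd d B.

Lemma measurable_compactI O : open O -> measurable (A `&` O : set (borelRp R p)).
Proof.
move=> oO; apply: measurableI; first exact: compact_measurable_borel.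
exact: open_measurable_borel.
Qed.

Lemma mu_le (B C : set (borelRp R p)) : measurable B -> measurable C ->
  B `<=` C -> (mu B <= mu C)%E.
Proof. by move=> mB mC; apply: le_measure; exact: mem_set. Qed.

Lemma mu_cover_le (T : eqType) (s : seq T) (B : T -> set 'rV[R]_p) K :
  measurable (K : set (borelRp R p)) ->
  (forall i, i \in s -> measurable (B i : set (borelRp R p))) ->
  (forall y, K y -> exists2 i, i \in s & B i y) ->
  (mu K <= \sum_(i <- s) mu (B i))%E.
Proof.
elim: s K => [|a s IH] K mK mB cov.
  have -> : K = set0 by apply/seteqP; split => // y /cov[].
  by rewrite measure0 big_nil.
have ma : measurable (B a : set (borelRp R p)) by apply: mB; exact: mem_head.
rewrite big_cons (measureDI mu mK ma) addeC; apply: leeD.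
  by apply: mu_le => //; exact: measurableI.
apply: IH => [|i si|y [/cov[i + iy] nay]]; first exact: measurableD.
  by apply: mB; rewrite inE si orbT.
by rewrite inE => /orP[/eqP ia|si]; [rewrite ia in iy|exists i].
Qed.

(** The half-side is [h = r / (4 (d + 1))], so that the twofold dilation is mapped into the ball of
    radius [r]. The ball of radius [3 r] has measure at most [(24 r)^d = (96 (d + 1) h)^d] and the
    piece at least [h^d]; this is the origin of the constant. *)
Lemma small_piece O kappa (rad : 'rV[R]_p -> R) x : open O -> M `&` O `<=` A ->
  1 < kappa -> kappa <= 2 -> (forall x, A x -> 0 < rad x) -> (M `&` O) x ->
  exists P : piece R p d * R,
   [/\ pcenter P.1 = x /\ 0 < P.2, good_piece M kappa rad (M `&` O) P.1,
       pimg P.1 1 `<=` eball x P.2 &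
       (Hd d (M `&` eball x (3 * P.2)%R) <=
         ((96 * (d%:R + 1)) ^+ d)%:E * Hd d (pimg P.1 1))%E].
Proof.
move=> oO MOA k1 k2 rad0 [Mx Ox]; have Ax : A x by exact: MOA.
have k0 : 0 < kappa by apply: lt_trans k1.
have [psi [V [a ch]]] := C1_chart CM k1 Mx.
have [r1 r10 Hr1] := Hd_chart_ball k1 k2 ch.
have [oV [Va ax] VM L Vo] := ch.
have [r2 r20 Hr2] := open_eballP oV Va.
have [r3 r30 Hr3] := open_eballP oO Ox.
have rx0 := rad0 _ Ax.
pose D1 : R := d%:R + 1; have D10 : 0 < D1 by rewrite ltr_wpDl.
have dD1 : d%:R < D1 by rewrite ltrDl.
pose r := Num.min (Num.min (r1 / 3) r2) (Num.min r3 (rad x)).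
have r0 : 0 < r by rewrite !lt_min rx0 r30 r20 divr_gt0.
have [rr1 rr2 rr3 rrx] : [/\ r <= r1 / 3, r <= r2, r <= r3 & r <= rad x].
  by split; rewrite /r !ge_min lexx ?orbT.
pose h := r / (4 * D1); have h0 : 0 < h by rewrite divr_gt0// mulr_gt0.
have rE : r = 4 * D1 * h by rewrite /h mulrC mulfVK// gt_eqF// mulr_gt0.
have ed k u : 0 <= k -> ccube a (k * h) u -> edist a u <= d%:R * (k * h).
  move=> kk Hu; have kh : 0 <= k * h by rewrite mulr_ge0// ltW.
  by apply: edist_le_coord => // i; rewrite distrC; exact: Hu.
have dh : d%:R * h < D1 * h by rewrite ltr_pM2r.
have Q2 : ccube a (2 * h) `<=` V.
  move=> u /ed H; apply: Hr2; rewrite /eball/=.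
  have : 0 <= d%:R * h by rewrite mulr_ge0// ltW.
  have := H (ler0n _ 2); rewrite mulrCA; lra.
have psiQ k u : 0 <= k -> k <= 2 -> ccube a (k * h) u ->
    edist x (psi u) <= kappa * (k * (d%:R * h)).
  move=> kk kk2 Hu; have Vu : V u.
    by apply: Q2; apply: sub_ccube Hu; rewrite ler_pM2r.
  have [H _] := L a u Va Vu; rewrite -{1}ax; apply: le_trans H _.
  by rewrite ler_pM2l// mulrCA; exact: ed.
pose c := Piece psi V a h; have cx : pcenter c = x by [].
have dh0 : 0 <= d%:R * h by rewrite mulr_ge0// ltW.
have gc : good_piece M kappa rad (M `&` O) c.
  split => //.
  move=> _ [u Hu <-]; have H := psiQ 2 u (ler0n _ 2) (lexx _) Hu.
  have {}H : edist x (psi u) < r by nra.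
  split; last by rewrite cx /eball/=; exact: lt_le_trans rrx.
  split; first by apply: VM; exact: Q2.
  by apply: Hr3; rewrite /eball/=; exact: lt_le_trans rr3.
exists (c, r); split => //=.
  move=> _ [u Hu <-]; have := psiQ 1 u (ler0n _ 1) (ler1n _ 2) Hu.
  by rewrite /eball/=; nra.
have r30' : 0 < 3 * r by rewrite mulr_gt0.
apply: le_trans (Hr1 x (3 * r) Mx r30' _) _.
  by move=> y; rewrite /eball/= => xy; lra.
have [_ H] := Hd_pimg k1 gc d0.
apply: le_trans (_ : _ <= ((96 * D1) ^+ d)%:E * ((kappa^-1 * (2 * h)) ^+ d)%:E)%E _; last first.
  by apply: lee_wpmul2l => //; rewrite lee_fin exprn_ge0// mulr_ge0// ltW.
rewrite -EFinM lee_fin -exprMn; apply: lerXn2r; rewrite ?nnegrE.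
- by rewrite !mulr_ge0// ltW.
- have h0' := ltW h0; have D0' := ltW D10.
  have k0' : 0 <= kappa^-1 by rewrite invr_ge0 ltW.
  by do 2 (apply: mulr_ge0 => //); apply: mulr_ge0.
have : 2^-1 <= kappa^-1 by rewrite lef_pV2 ?posrE.
have : 0 <= D1 * h by rewrite mulr_ge0// ltW.
by rewrite rE; nra.
Qed.

Lemma mu_fin : (mu A < +oo)%E.
Proof.
have k12 : 1 < 2 :> R by rewrite ltr1n.
have /choice[rho Hrho] : forall x, exists rho : R, A x -> 0 < rho /\
    (Hd d (M `&` eball x rho) <= ((8 * rho) ^+ d)%:E)%E.
  move=> x; have [Ax|nA] := pselect (A x); last by exists 0.
  have [psi [V [a ch]]] := C1_chart CM k12 (AM Ax).
  have [r r0 H] := Hd_chart_ball k12 (lexx _) ch.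
  exists r => _; split=> //; apply: H => //; exact: AM.
have [|s [sA cov]] := compact_eball_cover cA (r := rho).
  by move=> x /Hrho[].
apply: (@le_lt_trans _ _ (\sum_(i <- s) mu (A `&` eball i (rho i)))%E).
  apply: mu_cover_le => [|i _|y Ay].
  - exact: compact_measurable_borel.
  - by apply: measurable_compactI; exact: open_eball.
  - by have [x xs yx] := cov y Ay; exists x.
rewrite big_seq; apply: lte_sum_pinfty => i /sA /Hrho[_ Hi].
rewrite muE; last by apply: measurable_compactI; exact: open_eball.
apply: (@le_lt_trans _ _ (Hd d (M `&` eball i (rho i)))).
  by apply: sub_Hd => //; apply: setSI.
by apply: le_lt_trans Hi _; exact: ltry.
Qed.

Lemma measurable_pcover kappa rad G (s : seq (piece R p d)) : 1 < kappa ->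
  pall (good_piece M kappa rad G) s -> compact (pcover s).
Proof.
move=> k1; elim: s => [|c s IH] /=; first by move=> _; exact: compact0.
move=> [gc gs]; apply: compactU; last exact: IH.
by apply: (compact_pimg k1 gc); rewrite ler1n.
Qed.

Lemma mu_pcover kappa rad G (s : seq (piece R p d)) : 1 < kappa ->
  pall (good_piece M kappa rad G) s -> pdisj s ->
  mu (pcover s) = (\sum_(c <- s) mu (pimg c 1))%E.
Proof.
move=> k1; elim: s => [|c s IH] /=; first by rewrite measure0 big_nil.
move=> [gc gs] [cs ds]; rewrite big_cons -IH// measureU//.
  by apply: compact_measurable_borel; apply: (compact_pimg k1 gc); rewrite ler1n.
by apply: compact_measurable_borel; exact: measurable_pcover gs.
Qed.

(** Inner regularity: removing from [A] the neighbourhoods of radius [1 / (n + 1)] of the complement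
    of [O] gives compact sets that increase to the whole intersection. *)
Lemma compact_inner O : open O -> (0 < mu (A `&` O))%E ->
  exists K, [/\ compact K, K `<=` A `&` O & (2^-1%:E * mu (A `&` O) <= mu K)%E].
Proof.
move=> oO G0; pose C n := \bigcup_(z in ~` O) eball z (n.+1%:R^-1 : R).
have oC n : open (C n) by apply: bigcup_open => z _; exact: open_eball.
pose K n := A `\` C n.
have cK n : compact (K n).
  apply: (subclosed_compact _ cA) => //; last exact: subDsetl.
  apply: closedI; first exact: compact_closed (@norm_hausdorff _ _) cA.
  exact: open_closedC.
have KO n : K n `<=` A `&` O.
  move=> x [Ax Cx]; split => //; apply: contrapT => Ox; apply: Cx.
  by exists x => //; rewrite /eball/= edistxx invr_gt0 ltr0n.
have KU : \bigcup_n K n = A `&` O.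
  apply/seteqP; split => [x [n _ /KO//]|x [Ax Ox]].
  have [r r0 rO] := open_eballP oO Ox.
  have [n _ nr] := near_infty_natSinv_lt (PosNum r0).
  exists n => //; split => // -[z Oz]; rewrite /eball/= => zx; apply: Oz; apply: rO.
  rewrite /eball/= edistC; apply: lt_trans zx _; exact: nr n (leqnn n).
have mK n : measurable (K n : set (borelRp R p)) by exact: compact_measurable_borel.
have mG : measurable (A `&` O : set (borelRp R p)) by exact: measurable_compactI.
have Gfin : (mu (A `&` O) < +oo)%E.
  apply: le_lt_trans mu_fin; apply: mu_le => //.
  exact: compact_measurable_borel.
have := @nondecreasing_cvg_mu _ _ _ mu K mK; rewrite KU => /(_ mG) cv.
have {}cv : (mu \o K) @ \oo --> mu (A `&` O).
  apply: cv => n m nm; apply/subsetPset; apply: setDS => y [z Oz zy].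
  exists z => //; rewrite /eball/= in zy *; apply: lt_le_trans zy _.
  by rewrite lef_pV2 ?posrE ?ltr0n// ler_nat.
have lt2 : (2^-1%:E * mu (A `&` O) < mu (A `&` O))%E.
  move: G0 Gfin; case: (mu (A `&` O)) => // g; rewrite !lte_fin => g0 _.
  by rewrite gtr_pMl// invf_lt1// ltr1n.
have [n _ Hn] := cv _ (open_ereal_gt' lt2).
exists (K n); split => //; apply: ltW; exact: (Hn n (leqnn n)).
Qed.

Lemma good_piece_sub kappa rad G G' c : G `<=` G' ->
  good_piece M kappa rad G c -> good_piece (p := p) (d := d) M kappa rad G' c.
Proof. by move=> GG [H1 H2 H3 H4]; split => // y /H4[/GG ? ?]. Qed.

Lemma good_pcover_sub kappa rad G (s : seq (piece R p d)) :
  pall (good_piece M kappa rad G) s -> pcover s `<=` G.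
Proof.
elim: s => [|c l IH] /=; first by move=> _; exact: sub0set.
move=> [gc gl]; rewrite subUset; split; last exact: IH.
have [_ c0 _ H] := gc; apply: (subset_trans (pimg_sub (ltW c0) (_ : 1 <= 2))).
  by rewrite ler1n.
by move=> y /H[].
Qed.

(* By the Vitali covering lemma, disjoint pieces capture a fraction [1 / (2 D)]
   of the measure of any relatively open set; iterating exhausts the set. *)
Lemma vitali_step O kappa (rad : 'rV[R]_p -> R) : open O -> M `&` O `<=` A ->
  1 < kappa -> kappa <= 2 -> (forall x, A x -> 0 < rad x) ->
  let D : R := (96 * (d%:R + 1)) ^+ d in
  exists s : seq (piece R p d),
    [/\ pall (good_piece M kappa rad (M `&` O)) s, pdisj s &
        (mu ((M `&` O) `\` pcover s) <= (1 - (2 * D)^-1)%:E * mu (M `&` O))%E].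
Proof.
move=> oO MOA k1 k2 rad0 D.
have D0 : 0 < D by rewrite exprn_gt0// mulr_gt0// ltr_wpDl.
have GE : M `&` O = A `&` O.
  apply/seteqP; split => [x [Mx Ox]|x [/AM Mx Ox]] //; split => //; exact: MOA.
have mG : measurable (M `&` O : set (borelRp R p)).
  by rewrite GE; exact: measurable_compactI.
have Gfin : (mu (M `&` O) < +oo)%E.
  apply: le_lt_trans mu_fin; apply: mu_le => //.
  exact: compact_measurable_borel.
have [G0|] := eqVneq (mu (M `&` O)) 0%E.
  by exists [::]; split => //=; rewrite setD0 G0 mule0.
move=> G0'; have G0 : (0 < mu (M `&` O))%E by rewrite lt0e G0' measure_ge0.
(* The origin of the 2 in [(2 * D)^-1]: half of the measure is given up to get a compact set, hence
   a finite family of balls. *)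
have [K [cK KG HK]] : exists K, [/\ compact K, K `<=` M `&` O &
    (2^-1%:E * mu (M `&` O) <= mu K)%E].
  by rewrite GE in G0 *; exact: compact_inner.
have /choice[P HP] : forall x, exists P : piece R p d * R, K x ->
   [/\ pcenter P.1 = x /\ 0 < P.2, good_piece M kappa rad (M `&` O) P.1,
       pimg P.1 1 `<=` eball x P.2 &
       (Hd d (M `&` eball x (3 * P.2)%R) <= D%:E * Hd d (pimg P.1 1))%E].
  move=> x; have [Kx|] := pselect (K x); last by exists (Piece (fun=> 0) set0 0 0, 0).
  by have [P0 H0] := small_piece oO MOA k1 k2 rad0 (KG _ Kx); exists P0.
have [|s0 [sK cov]] := compact_eball_cover cK (r := fun x => (P x).2).
  by move=> x /HP[[_ ?]].
have [|t [ut ts tdisj tcov]] := vitali_eball (r := fun x => (P x).2) (s := s0).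
  by move=> x /sK /HP[[_ ?]].
have HPt x : x \in t -> _ := fun xt => HP x (sK x (ts x xt)).
pose s := [seq (P x).1 | x <- t].
have gs : pall (good_piece M kappa rad (M `&` O)) s.
  rewrite /s; elim: (t) HPt => //= a l IH H; split.
    by have [] := H a (mem_head _ _).
  by apply: IH => x xl; apply: H; rewrite inE xl orbT.
have ds : pdisj s.
  have scov l y : pcover [seq (P x).1 | x <- l] y -> exists2 x, x \in l & pimg (P x).1 1 y.
    elim: l => //= a l IH [ya|/IH[x xl xy]]; first by exists a => //; exact: mem_head.
    by exists x => //; rewrite inE xl orbT.
  rewrite /s; elim: (t) ut tdisj HPt => //= a l IH /andP[al ul] H H'; split.
    apply/seteqP; split => // y [ya /scov[x xl xy]].
    rewrite -(H a x) ?mem_head ?inE ?xl ?orbT//; last first.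
      by apply: contraNneq al => ->.
    split; first by have [_ _ + _] := H' a (mem_head _ _); apply.
    by have [|_ _ + _] := H' x; [rewrite inE xl orbT|apply].
  apply: IH => // [x y xl yl|x xl]; first by apply: H; rewrite inE ?xl ?yl orbT.
  by apply: H'; rewrite inE xl orbT.
exists s; split => //.
have cs : compact (pcover s) by exact: measurable_pcover gs.
have ms : measurable (pcover s : set (borelRp R p)) by exact: compact_measurable_borel.
have sG := good_pcover_sub gs.
have key : (mu K <= D%:E * mu (pcover s))%E.
  apply: (@le_trans _ _ (\sum_(x <- t) mu (A `&` eball x (3 * (P x).2)))%E).
    apply: mu_cover_le => [|i _|y Ky].
    - exact: compact_measurable_borel.
    - by apply: measurable_compactI; exact: open_eball.
    - have [x xs yx] := cov y Ky; have [z zt zx] := tcov x xs.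
      by exists z => //; split; [have [My Oy] := KG _ Ky; exact: MOA|exact: zx].
  rewrite (mu_pcover k1 gs ds) /s big_map ge0_sume_distrr; last by move=> i _.
  rewrite big_seq [leRHS]big_seq; apply: lee_sum => x /HPt[_ gx _ Hx].
  rewrite !muE.
  - apply: le_trans Hx; apply: sub_Hd => //; exact: setSI.
  - by apply: compact_measurable_borel; apply: (compact_pimg k1 gx); rewrite ler1n.
  - by apply: measurable_compactI; exact: open_eball.
have -> : mu ((M `&` O) `\` pcover s) = (mu (M `&` O) - mu (pcover s))%E.
  rewrite (measureD mG ms Gfin); congr (_ - mu _)%E.
  by apply/seteqP; split => [y []//|y sy]; split => //; exact: sG.
have sfin : (mu (pcover s) < +oo)%E.
  by apply: le_lt_trans Gfin; apply: mu_le.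
have : (2^-1%:E * mu (M `&` O) <= D%:E * mu (pcover s))%E by exact: le_trans key.
have mE : mu (pcover s) = (fine (mu (pcover s)))%:E.
  by rewrite fineK// ge0_fin_numE ?measure_ge0.
have gE : mu (M `&` O) = (fine (mu (M `&` O)))%:E.
  by rewrite fineK// ge0_fin_numE ?measure_ge0.
rewrite mE gE; set g := fine _; set m := fine _.
rewrite -!EFinM -EFinB !lee_fin => H.
have H2 : (2 * D)^-1 * g <= m.
  by rewrite invfM mulrAC mulrC ler_pdivrMl.
by rewrite mulrBl mul1r lerB.
Qed.

(** Pieces are compact, so what they leave uncovered is again relatively open in [M]; the step
    applies to it, and the uncovered measure decays geometrically. *)
Lemma vitali_iter O kappa (rad : 'rV[R]_p -> R) n : open O -> M `&` O `<=` A ->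
  1 < kappa -> kappa <= 2 -> (forall x, A x -> 0 < rad x) ->
  let D : R := (96 * (d%:R + 1)) ^+ d in
  exists s : seq (piece R p d),
    [/\ pall (good_piece M kappa rad (M `&` O)) s, pdisj s &
        (mu ((M `&` O) `\` pcover s) <= ((1 - (2 * D)^-1) ^+ n)%:E * mu (M `&` O))%E].
Proof.
move=> oO MOA k1 k2 rad0 D; elim: n => [|n [s [gs ds Hs]]].
  by exists [::]; split => //=; rewrite setD0 expr0 mul1e.
have cs : compact (pcover s) by exact: measurable_pcover gs.
pose O' := O `\` pcover s.
have oO' : open O'.
  by apply: openI => //; apply: closed_openC; exact: compact_closed (@norm_hausdorff _ _) cs.
have MO' : M `&` O' = (M `&` O) `\` pcover s by rewrite setDE setIA -setDE.
have MOA' : M `&` O' `<=` A by rewrite MO' => y [/MOA].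
have [s' [gs' ds' Hs']] := vitali_step oO' MOA' k1 k2 rad0.
have MOO : M `&` O' `<=` M `&` O by rewrite MO'; exact: subDsetl.
exists (s ++ s'); split.
- apply: pall_cat => //; apply: pall_impl gs' => c; exact: good_piece_sub.
- apply: pdisj_cat => //; apply/seteqP; split => // y [sy s'y].
  by have := good_pcover_sub gs' s'y; rewrite MO' => -[].
- rewrite pcover_cat -setDDl -MO'; apply: le_trans Hs' _.
  rewrite exprS EFinM -muleA; apply: lee_wpmul2l; last by rewrite MO'.
  rewrite lee_fin subr_ge0 invf_le1; last first.
    by rewrite mulr_gt0// exprn_gt0// mulr_gt0// ltr_wpDl.
  have D1 : 1 <= D by apply: exprn_ege1; have := ler0n R d; lra.
  by rewrite (le_trans D1)// ler_peMl ?ler1n// (le_trans _ D1).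
Qed.

Lemma vitali_cover kappa (rad : 'rV[R]_p -> R) (e : R) :
  Hd d (relbdry M A) = 0%E -> 1 < kappa -> kappa <= 2 ->
  (forall x, A x -> 0 < rad x) -> 0 < e ->
  exists s : seq (piece R p d),
    [/\ pall (good_piece M kappa rad A) s, pdisj s & (mu (A `\` pcover s) <= e%:E)%E].
Proof.
move=> bd k1 k2 rad0 e0.
(* [M] meets [O0] in the relative interior of [A]; the rest of [A] lies in the relative boundary, of
   measure 0. *)
pose O0 := \bigcup_(U in [set U : set 'rV[R]_p | open U /\ U `&` M `<=` A]) U.
have oO : open O0 by apply: bigcup_open => U [].
have MOA : M `&` O0 `<=` A by move=> y [My [U [oU UA] Uy]]; exact: UA.
pose D : R := (96 * (d%:R + 1)) ^+ d.
have D1 : 1 <= D by apply: exprn_ege1; have := ler0n R d; lra.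
pose z := 1 - (2 * D)^-1.
have iD : 0 < (2 * D)^-1 by rewrite invr_gt0; lra.
have iD1 : (2 * D)^-1 < 1 by rewrite invf_lt1; lra.
have z1 : `|z| < 1 by rewrite ger0_norm /z; lra.
have GE : M `&` O0 = A `&` O0.
  apply/seteqP; split => [x [Mx Ox]|x [/AM Mx Ox]] //; split => //; exact: MOA.
have mG : measurable (M `&` O0 : set (borelRp R p)).
  by rewrite GE; exact: measurable_compactI.
have mA : measurable (A : set (borelRp R p)) by exact: compact_measurable_borel.
have gE : mu (M `&` O0) = (fine (mu (M `&` O0)))%:E.
  rewrite fineK// ge0_fin_numE ?measure_ge0//; apply: le_lt_trans mu_fin.
  exact: mu_le.
set g := fine _ in gE; have g0 : 0 <= g by apply: fine_ge0; exact: measure_ge0.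
have [n Hn] : exists n : nat, z ^+ n * g <= e.
  have e' : 0 < e / (g + 1) by rewrite divr_gt0// ltr_wpDl.
  have /cvgrPdist_lt/(_ _ e')[n _ Hn] := cvg_expr z1.
  exists n; have := Hn n (leqnn n); rewrite /= sub0r normrN => H.
  have {}H : z ^+ n < e / (g + 1) by apply: le_lt_trans H; exact: ler_norm.
  have g1 : 0 < g + 1 by rewrite ltr_wpDl.
  have : e / (g + 1) * (g + 1) = e by rewrite mulfVK// gt_eqF.
  have : 0 < e / (g + 1) by rewrite divr_gt0.
  nra.
have [s [gs ds Hs]] := vitali_iter n oO MOA k1 k2 rad0.
exists s; split => //.
  by apply: pall_impl gs => c; exact: good_piece_sub.
have ms : measurable (pcover s : set (borelRp R p)).
  by apply: compact_measurable_borel; exact: measurable_pcover gs.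
have mB : measurable (A `\` (M `&` O0) : set (borelRp R p)) by exact: measurableD.
have mC : measurable ((M `&` O0) `\` pcover s : set (borelRp R p)) by exact: measurableD.
apply: (@le_trans _ _ (mu ((A `\` (M `&` O0)) `|` ((M `&` O0) `\` pcover s)))).
  apply: mu_le; [exact: measurableD|exact: measurableU|].
  move=> y [Ay sy]; have [Gy|] := pselect ((M `&` O0) y); first by right.
  by left.
apply: le_trans (measureU2 mu mB mC) _.
rewrite -[leRHS]add0e; apply: leeD.
  have : (mu (A `\` (M `&` O0)) <= Hd d (A `\` (M `&` O0)))%E by rewrite muE.
  move/le_trans; apply; rewrite -bd; apply: sub_Hd => //.
  move=> y [Ay nG]; split; first by split; [exact: subset_closure|exact: AM].
  move=> [_ [U [oU [Uy UA]]]]; apply: nG; split; first exact: AM.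
  by exists U.
apply: le_trans Hs _.
by rewrite gE -EFinM lee_fin.
Qed.

End BorelHausdorff.

(** * Lower bound for the maximal polarization *)

Section TauGrowth.
Variables (R : realType) (d : nat) (s : R).
Hypotheses (d0 : (0 < d)%N) (ds : d%:R <= s).

Let dR0 : 0 < d%:R :> R. Proof. by rewrite ltr0n. Qed.
Let s0 : 0 < s. Proof. exact: lt_le_trans ds. Qed.

Lemma nat_large (x : R) : exists n0, forall n, (n0 <= n)%N -> x <= n%:R.
Proof.
exists (Num.bound x) => n xn; apply: le_trans (ler_norm _) _.
apply: le_trans (ltW (archi_boundP (normr_ge0 x))) _.
rewrite ler_nat; apply: leq_trans xn.
by rewrite /Num.bound normr_id.
Qed.

Lemma tauE_crit n : s = d%:R -> tau s d n = n%:R * ln n%:R.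
Proof. by move=> ->; rewrite /tau ltxx. Qed.

Lemma tau_ge0 n : 0 <= tau s d n.
Proof.
rewrite /tau; case: ifP => _; first exact: powR_ge0.
case: n => [|n]; first by rewrite mul0r.
by rewrite mulr_ge0// ln_ge0// ler1n.
Qed.

(** Contributions of order [N], such as those of points at a distance bounded below, are negligible;
    for [s = d] this is due to the logarithm. *)
Lemma tau_dominates (C : R) : exists n0, forall n, (n0 <= n)%N -> C * n%:R <= tau s d n.
Proof.
pose C' := Num.max C 1; have C'1 : 1 <= C' by rewrite le_max lexx orbT.
suff [n0 H] : exists n0, forall n, (n0 <= n)%N -> C' * n%:R <= tau s d n.
  exists n0 => n /H; apply: le_trans; apply: ler_wpM2r => //.
  by rewrite le_max lexx.
rewrite /tau; case: ltP => dss.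
  pose q := s / d%:R - 1.
  have q0 : 0 < q by rewrite subr_gt0 ltr_pdivlMr// mul1r.
  have [n0 H] := nat_large (Num.max 1 (powR C' q^-1)); exists n0 => n /H.
  rewrite ge_max => /andP[n1 nC].
  have -> : s / d%:R = q + 1 by rewrite /q subrK.
  rewrite powRD; last by rewrite (gt_eqF (_ : 0 < n%:R)) ?implybT//; lra.
  rewrite powRr1//; apply: ler_wpM2r => //.
  have -> : C' = powR (powR C' q^-1) q.
    by rewrite -powRrM mulVf ?gt_eqF// powRr1//; lra.
  apply: ge0_ler_powR; rewrite ?nnegrE//; first exact: ltW.
  exact: powR_ge0.
have [n0 H] := nat_large (expR C'); exists n0 => n /H nC.
rewrite mulrC; apply: ler_wpM2l => //.
by rewrite -(expRK C') ler_ln// ?posrE ?expR_gt0//; apply: lt_le_trans nC; exact: expR_gt0.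
Qed.

Lemma tau_gt0_ev : exists n0, forall n, (n0 <= n)%N -> (0 < n)%N /\ 0 < tau s d n.
Proof.
have [n0 H] := tau_dominates 1; exists n0.+1 => n n0n.
have n1 : (0 < n)%N by exact: leq_ltn_trans n0n.
split=> //; apply: lt_le_trans (H n (ltnW n0n)).
by rewrite mul1r ltr0n.
Qed.

(** [tau] is asymptotically homogeneous of degree [s / d]; the subtracted 1 allows for rounding. For
    [s = d] the constant [t * ln t] is beaten by [(t - th') * ln n], with [t] halfway between [th']
    and [th]. *)
Lemma tau_scale (th' th : R) : 0 < th' -> th' < th ->
  exists n0, forall n m, (n0 <= n)%N -> th * n%:R - 1 <= m%:R ->
    powR th' (s / d%:R) * tau s d n <= tau s d m.
Proof.
move=> t0 tt; have [dss|sd] := ltP d%:R s.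
  have [n0 H] := nat_large (th - th')^-1; exists n0 => n m /H nt mn.
  rewrite /tau dss -powRM//; last exact: ltW.
  have : 1 <= (th - th') * n%:R by rewrite -ler_pdivrMl ?subr_gt0// mulr1.
  move=> H1; apply: ge0_ler_powR; rewrite ?nnegrE//.
  - by apply: divr_ge0 => //; exact: ltW.
  - by rewrite mulr_ge0// ltW.
  - lra.
have sE : s = d%:R by apply/eqP; rewrite eq_le sd ds.
pose t := (th + th') / 2; have tE : t = (th + th') / 2 by [].
have tp : 0 < t by lra.
have td : 0 < t - th' by lra.
pose K := - (t * ln t) / (t - th').
have [n0 H] := nat_large (Num.max (Num.max 1 (th - t)^-1) (Num.max t^-1 (expR K))).
exists n0 => n m /H; rewrite !ge_max => /andP[/andP[n1 nt] /andP[nt' nK]] mn.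
rewrite !tauE_crit// sE divff ?gt_eqF// powRr1 ?(ltW t0)//.
have H1 : 1 <= (th - t) * n%:R by rewrite -ler_pdivrMl ?mulr1//; lra.
have H2 : 1 <= t * n%:R by rewrite -ler_pdivrMl ?mulr1.
have np : 0 < n%:R :> R by lra.
have mt : t * n%:R <= m%:R by lra.
apply: (@le_trans _ _ (t * n%:R * ln (t * n%:R))); last first.
  apply: ler_pM => //; [by lra|exact: ln_ge0|].
  by rewrite ler_ln// posrE; lra.
rewrite lnM ?posrE//.
have lK : K <= ln n%:R by rewrite -(expRK K) ler_ln ?posrE ?expR_gt0.
have : - (t * ln t) <= (t - th') * ln n%:R by rewrite [leRHS]mulrC -ler_pdivrMr.
move=> H3; have : 0 <= n%:R * ((t - th') * ln n%:R + t * ln t) by rewrite mulr_ge0//; lra.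
by move=> H4; rewrite -subr_ge0; apply: le_trans H4 _; rewrite le_eqVlt; apply/orP; left; apply/eqP; ring.
Qed.

End TauGrowth.

Section WithinContinuity.
Variables (R : realType) (p : nat).

Lemma within_edist (A : set 'rV[R]_p) (f : 'rV[R]_p -> R) x (e : R) :
  {within A, continuous f} -> A x -> 0 < e ->
  exists2 r, 0 < r & forall y, A y -> edist x y < r -> `|f y - f x| < e.
Proof.
move=> /subspace_continuousP cf Ax e0.
have := cf x Ax (ball (f x) e) (nbhsx_ballx _ _ e0).
move=> /nbhs_eballP[r r0 rH]; exists r => // y Ay xy.
by have := rH y xy Ay; rewrite /ball/= distrC.
Qed.

Lemma within_edist2 (A : set 'rV[R]_p) (w : 'rV[R]_p * 'rV[R]_p -> R) x (e : R) :
  {within A `*` A, continuous w} -> A x -> 0 < e ->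
  exists2 r, 0 < r & forall y y', A y -> A y' -> edist x y < r -> edist x y' < r ->
    `|w (y, y') - w (x, x)| < e.
Proof.
move=> /subspace_continuousP cw Ax e0.
have := cw (x, x) (conj Ax Ax) (ball (w (x, x)) e) (nbhsx_ballx _ _ e0).
move=> [[U V] /= [/nbhs_eballP[r r0 rU] /nbhs_eballP[r' r'0 rV]] UV].
exists (Num.min r r'); first by rewrite lt_min r0.
move=> y y' Ay Ay'; rewrite !lt_min => /andP[xy _] /andP[_ xy'].
have := UV (y, y') (conj (rU _ xy) (rV _ xy')) (conj Ay Ay').
by rewrite /ball/= distrC.
Qed.

Lemma within_diag (A : set 'rV[R]_p) (w : 'rV[R]_p * 'rV[R]_p -> R) :
  {within A `*` A, continuous w} -> {within A, continuous (fun x => w (x, x))}.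
Proof.
move=> cw; apply/subspace_continuousP => x Ax U /nbhs_ballP[e /= e0 eU].
have [r r0 rH] := within_edist2 cw Ax e0.
have H : \forall y \near x, A y -> U (w (y, y)).
  near=> y => Ay; apply: eU; rewrite /ball/= distrC.
  have xy : edist x y < r by near: y; exact: nbhs_eball.
  exact: rH.
by [].
Unshelve. all: by end_near. Qed.

Lemma within_ratio (A : set 'rV[R]_p) (w : 'rV[R]_p * 'rV[R]_p -> R) x (k : R) :
  {within A `*` A, continuous w} -> A x -> 0 < w (x, x) -> 1 < k ->
  exists2 r, 0 < r & forall y y', A y -> A y' -> edist x y < r -> edist x y' < r ->
    w (x, x) <= k * w (y, y') /\ w (y, y') <= k * w (x, x).
Proof.
move=> cw Ax wx k1; have e0 : 0 < w (x, x) * (1 - k^-1).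
  by rewrite mulr_gt0// subr_gt0 invf_lt1//; apply: lt_trans k1.
have [r r0 rH] := within_edist2 cw Ax e0.
exists r => // y y' Ay Ay' xy xy'; have := rH y y' Ay Ay' xy xy'.
have k0 : 0 < k by apply: lt_trans k1.
have kk : k * k^-1 = 1 by rewrite mulfV// gt_eqF.
have ki : 0 < k^-1 by rewrite invr_gt0.
rewrite ltr_norml => /andP[H1 H2]; split.
  have H : 0 < k * (w (y, y') - k^-1 * w (x, x)) by rewrite mulr_gt0//; lra.
  by rewrite mulrBr mulrA kk mul1r in H; lra.
suff : w (x, x) * (1 - k^-1) <= (k - 1) * w (x, x) by lra.
rewrite mulrC; apply: ler_wpM2r; first exact: ltW.
nra.
Qed.

End WithinContinuity.

Section DiagonalLowerBound.
Variables (R : realType) (p : nat) (A : set 'rV[R]_p) (w : 'rV[R]_p * 'rV[R]_p -> R).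
Hypotheses (cA : compact A) (cw : {within A `*` A, continuous w}).
Hypothesis wpos : forall x, A x -> 0 < w (x, x).

(** Positivity is assumed on the diagonal, so continuity and compactness give a uniform lower bound
    near it. Halving the radii of the cover keeps both points in one neighbourhood where [w] is
    controlled. *)
Lemma weight_near_diag : exists w0 del : R, [/\ 0 < w0, 0 < del &
  forall x y, A x -> A y -> edist x y < del -> w0 <= w (x, y)].
Proof.
have /choice[r Hr] : forall x, exists r : R, A x -> 0 < r /\
    forall y y', A y -> A y' -> edist x y < r -> edist x y' < r ->
      w (x, x) <= 2 * w (y, y').
  move=> x; have [Ax|nA] := pselect (A x); last by exists 0.
  have k1 : 1 < 2 :> R by rewrite ltr1n.
  have [r r0 H] := within_ratio cw Ax (wpos Ax) k1.
  by exists r => _; split => // y y' Ay Ay' xy xy'; have [] := H y y' Ay Ay' xy xy'.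
have [|s [sA cov]] := compact_eball_cover cA (r := fun x => r x / 2).
  by move=> x /Hr[r0 _]; rewrite divr_gt0.
have [w0 [del [w00 del0 H]]] : exists w0 del : R, [/\ 0 < w0, 0 < del &
    forall x, x \in s -> w0 <= w (x, x) / 2 /\ del <= r x / 2].
  elim: s sA {cov} => [_|a s IH sA]; first by exists 1, 1; rewrite ltr01.
  have [|w0 [del [w00 del0 H]]] := IH; first by move=> x xs; apply: sA; rewrite inE xs orbT.
  have Aa : A a by apply: sA; exact: mem_head.
  have [ra _] := Hr a Aa; have wa := wpos Aa.
  exists (Num.min w0 (w (a, a) / 2)), (Num.min del (r a / 2)).
  split; [by rewrite lt_min w00 divr_gt0|by rewrite lt_min del0 divr_gt0|].
  move=> x; rewrite inE => /orP[/eqP->|/H[H1 H2]]; first by rewrite !ge_min !lexx !orbT.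
  by rewrite !ge_min H1 H2.
exists w0, del; split => // x y Ax Ay xy.
have [z zs zx] := cov x Ax; have [H1 H2] := H z zs; have [rz0 Hz] := Hr z (sA z zs).
rewrite /eball/= in zx.
have := Hz x y Ax Ay; have := edist_triangle z x y => tri.
have zy : edist z y < r z by lra.
have zx' : edist z x < r z by lra.
by move=> /(_ zx' zy); lra.
Qed.

Lemma weight_bounded : exists2 W, 0 < W & forall x y, A x -> A y -> w (x, y) <= W.
Proof.
have [[a Aa]|nA] := pselect (A !=set0); last first.
  by exists 1 => // x y Ax; exfalso; apply: nA; exists x.
have cAA : compact (A `*` A) by exact: compact_setX.
have := continuous_compact cw cAA => /compact_bounded[M [_ HM]].
have M0 : 0 <= Num.max M 0 by rewrite le_max lexx orbT.
have MM : M <= Num.max M 0 by rewrite le_max lexx.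
exists (Num.max M 0 + 1); first by lra.
move=> x y Ax Ay; apply: le_trans (ler_norm _) _; apply: HM.
  by lra.
by exists (x, y).
Qed.

End DiagonalLowerBound.

Section CubeParametrization.
Variables (R : realType) (d : nat).

Lemma cube_param (a : 'rV[R]_d) h : 0 < h ->
  exists g g' : 'rV[R]_d -> 'rV[R]_d,
    [/\ forall z, unit_cube R d z -> ccube a h (g z),
        forall v, ccube a h v -> unit_cube R d (g' v) /\ g (g' v) = v &
        forall z z', edist (g z) (g z') = (2 * h) * edist z z'].
Proof.
move=> h0; have h20 : 0 < 2 * h by rewrite mulr_gt0.
pose b : 'rV[R]_d := a - const_mx h.
have bE i : b ord0 i = a ord0 i - h by rewrite !mxE.
exists (fun z => (2 * h) *: z + b), (fun v => (2 * h)^-1 *: (v - b)); split.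
- move=> z Hz i; have /andP[y1 y2] := Hz i; rewrite !mxE.
  have : 0 <= (2 * h) * z ord0 i by rewrite mulr_ge0// ltW.
  have : (2 * h) * z ord0 i <= 2 * h by rewrite ler_piMr// ltW.
  by rewrite ler_norml => ? ?; apply/andP; split; lra.
- move=> v Hv; split; last by rewrite scalerA mulfV ?gt_eqF// scale1r subrK.
  move=> i; have := Hv i; rewrite !mxE ler_norml => /andP[y1 y2].
  rewrite mulrC ler_pdivlMr// ler_pdivrMr// mul0r mul1r.
  by apply/andP; split; lra.
- by move=> z z'; rewrite edistDr edistZ ger0_norm// ltW.
Qed.

End CubeParametrization.

(** * Coverability constants *)

Section Coverability.
Variables (R : realType) (p d : nat) (s : R) (A : set 'rV[R]_p).
Variables (w : 'rV[R]_p * 'rV[R]_p -> R) (a0 : 'rV[R]_p).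
Hypotheses (d0 : (0 < d)%N) (ds : d%:R <= s) (Aa0 : A a0).
Hypothesis wge0 : forall x y, A x -> A y -> 0 <= w (x, y).

Let sig := sigma_sd s d.
Let dR0 : 0 < d%:R :> R. Proof. by rewrite ltr0n. Qed.
Let s0 : 0 < s. Proof. exact: lt_le_trans ds. Qed.
Let q0 : 0 < s / d%:R. Proof. exact: divr_gt0. Qed.
Let sig0 : 0 < sig. Proof. by have [] := cube_asymp d0 ds. Qed.

(* For every [l' > l], [n]-point configurations of [A] can produce on [B] a
   potential asymptotically at least that of an optimal configuration on a
   [d]-dimensional set of measure [l']. *)
Definition coverable (B : set 'rV[R]_p) (l : R) :=
  [/\ B `<=` A, 0 <= l & forall l', l < l' -> exists n0, forall n, (n0 <= n)%N ->
    exists2 omega, configs A n omega & forall y, B y ->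
      ((sig * powR l' (- (s / d%:R)) * tau s d n)%:E <= Upot w s y omega)%E].

Lemma coverable_sub B B' l l' : B' `<=` B -> l <= l' ->
  coverable B l -> coverable B' l'.
Proof.
move=> BB ll [BA l0 H]; split; [exact: subset_trans BA|exact: le_trans ll|].
move=> m lm; have [n0 Hn] := H m (le_lt_trans ll lm).
by exists n0 => n /Hn[om Aom Hom]; exists om => // y /BB; exact: Hom.
Qed.

Lemma coverable0 : coverable set0 0.
Proof.
by split => // l' _; exists 0%N => n _; exists (fun=> a0).
Qed.

(** The [n] points are divided in the proportion [l1 : l2]. By homogeneity of [tau], the share
    [l1 / l'] of them yields on [B1] the potential [sig * l1^(-s/d) * tau(n * l1 / l')], about
    [sig * l'^(-s/d) * tau(n)], and likewise on [B2]. *)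
Lemma coverableU B1 B2 l1 l2 : coverable B1 l1 -> coverable B2 l2 ->
  coverable (B1 `|` B2) (l1 + l2).
Proof.
move=> [BA1 l10 H1] [BA2 l20 H2]; split; [by rewrite subUset|exact: addr_ge0|].
(* Each set gets one [del] of slack and half a [del] more for [tau_scale]; the shares
   [l1 + 3 / 2 * del] and [l2 + 3 / 2 * del] add up to exactly [l']. *)
move=> l' ll; pose del := (l' - l1 - l2) / 3.
have delE : del = (l' - l1 - l2) / 3 by [].
have del0 : 0 < del by lra.
have l'0 : 0 < l' by lra.
have l'E : l' = l1 + l2 + 3 * del by lra.
have [n1 Hn1] := H1 (l1 + del) (ltr_pwDr del0 (lexx _)).
have [n2 Hn2] := H2 (l2 + del) (ltr_pwDr del0 (lexx _)).
have main l (l0 : 0 <= l) n' : exists n0, forall n m, (n0 <= n)%N ->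
    ((l + 3 / 2 * del) / l') * n%:R - 1 <= m%:R ->
    (n' <= m)%N /\ sig * powR l' (- (s / d%:R)) * tau s d n <=
      sig * powR (l + del) (- (s / d%:R)) * tau s d m.
  have ld : 0 < l + del by lra.
  have th'0 : 0 < (l + del) / l' by rewrite divr_gt0.
  have thth : (l + del) / l' < (l + 3 / 2 * del) / l'.
    by rewrite ltr_pM2r ?invr_gt0//; lra.
  have [k Hk] := tau_scale d0 ds th'0 thth.
  have [k' Hk'] := nat_large (((l + 3 / 2 * del) / l')^-1 * (n'%:R + 1)).
  exists (maxn k k') => n m; rewrite geq_max => /andP[kn k'n] mn; split.
    have := Hk' n k'n; rewrite ler_pdivrMl; last exact: lt_trans thth.
    by move=> H; rewrite -(ler_nat R); lra.
  have := Hk n m kn mn; rewrite powRM ?invr_ge0 ?(ltW ld) ?(ltW l'0)//.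
  rewrite powR_inv// => H; rewrite -!mulrA ler_pM2l//.
  have pl : 0 < powR (l + del) (- (s / d%:R)) by exact: powR_gt0.
  rewrite -(ler_pM2l pl) in H; apply: le_trans H; rewrite !mulrA.
  by rewrite [X in _ <= X * _ * _]mulrC -powRD ?subrr ?powRr0 ?mul1r ?(gt_eqF ld) ?implybT// addrN powRr0 mul1r.
have [k1 Hk1] := main l1 l10 n1; have [k2 Hk2] := main l2 l20 n2.
exists (maxn k1 k2) => n; rewrite geq_max => /andP[kn1 kn2].
pose m1 := Num.truncn ((l1 + 3 / 2 * del) / l' * n%:R).
pose m2 := Num.truncn ((l2 + 3 / 2 * del) / l' * n%:R).
have t1 : 0 <= (l1 + 3 / 2 * del) / l' * n%:R.
  by rewrite mulr_ge0// divr_ge0//; lra.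
have t2 : 0 <= (l2 + 3 / 2 * del) / l' * n%:R.
  by rewrite mulr_ge0// divr_ge0//; lra.
have /andP[m1l] := truncn_itv t1; rewrite -/m1 -natr1 => m1u.
have /andP[m2l] := truncn_itv t2; rewrite -/m2 -natr1 => m2u.
have [|m1n Hm1] := Hk1 n m1 kn1; first by lra.
have [|m2n Hm2] := Hk2 n m2 kn2; first by lra.
have mn : (m1 + m2 <= n)%N.
  rewrite -(ler_nat R) natrD; apply: (le_trans (lerD m1l m2l)).
  rewrite -mulrDl -mulrDl -[leRHS]mul1r ler_wpM2r// ler_pdivrMr// mul1r; lra.
have [om1 Ao1 Ho1] := Hn1 m1 m1n; have [om2 Ao2 Ho2] := Hn2 m2 m2n.
pose f (t : 'I_m1 + 'I_m2) := match t with inl i => om1 i | inr i => om2 i end.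
have [||om Aom Hom] := @fin_config R p A _ f n a0 Aa0.
- by case => i; rewrite /f.
- by rewrite card_sum !card_ord.
exists om => // y BUy; have Ay : A y by case: BUy => [/BA1|/BA2].
apply: le_trans (Hom y w s (fun x Ax => wge0 Ay Ax)).
have f0 t : (0 <= rkernel w s y (f t))%E.
  by apply: rkernel_ge0; apply: wge0 => //; case: t => i; rewrite /f.
rewrite big_sumType/=; case: BUy => [B1y|B2y].
  apply: (@le_trans _ _ (Upot w s y om1)).
    by apply: le_trans (Ho1 y B1y); rewrite lee_fin.
  by apply: leeDl; apply: sume_ge0 => i _; exact: (f0 (inr i)).
apply: (@le_trans _ _ (Upot w s y om2)).
  by apply: le_trans (Ho2 y B2y); rewrite lee_fin.
by apply: leeDr; apply: sume_ge0 => i _; exact: (f0 (inl i)).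
Qed.

(** Only distances from points of [B] to image points matter, so [g] may be any map, even a
    discontinuous nearest-point projection. The constant [l] solves [l^(-s/d) = c0 * L^(-s)]. *)
Lemma coverable_map B (g : 'rV[R]_d -> 'rV[R]_p) L c0 :
  B `<=` A -> 0 < L -> 0 < c0 -> (forall z, unit_cube R d z -> A (g z)) ->
  (forall y, B y -> exists2 u, unit_cube R d u & forall z, unit_cube R d z ->
     edist y (g z) <= L * edist u z /\ c0 <= w (y, g z)) ->
  coverable B (L ^+ d * powR c0 (- (d%:R / s))).
Proof.
move=> BA L0 c00 gA Hg; set l := L ^+ d * _.
have l0 : 0 < l by rewrite mulr_gt0 ?exprn_gt0 ?powR_gt0.
split => //; first exact: ltW.
move=> l' ll; have l'0 : 0 < l' by apply: lt_trans ll.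
pose D := c0 * powR L (- s).
have D0 : 0 < D by rewrite mulr_gt0 ?powR_gt0.
have lD : powR l (- (s / d%:R)) = D.
  rewrite /l powRM ?powR_ge0 ?exprn_ge0 ?(ltW L0)// -powR_mulrn ?(ltW L0)// -!powRrM.
  rewrite mulrC; congr (_ * _).
    have -> : - (d%:R / s) * - (s / d%:R) = 1.
      by rewrite mulrNN mulrA mulfVK ?gt_eqF// mulfV ?gt_eqF.
    by rewrite powRr1// ltW.
  by rewrite mulrN mulrCA mulfV ?mulr1// gt_eqF.
pose rho := powR l' (- (s / d%:R)) / D.
have rhoE : powR l' (- (s / d%:R)) = rho * D by rewrite /rho mulfVK// gt_eqF.
have rho1 : rho < 1.
  rewrite /rho ltr_pdivrMr// mul1r -lD !powRN ltf_pV2 ?posrE ?powR_gt0//.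
  by apply: gt0_ltr_powR; rewrite ?nnegrE//; exact: ltW.
have rho0 : 0 < rho by rewrite divr_gt0// powR_gt0.
have e0 : 0 < sig * (1 - rho) / 2 by rewrite divr_gt0// mulr_gt0// subr_gt0.
have [_ [_ cl]] := cube_asymp d0 ds; have [n0 Hn0] := cl _ e0.
have [n1 Hn1] := tau_gt0_ev s d0.
exists (maxn n0 n1) => n; rewrite geq_max => /andP[nn0 nn1].
have [np tp] := Hn1 n nn1.
have aP : ((sig * rho * tau s d n)%:E < Pmax (fun=> 1%R) s (unit_cube R d) n)%E.
  apply: lt_le_trans (Hn0 n nn0); rewrite lte_fin ltr_pM2r// -/sig.
  have := mulr_gt0 sig0 (_ : 0 < 1 - rho); rewrite subr_gt0 => /(_ rho1); lra.
have [om Aom Hom] := Pmax_gt_ex aP.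
exists (fun j => g (om j)) => [j|y By]; first by apply: gA; exact: Aom.
have [u Qu Hu] := Hg y By.
apply: le_trans (Upot_ge (L := L) (c := D) (ltW s0) L0 (ltW D0)
  (fun j => (Hu _ (Aom j)).1) _).
  rewrite rhoE mulrA -mulrA [D * _]mulrC mulrA [_ * D]mulrC EFinM.
  by apply: lee_wpmul2l; [rewrite lee_fin ltW|exact: ltW (Hom u Qu)].
move=> j; rewrite /D -mulrA powRN mulVf ?gt_eqF ?powR_gt0// mulr1.
exact: (Hu _ (Aom j)).2.
Qed.

End Coverability.

(** * Coverability of pieces and of small remainders *)

Section CoverManifold.
Variables (R : realType) (p d : nat) (s : R) (A M : set 'rV[R]_p).
Variables (w : 'rV[R]_p * 'rV[R]_p -> R) (a0 : 'rV[R]_p).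
Hypotheses (d0 : (0 < d)%N) (ds : d%:R <= s) (Aa0 : A a0).
Hypothesis wge0 : forall x y, A x -> A y -> 0 <= w (x, y).
Hypotheses (CM : C1_submanifold d M) (cA : compact A) (AM : A `<=` M).

Let cov := @coverable R p d s A w.

(** The dilated cube has side [2 * kappa * prad c], the chart costs another [kappa], and [kappa^-1]
    accounts for the oscillation of the weight. The dilation serves [pieces_open]. *)
Lemma cov_piece kappa rad (c : piece R p d) : 1 < kappa -> kappa <= 2 ->
  (forall x, A x -> 0 < w (x, x)) ->
  (forall x y y', A x -> A y -> A y' -> edist x y < rad x -> edist x y' < rad x ->
     w (x, x) <= kappa * w (y, y')) ->
  good_piece M kappa rad A c ->
  cov (pimg c kappa) ((kappa ^+ 2 * (2 * prad c)) ^+ d *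
    powR (kappa^-1 * w (pcenter c, pcenter c)) (- (d%:R / s))).
Proof.
move=> k1 k2 wpos Hrad gc; have [ch c0 cV cA2] := gc.
have k0 : 0 < kappa by apply: lt_trans k1.
have pA2 : pimg c kappa `<=` A `&` eball (pcenter c) (rad (pcenter c)).
  by apply: subset_trans cA2; apply: pimg_sub => //; exact: ltW.
have Ax : A (pcenter c).
  apply: (proj1 (cA2 _ _)); exists (pctr c) => //; apply: ccube_center.
  by rewrite mulr_ge0// ltW.
have kc0 : 0 < kappa * prad c by exact: mulr_gt0.
have [g [g' [Hg Hg' gd]]] := cube_param (pctr c) kc0.
have gpimg z : unit_cube R d z -> pimg c kappa (pmap c (g z)).
  by move=> Qz; exists (g z) => //; exact: Hg.
apply: (@coverable_map R p d s A w d0 ds _ (fun z => pmap c (g z))) => //.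
- by move=> y /pA2[].
- by rewrite mulr_gt0 ?exprn_gt0// mulr_gt0.
- by rewrite mulr_gt0 ?invr_gt0//; exact: wpos.
- by move=> z /gpimg/pA2[].
move=> _ [v Hv <-]; have [Qu gu] := Hg' v Hv.
exists (g' v) => // z Qz; split.
  have V1 : pdom c v by exact: (pdom_ccube gc k2).
  have V2 : pdom c (g z) by apply: (pdom_ccube gc k2); exact: Hg.
  apply: le_trans (pmap_lip gc V1 V2) _.
  rewrite -{1}gu gd le_eqVlt; apply/orP; left; apply/eqP; ring.
rewrite mulrC ler_pdivrMr// mulrC.
have [Az xz] := pA2 _ (gpimg z Qz).
have [Av xv] : (A `&` eball (pcenter c) (rad (pcenter c))) (pmap c v).
  by apply: pA2; exists v.
exact: Hrad.
Qed.

Lemma nearest_point y : exists2 n, A n & forall a, A a -> edist y n <= edist y a.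
Proof.
have A0 : A !=set0 by exists a0.
have cf : {within A, continuous (edist y)}.
  by apply: continuous_subspaceT => z; exact: edist_continuous.
have [n nA H] := EVT_min_rV A0 cA cf.
by exists n; [exact: set_mem|move=> a Aa; apply: H; exact: mem_set].
Qed.

Variables (w0 del : R).
Hypotheses (w00 : 0 < w0) (del0 : 0 < del).
Hypothesis wdiag : forall x y, A x -> A y -> edist x y < del -> w0 <= w (x, y).

(** The 16 is the product of 4 (a ball of radius [r] pulls back into a cube of side [4 * r]), of the
    Lipschitz constant 2 of the chart and of the factor 2 lost by nearest points. *)
Let C : R := 16 ^+ d * powR w0 (- (d%:R / s)).

(* [A] may be arbitrarily thin inside the chart: an optimal configuration of the
   whole chart cube is projected to nearest points of [A], which at most doubles
   the distances to points of [A]. *)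
Lemma cov_ball_local x : A x -> exists2 q, 0 < q &
  forall y r, A y -> edist x y < q -> 0 < r -> r <= q ->
    cov (A `&` eball y r) (C * r ^+ d).
Proof.
move=> Ax; have k12 : 1 < 2 :> R by rewrite ltr1n.
have [psi [V [a [oV [Va ax] VM L Vo]]]] := C1_chart CM k12 (AM Ax).
have [Q [oQ VQ]] := Vo V oV (fun u Vu => Vu).
have px : (psi @` V) x by exists a.
have Qx : Q x by rewrite VQ in px; case: px.
have [rho rho0 rQ] := open_eballP oQ Qx.
have [r2 r20 rV] := open_eballP oV Va.
pose D1 : R := d%:R + 1; have D10 : 0 < D1 by rewrite ltr_wpDl.
have dD1 : D1 = d%:R + 1 by [].
have dge : 0 <= d%:R :> R by [].
(* So small that the balls considered and the cubes containing their preimages stay in the chart,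
   and that all distances involved stay below [del]. *)
pose q := Num.min (Num.min r2 rho) del / (16 * D1).
have q0 : 0 < q by rewrite divr_gt0 ?mulr_gt0// !lt_min r20 rho0.
have [q2 qr qd] : [/\ 16 * D1 * q <= r2, 16 * D1 * q <= rho & 16 * D1 * q <= del].
  have -> : 16 * D1 * q = Num.min (Num.min r2 rho) del.
    by rewrite /q mulrC mulfVK// gt_eqF// mulr_gt0.
  by split; rewrite !ge_min lexx ?orbT.
have dq : 0 <= d%:R * q by rewrite mulr_ge0// ltW.
have D1q : D1 * q = d%:R * q + q by rewrite dD1 mulrDl mul1r.
exists q => // y r Ay xy r0 rq.
have dr : d%:R * r <= d%:R * q by rewrite ler_wpM2l.
have dr0 : 0 <= d%:R * r by rewrite mulr_ge0// ltW.
have pull z : M z -> edist x z < rho -> exists2 u, V u & psi u = z.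
  by move=> Mz xz; have : (psi @` V) z by rewrite VQ; split => //; exact: rQ.
have [b Vb by_] : exists2 u, V u & psi u = y by apply: pull; [exact: AM|lra].
have ab : edist a b <= 2 * q.
  have [_ H] := L a b Va Vb; rewrite ax by_ in H; lra.
have QV : ccube b (2 * r) `<=` V.
  move=> v Hv; apply: rV; rewrite /eball/=.
  have bv : edist b v <= d%:R * (2 * r).
    by apply: edist_le_coord => [|i]; [lra|rewrite distrC; exact: Hv].
  have := edist_triangle a b v; lra.
have /choice[near Hnear] : forall z, exists n, A n /\ forall a, A a -> edist z n <= edist z a.
  by move=> z; have [n An Hn] := nearest_point z; exists n.
have r20' : 0 < 2 * r by lra.
have [g [g' [Hg Hg' gd]]] := cube_param b r20'.
rewrite /C mulrAC -exprMn.
apply: (@coverable_map R p d s A w d0 ds _ (fun z => near (psi (g z)))) => //.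
- lra.
- by move=> z _; have [] := Hnear (psi (g z)).
move=> y' [Ay' yy']; rewrite /eball/= in yy'.
have [u Vu uy'] : exists2 u, V u & psi u = y'.
  by apply: pull; [exact: AM|have := edist_triangle x y y'; lra].
have bu : ccube b (2 * r) u.
  move=> i; apply: le_trans (coord_le_edist _ _ i) _.
  by have [_ H] := L u b Vu Vb; rewrite uy' by_ edistC (edistC y') in H *; lra.
have [Qu gu] := Hg' u bu; exists (g' u) => // z Qz.
have [An nH] := Hnear (psi (g z)).
have Vz : V (g z) by apply: QV; exact: Hg.
have e1 : edist y' (psi (g z)) <= 2 * edist u (g z).
  by have [H _] := L u (g z) Vu Vz; rewrite uy' in H.
have e2 : edist y' (near (psi (g z))) <= 4 * edist u (g z).
  have := edist_triangle y' (psi (g z)) (near (psi (g z))).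
  have := nH _ Ay'; rewrite (edistC _ y'); lra.
split; first by rewrite -{1}gu gd in e2; lra.
apply: wdiag => //; apply: le_lt_trans e2 _.
have := ccube_edist (ltW r20') bu (Hg z Qz); lra.
Qed.

Lemma cov_ball : exists2 q, 0 < q & forall y r, A y -> 0 < r -> r <= q ->
  cov (A `&` eball y r) (C * r ^+ d).
Proof.
have /choice[q Hq] : forall x, exists q : R, A x -> 0 < q /\
    forall y r, A y -> edist x y < q -> 0 < r -> r <= q ->
    cov (A `&` eball y r) (C * r ^+ d).
  move=> x; have [Ax|nA] := pselect (A x); last by exists 0.
  by have [q q0 H] := cov_ball_local Ax; exists q.
have [|l [lA covl]] := compact_eball_cover cA (r := q); first by move=> x /Hq[].
have [q1 q10 H1] : exists2 q1 : R, 0 < q1 & forall x, x \in l -> q1 <= q x.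
  elim: l lA {covl} => [_|a l IH lA]; first by exists 1.
  have [|q1 q10 H1] := IH; first by move=> x xl; apply: lA; rewrite inE xl orbT.
  have Aa : A a by apply: lA; exact: mem_head.
  have [qa _] := Hq a Aa; exists (Num.min q1 (q a)); first by rewrite lt_min q10.
  move=> x; rewrite inE => /orP[/eqP->|/H1 H]; first by rewrite ge_min lexx orbT.
  by rewrite ge_min H.
exists q1 => // y r Ay r0 rq; have [x xl xy] := covl y Ay.
have [_ H] := Hq x (lA x xl); apply: H => //.
exact: le_trans rq (H1 x xl).
Qed.

Lemma cov_compact (K : set 'rV[R]_p) x : compact K -> K `<=` A -> (hraw d K < x%:E)%E ->
  cov K (C * x).
Proof.
move=> cK KA Kx; have [q q0 Hq] := cov_ball.
(* [compact_hcover] produces radii up to twice its [delta]. *)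
have q20 : 0 < q / 2 by rewrite divr_gt0.
have [|l [lK covl lx]] := compact_hcover cK q20 (x := x) (d := d).
  by apply: le_lt_trans Kx; exact: hdelta_le_hraw.
have C0 : 0 <= C by rewrite mulr_ge0 ?powR_ge0// exprn_ge0.
have H : cov (\big[setU/set0]_(c <- l) (A `&` eball c.1 c.2)) (\sum_(c <- l) C * c.2 ^+ d).
  elim: l lK {covl lx} => [_|c l IH lK]; first by rewrite !big_nil; apply: coverable0; exact: Aa0.
  rewrite !big_cons; apply: (coverableU d0 ds Aa0 wge0).
    have [Kc /andP[c0 c2]] := lK c (mem_head _ _).
    by apply: Hq => //; [exact: KA|lra].
  by apply: IH => c' c'l; apply: lK; rewrite inE c'l orbT.
apply: coverable_sub H.
  move=> y Ky; have [c cl yc] := covl y Ky; rewrite -bigcup_seq; exists c => //.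
  by split => //; exact: KA.
by rewrite -mulr_sumr ler_wpM2l.
Qed.

(** The image of the open cube of half-side [kappa * prad c] is relatively open in [M], contains the
    piece and lies in its dilation. Removing [O] from [A] therefore leaves a compact set, to which
    [cov_compact] applies. *)
Lemma pieces_open kappa rad (l : seq (piece R p d)) : 1 < kappa -> kappa <= 2 ->
  pall (good_piece M kappa rad A) l ->
  exists O, [/\ open O, pcover l `<=` O &
    O `&` A `<=` \big[setU/set0]_(c <- l) pimg c kappa].
Proof.
move=> k1 k2; elim: l => [_|c l IH /= [gc gl]].
  by exists set0; split; [exact: open0|exact: sub0set|rewrite set0I; exact: sub0set].
have [Q [oQ lQ QA]] := IH gl; have [[oV _ VM _ Vo] c0 cV _] := gc.
have kc0 : 0 < kappa * prad c by rewrite mulr_gt0//; apply: lt_trans k1.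
have bsub : ball (pctr c) (kappa * prad c) `<=` ccube (pctr c) (kappa * prad c).
  by move=> v /(ballP _ _ kc0) H i; rewrite distrC; exact: ltW (H i).
have bV : ball (pctr c) (kappa * prad c) `<=` pdom c.
  by apply: subset_trans (pdom_ccube gc k2).
have [P [oP VP]] := Vo _ (ball_open _ _) bV.
exists (P `|` Q); split.
- exact: openU.
- move=> y [[v Hv vy]|/lQ Qy]; last by right.
  left; have : (pmap c @` ball (pctr c) (kappa * prad c)) y.
    exists v => //; apply/(ballP _ _ kc0) => i; apply: le_lt_trans (_ : _ <= 1 * prad c) _.
      by rewrite distrC; exact: Hv.
    by rewrite ltr_pM2r.
  by rewrite VP => -[].
- move=> y [[Py|Qy] Ay]; rewrite big_cons; last by right; apply: QA.
  left; have : (P `&` M) y by split => //; exact: AM.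
  by rewrite -VP => -[v /bsub Hv vy]; exists v.
Qed.

(** In the last term, the 2 provides the strict inequality that [cov_compact] asks for, and [hraw]
    of the unit cube undoes the normalization of [Hd]. *)
Lemma cov_total kappa rad (l : seq (piece R p d)) (e : R) :
  1 < kappa -> kappa <= 2 -> (forall x, A x -> 0 < w (x, x)) ->
  (forall x y y', A x -> A y -> A y' -> edist x y < rad x -> edist x y' < rad x ->
     w (x, x) <= kappa * w (y, y')) ->
  pall (good_piece M kappa rad A) l -> 0 < e -> (Hd d (A `\` pcover l) <= e%:E)%E ->
  cov A (\sum_(c <- l) (kappa ^+ 2 * (2 * prad c)) ^+ d *
      powR (kappa^-1 * w (pcenter c, pcenter c)) (- (d%:R / s)) +
    C * (fine (hraw d (unit_cube R d)) * (2 * e))).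
Proof.
move=> k1 k2 wpos Hrad gl e0 He.
have [Q [oQ lQ QA]] := pieces_open k1 k2 gl.
have cK : compact (A `\` Q).
  apply: (subclosed_compact _ cA); last exact: subDsetl.
  apply: closedI; first exact: compact_closed (@norm_hausdorff _ _) cA.
  exact: open_closedC.
have H1 : cov (\big[setU/set0]_(c <- l) pimg c kappa) (\sum_(c <- l) (kappa ^+ 2 * (2 * prad c)) ^+ d *
      powR (kappa^-1 * w (pcenter c, pcenter c)) (- (d%:R / s))).
  elim: (l) gl => [_|c l' IH /= [gc gl']]; first by rewrite !big_nil; apply: coverable0; exact: Aa0.
  rewrite !big_cons; apply: (coverableU d0 ds Aa0 wge0); last exact: IH.
  exact: cov_piece Hrad gc.
have [hE h0] := hraw_cubeE R d0.
have H2 : cov (A `\` Q) (C * (fine (hraw d (unit_cube R d)) * (2 * e))).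
  apply: cov_compact => //.
  have : (Hd d (A `\` Q) <= e%:E)%E.
    by apply: le_trans He; apply: sub_Hd => //; apply: setDS.
  rewrite /Hd; have := hraw_ge0 d (A `\` Q); case: (hraw d (A `\` Q)) => [r||]//=.
    rewrite -EFinM !lee_fin lte_fin => r0; rewrite ler_pdivrMr// => re.
    by apply: le_lt_trans re _; rewrite mulrC ltr_pM2l// ltr_pMl// ltr1n.
  by rewrite gt0_mulye ?lte_fin ?invr_gt0// => _; rewrite leye_eq.
apply: coverable_sub (coverableU d0 ds Aa0 wge0 H1 H2) => // y Ay.
have [Qy|nQ] := pselect (Q y); last by right.
by left; apply: QA.
Qed.

End CoverManifold.

(** * Points that a configuration must have in a small cube *)

Section Clamping.
Variables (R : realType) (d : nat).

Lemma edist_coordwise (x y x' y' : 'rV[R]_d) :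
  (forall i, `|x ord0 i - y ord0 i| <= `|x' ord0 i - y' ord0 i|) ->
  edist x y <= edist x' y'.
Proof.
move=> H; rewrite /edist ler_wsqrtr//; apply: ler_sum => i _.
by rewrite -real_normK ?num_real// -[leRHS]real_normK ?num_real// lerXn2r ?nnegrE.
Qed.

Lemma clamp_exists (a v : 'rV[R]_d) h : 0 <= h ->
  exists2 v', ccube a h v' & forall u, ccube a h u -> edist u v' <= edist u v.
Proof.
move=> h0.
exists (\row_i Num.max (a ord0 i - h) (Num.min (a ord0 i + h) (v ord0 i))).
  move=> i; rewrite mxE ler_norml; apply/andP.
  case: (leP (a ord0 i + h) (v ord0 i)) => H1.
    by case: (leP (a ord0 i - h) (a ord0 i + h)) => H2; split; lra.
  by case: (leP (a ord0 i - h) (v ord0 i)) => H2; split; lra.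
move=> u Hu; apply: edist_coordwise => i; rewrite mxE.
have := Hu i; rewrite ler_norml => /andP[u1 u2].
case: (leP (a ord0 i + h) (v ord0 i)) => H1.
  case: (leP (a ord0 i - h) (a ord0 i + h)) => H2; last by lra.
  by rewrite !ler0_norm; lra.
case: (leP (a ord0 i - h) (v ord0 i)) => H2; first by [].
by rewrite !ger0_norm; lra.
Qed.

Lemma compact_open_gap (K P : set 'rV[R]_d) : compact K -> open P -> K `<=` P ->
  exists2 c0, 0 < c0 & forall y z, K y -> ~ P z -> c0 <= edist y z.
Proof.
move=> cK oP KP.
have /choice[r Hr] : forall y, exists r : R, K y -> 0 < r /\ eball y r `<=` P.
  move=> y; have [Ky|nK] := pselect (K y); last by exists 0.
  by have [r r0 H] := open_eballP oP (KP _ Ky); exists r.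
have [|l [lK covl]] := compact_eball_cover cK (r := fun y => r y / 2).
  by move=> x /Hr[r0 _]; rewrite divr_gt0.
have [q1 q10 H1] : exists2 q1 : R, 0 < q1 & forall x, x \in l -> q1 <= r x / 2.
  elim: l lK {covl} => [_|a l IH lK]; first by exists 1.
  have [|q1 q10 H1] := IH; first by move=> x xl; apply: lK; rewrite inE xl orbT.
  have [ra _] := Hr a (lK a (mem_head _ _)).
  exists (Num.min q1 (r a / 2)); first by rewrite lt_min q10 divr_gt0.
  move=> x; rewrite inE => /orP[/eqP->|/H1 H]; first by rewrite ge_min lexx orbT.
  by rewrite ge_min H.
exists q1 => // y z Ky nPz; have [x xl xy] := covl y Ky.
have [r0 rP] := Hr x (lK x xl); have := H1 x xl.
rewrite leNgt => ?; apply/negP => yz; apply: nPz; apply: rP.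
by rewrite /eball/= in xy *; have := edist_triangle x y z; have := H1 x xl; lra.
Qed.

End Clamping.

Section PieceCount.
Variables (R : realType) (p d : nat) (s : R) (A M : set 'rV[R]_p).
Variables (w : 'rV[R]_p * 'rV[R]_p -> R) (W kappa : R) (rad : 'rV[R]_p -> R).
Variable c : piece R p d.
Hypotheses (d0 : (0 < d)%N) (ds : d%:R <= s).
Hypothesis wge0 : forall x y, A x -> A y -> 0 <= w (x, y).
Hypothesis wpos : forall x, A x -> 0 < w (x, x).
Hypotheses (W0 : 0 < W) (wW : forall x y, A x -> A y -> w (x, y) <= W).
Hypotheses (AM : A `<=` M) (k1 : 1 < kappa) (k2 : kappa <= 2).
Hypothesis Hrad : forall x y y', A x -> A y -> A y' ->
  edist x y < rad x -> edist x y' < rad x -> w (y, y') <= kappa * w (x, x).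
Hypothesis gc : good_piece M kappa rad A c.

Let sig := sigma_sd s d.
Let dR0 : 0 < d%:R :> R. Proof. by rewrite ltr0n. Qed.
Let s0 : 0 < s. Proof. exact: lt_le_trans ds. Qed.
Let q0 : 0 < s / d%:R. Proof. exact: divr_gt0. Qed.
Let sig0 : 0 < sig. Proof. by have [] := cube_asymp d0 ds. Qed.
Let k0 : 0 < kappa. Proof. exact: lt_trans k1. Qed.
Let c0 : 0 < prad c. Proof. by have [] := gc. Qed.
Let wc := w (pcenter c, pcenter c).

Lemma pimg_A k : k <= 2 -> pimg c k `<=` A `&` eball (pcenter c) (rad (pcenter c)).
Proof.
move=> kk; have [_ _ _ H] := gc; apply: subset_trans H.
by apply: pimg_sub => //; exact: ltW.
Qed.

Lemma pcenter_A : A (pcenter c).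
Proof.
apply: (proj1 (pimg_A (lexx 2) _)); exists (pctr c) => //; apply: ccube_center.
by rewrite mulr_ge0// ltW.
Qed.

(** The image of the open cube is the trace on [M] of an open set [P] of the ambient space, which
    contains the compact shrunk piece. Hence no other part of [A] comes close to the shrunk piece in
    the ambient distance. *)
Lemma piece_gap : exists2 e, 0 < e & forall y z,
  pimg c kappa^-1 y -> A z -> ~ pimg c 1 z -> e <= edist y z.
Proof.
have ki : kappa^-1 < 1 by rewrite invf_lt1.
have bsub : ball (pctr c) (prad c) `<=` ccube (pctr c) (1 * prad c).
  by move=> v /(ballP _ _ c0) H i; rewrite distrC mul1r; exact: ltW (H i).
have k12 : 1 <= 2 :> R by rewrite ler1n.
have [[oV _ VM _ Vo] _ _ _] := gc.
have [P [oP VP]] := Vo _ (ball_open _ _) (subset_trans bsub (pdom_ccube gc k12)).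
have cK : compact (pimg c kappa^-1).
  by apply: (compact_pimg k1 gc); apply: le_trans (ltW ki) k12.
have KP : pimg c kappa^-1 `<=` P.
  move=> y [v Hv vy]; have : (pmap c @` ball (pctr c) (prad c)) y.
    exists v => //; apply/(ballP _ _ c0) => i; rewrite distrC.
    by apply: le_lt_trans (Hv i) _; rewrite gtr_pMl.
  by rewrite VP => -[].
have [e e0 He] := compact_open_gap cK oP KP.
exists e => // y z Ky Az nz; apply: He => // Pz; apply: nz.
have : (P `&` M) z by split => //; exact: AM.
by rewrite -VP => -[v /bsub Hv vz]; exists v.
Qed.

(** Kernels on the piece are at most [D] times those on the unit cube: [kappa * wc] bounds the
    weight, the shrunk cube has side [2 * prad c / kappa], and the chart costs another [kappa]. *)
Let D := kappa * wc * powR (kappa ^+ 2 / (2 * prad c)) s.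

(* Test points are taken in the slightly shrunk cube, so that points outside the
   piece contribute only [O(N)]; points inside the piece are retracted onto the
   shrunk cube, which decreases their distances to the test points. *)
Lemma piece_potential : exists2 C, 0 <= C & forall N (omega : 'I_N -> 'rV[R]_p) t,
  configs A N omega -> (t%:E <= Ppol w s A omega)%E ->
  (((t - C * N%:R) / D)%:E <= Pmax (fun=> 1%R) s (unit_cube R d)
     #|[pred j | `[< pimg c 1 (omega j) >]]|)%E.
Proof.
have [e e0 He] := piece_gap.
have ki : kappa^-1 < 1 by rewrite invf_lt1.
have ki0 : 0 < kappa^-1 by rewrite invr_gt0.
have k12 : 1 <= 2 :> R by rewrite ler1n.
have ki2 : kappa^-1 <= 2 by apply: le_trans (ltW ki) k12.
have wc0 : 0 < wc by apply: wpos; exact: pcenter_A.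
have L0 : 0 < kappa ^+ 2 / (2 * prad c) by rewrite divr_gt0 ?exprn_gt0// mulr_gt0.
have D0 : 0 < D by rewrite /D !mulr_gt0// powR_gt0.
have h0 : 0 < kappa^-1 * prad c by rewrite mulr_gt0.
exists (W * powR e (- s)) => [|N om t Aom Ht].
  by rewrite mulr_ge0 ?powR_ge0// ltW.
set b := [pred j | _].
have [g [g' [Hg Hg' gd]]] := cube_param (pctr c) h0.
(* [f j] is the position in the unit cube of the retraction of [om j] onto the shrunk cube; points
   outside the piece get a dummy value. *)
have /choice[f Hf] : forall j, exists z, unit_cube R d z /\ (b j ->
    forall u, unit_cube R d u ->
      edist u z <= (kappa ^+ 2 / (2 * prad c)) * edist (pmap c (g u)) (om j)).
  move=> j; have [bj|nb] := boolP (b j); last first.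
    by exists 0; split => //; exact: unit_cube0.
  have /asboolP[v Hv vj] : `[< pimg c 1 (om j) >] by exact: bj.
  have [v' Hv' clv] := clamp_exists (pctr c) v (ltW h0).
  have [Qz gz] := Hg' v' Hv'; exists (g' v'); split => // _ u Qu.
  have gu := Hg u Qu; have := clv _ gu; rewrite -{1}gz gd.
  have Vu : pdom c (g u) by apply: (pdom_ccube gc ki2).
  have Vv : pdom c v by apply: (pdom_ccube gc k12).
  have := pmap_colip gc Vu Vv; rewrite vj => H1 H2.
  have {H1 H2} := le_trans H2 H1.
  move=> H; rewrite -(ler_pM2l k0) in H.
  rewrite mulrAC ler_pdivlMr ?mulr_gt0//.
  have <- : kappa * (2 * (kappa^-1 * prad c) * edist u (g' v')) =
      edist u (g' v') * (2 * prad c) by field; rewrite gt_eqF.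
  by apply: le_trans H _; rewrite mulrA -expr2.
have fQ j : unit_cube R d (f j) by have [] := Hf j.
pose T := {j : 'I_N | j \in b}.
have [|om' Aom' Hom'] := @fin_config R d (unit_cube R d) T (fun t => f (sval t))
  #|b| 0 (@unit_cube0 R d) (fun t => fQ _).
  by rewrite card_sig.
apply: le_trans (Pmax_ge _ _ Aom'); apply: Ppol_ge => u Qu.
have Hu := Hom' u (fun=> 1%R) s (fun _ _ => ler01).
apply: le_trans Hu; set y := pmap c (g u).
have Py : pimg c kappa^-1 y by exists (g u) => //; exact: Hg.
have [Ay xy] := pimg_A ki2 Py.
set S := (\sum_t0 _)%E.
have S0 : (0 <= S)%E by apply: sume_ge0 => z _; apply: rkernel_ge0; exact: ler01.
suff key : (Upot w s y om <= D%:E * S + (W * powR e (- s) * N%:R)%:E)%E.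
  have {key} := le_trans (le_trans Ht (Ppol_le w s om Ay)) key.
  move: S0; case: S => [r||] // _; last by rewrite leey.
  by rewrite -EFinM -EFinD !lee_fin ler_pdivrMr// mulrC; lra.
rewrite /Upot (bigID (mem b)); apply: leeD.
  rewrite /S ge0_sume_distrr; last first.
    by move=> z _; apply: rkernel_ge0; exact: ler01.
  rewrite big_sub; apply: lee_sum => -[j bj] _ /=; have [_ /(_ bj u Qu) H] := Hf j.
  apply: (rkernel_le (ltW s0) L0 _ H); first exact: wge0.
  rewrite /D ler_wpM2r ?powR_ge0//.
  have /asboolP Pj : `[< pimg c 1 (om j) >] by exact: bj.
  have [Aj xj] := pimg_A k12 Pj.
  by apply: Hrad => //; exact: pcenter_A.
apply: (@le_trans _ _ (\sum_(j < N | j \notin b) (W * powR e (- s))%:E)%E).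
  apply: lee_sum => j nb; have Pj : ~ pimg c 1 (om j).
    by move=> /asboolP Pj; move/negP: nb; apply.
  have ej := He y (om j) Py (Aom j) Pj; rewrite rkernelE EFinM.
  apply: lee_pmul; rewrite ?lee_fin ?riesz_ge0//; [exact: wge0|exact: wW|].
  apply: (@le_trans _ _ (riesz s e)); first by apply: riesz_anti => //; exact: ltW.
  by rewrite /riesz gt_eqF.
rewrite sumEFin lee_fin sumr_const -[X in X <= _]mulr_natr.
apply: ler_wpM2l; first by rewrite mulr_ge0 ?powR_ge0// ltW.
rewrite ler_nat; apply: leq_trans (max_card _) _; by rewrite card_ord.
Qed.

(** With fewer points in the piece, [cube_upper] would keep their potential on the shrunk cube below
    what is required. In the exponent [2 + 2 * s], the part [1 + 2 * s] cancels the powers of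
    [kappa] in [D], and the remaining 1 makes the inequality strict. *)
Lemma piece_count t : 0 < t -> exists N0, forall N, (N0 <= N)%N ->
  forall omega : 'I_N -> 'rV[R]_p, configs A N omega ->
    ((t * tau s d N)%:E <= Ppol w s A omega)%E ->
    powR (t / sig) (d%:R / s) * powR wc (- (d%:R / s)) * (2 * prad c) ^+ d *
      powR kappa (- ((2 + 2 * s) * (d%:R / s))) * N%:R <=
    #|[pred j | `[< pimg c 1 (omega j) >]]|%:R.
Proof.
move=> t0; set a := powR (t / sig) _ * _ * _ * _.
have wc0 : 0 < wc by apply: wpos; exact: pcenter_A.
have h0 : 0 < 2 * prad c by rewrite mulr_gt0.
have L0 : 0 < kappa ^+ 2 / (2 * prad c) by rewrite divr_gt0 ?exprn_gt0.
have D0 : 0 < D by rewrite /D !mulr_gt0// powR_gt0.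
have ts : 0 < t / sig by rewrite divr_gt0.
have a0 : 0 < a by rewrite /a !mulr_gt0 ?powR_gt0// exprn_gt0.
have dsq : d%:R / s * (s / d%:R) = 1.
  by rewrite mulrA mulfVK ?gt_eqF// mulfV ?gt_eqF.
have aq : D * sig * powR a (s / d%:R) = t * kappa^-1.
  rewrite /a !powRM ?mulr_ge0 ?powR_ge0 ?exprn_ge0 ?(ltW h0) ?invr_ge0 ?(ltW t0) ?(ltW sig0)//.
  rewrite -!powRrM dsq !powRr1 ?invr_ge0 ?(ltW t0) ?(ltW sig0)// mulNr dsq powRN powRr1 ?(ltW wc0)//.
  have -> : - ((2 + 2 * s) * (d%:R / s)) * (s / d%:R) = - (2 + 2 * s).
    by rewrite mulNr -mulrA dsq mulr1.
  have -> : powR ((2 * prad c) ^+ d) (s / d%:R) = powR (2 * prad c) s.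
    rewrite -powR_mulrn ?(ltW h0)// -powRrM mulrCA mulfV ?mulr1// gt_eqF//.
  rewrite /D powRM ?exprn_ge0 ?invr_ge0 ?(ltW k0) ?(ltW h0)// powR_inv// powRN.
  rewrite powRN powRD ?(gt_eqF k0) ?implybT// powR_mulrn ?(ltW k0)//.
  have -> : powR (kappa ^+ 2) s = powR kappa (2 * s).
    by rewrite -powR_mulrn ?(ltW k0)// -powRrM.
  have P1 : powR kappa (2 * s) != 0 by rewrite gt_eqF// powR_gt0.
  have P2 : powR (2 * prad c) s != 0 by rewrite gt_eqF// powR_gt0.
  by field; rewrite P1 P2 !gt_eqF.
have at_ : D * sig * powR a (s / d%:R) < t by rewrite aq gtr_pMr// invf_lt1.
set Q := powR a (s / d%:R) in at_.
have Q0 : 0 < Q by exact: powR_gt0.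
have DQ : 0 < D * Q by exact: mulr_gt0.
have tD : 0 < t - D * sig * Q by rewrite subr_gt0.
(* Half of the gap [t - D * sig * Q] absorbs the error [e] of [cube_upper]; the other half beats the
   terms of order [N] once [tau] is at least [K * N]. *)
pose e := (t - D * sig * Q) / (2 * (D * Q)).
have e0 : 0 < e by apply: divr_gt0 => //; rewrite mulr_gt0.
have eE : e * (D * Q) = (t - D * sig * Q) / 2.
  by rewrite /e; field; rewrite !gt_eqF.
have [C C0 HC] := piece_potential.
have [_ [cu _]] := cube_asymp d0 ds; have [C' C'0 HC'] := cu e e0.
pose K := (C + D * C' + 1) / ((t - D * sig * Q) / 2).
have [N0 HN0] := tau_dominates s d0 K.
exists N0.+1 => N NN om Aom Hom; rewrite leNgt; apply/negP => lt.
have N0' : (0 < N)%N by exact: leq_ltn_trans NN.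
have NR : 0 < N%:R :> R by rewrite ltr0n.
have := HC _ _ _ Aom Hom; set n := #|_| in lt *.
have nN : (n <= N)%N by rewrite -[leqRHS]card_ord; exact: max_card.
move/le_trans => /(_ _ (HC' n N nN N0')); rewrite lee_fin ler_pdivrMr// => H.
have T0 := tau_ge0 d s N; have HT := HN0 N (ltnW NN).
set T := tau s d N in H T0 HT.
have nq : powR (n%:R / N%:R) (s / d%:R) <= Q.
  apply: ge0_ler_powR; rewrite ?nnegrE ?(ltW q0) ?(ltW a0) ?divr_ge0//.
  by rewrite ler_pdivrMr// ltW.
have se : 0 < sigma_sd s d + e by apply: addr_gt0.
have H1 : (sigma_sd s d + e) * powR (n%:R / N%:R) (s / d%:R) * T * D <=
    (sig + e) * Q * T * D.
  by rewrite ler_pM2r// ler_wpM2r// ler_pM2l.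
have H2 : (sig + e) * Q * T * D = (D * sig * Q + e * (D * Q)) * T by ring.
have KE : K * ((t - D * sig * Q) / 2) = C + D * C' + 1.
  by rewrite /K mulfVK// gt_eqF// divr_gt0.
have dt : 0 < (t - D * sig * Q) / 2 by rewrite divr_gt0.
have H3 : (C + D * C' + 1) * N%:R <= (t - D * sig * Q) / 2 * T.
  by rewrite -KE mulrAC mulrC ler_pM2l.
rewrite eE in H2; rewrite H2 in H1.
have H4 : C' * N%:R * D = D * C' * N%:R by ring.
have : t * T - C * N%:R <= (D * sig * Q + (t - D * sig * Q) / 2) * T + D * C' * N%:R.
  apply: le_trans H _; rewrite mulrDl H4; exact: lerD.
have -> : (D * sig * Q + (t - D * sig * Q) / 2) * T = t * T - (t - D * sig * Q) / 2 * T.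
  by field.
move: H3; rewrite !mulrDl mul1r; lra.
Qed.

End PieceCount.

(** * Comparison with integrals *)

Section PieceIntegrals.
Variables (R : realType) (p d : nat).
Variables (A M : set 'rV[R]_p) (mu : {measure set (borelRp R p) -> \bar R}).
Hypotheses (d0 : (0 < d)%N) (CM : C1_submanifold d M) (cA : compact A) (AM : A `<=` M).
Hypothesis muE : forall B : set (borelRp R p), measurable B -> mu B = Hd d B.

(** Superlevel sets of a function continuous on [A] are traces on [A] of open sets. *)
Lemma measurable_within (g : 'rV[R]_p -> R) : {within A, continuous g} ->
  measurable_fun (A : set (borelRp R p)) g.
Proof.
move=> cg; apply: (measurability _ (RGenOInfty.measurableE R)) => //.
move=> _ [_ [a ->] <-].
have /choice[r Hr] : forall x, exists r : R, A x -> a < g x ->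
    0 < r /\ forall y, A y -> edist x y < r -> a < g y.
  move=> x; have [Ax|nA] := pselect (A x); last by exists 0.
  have [ax|nx] := ltP a (g x); last by exists 0.
  have [|r r0 H] := within_edist cg Ax (_ : 0 < g x - a); first by rewrite subr_gt0.
  exists r => _ _; split => // y Ay /(H y Ay); rewrite ltr_norml => /andP[]; lra.
pose O := \bigcup_(x in [set x | A x /\ a < g x]) eball x (r x).
have oO : open O by apply: bigcup_open => x _; exact: open_eball.
have -> : A `&` g @^-1` `]a, +oo[%classic = A `&` O.
  apply/seteqP; split => y [Ay].
    rewrite /= in_itv/= andbT => ay; split => //; exists y => //.
    by have [r0 _] := Hr y Ay ay; rewrite /eball/= edistxx.
  move=> [x [Ax ax] xy]; split => //=; rewrite in_itv/= andbT.
  by have [_ H] := Hr x Ax ax; exact: H.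
exact: measurable_compactI.
Qed.

Lemma integral_pieces_le kappa rad G (g : 'rV[R]_p -> R) (al : piece R p d -> R)
    (l : seq (piece R p d)) (B : set (borelRp R p)) : 1 < kappa ->
  measurable B -> measurable_fun B g -> (forall y, B y -> 0 <= g y) ->
  pall (good_piece M kappa rad G) l -> pdisj l -> pcover l `<=` B ->
  pall (fun c => forall y, pimg c 1 y -> al c <= g y) l ->
  (forall c, 0 <= al c) ->
  (\sum_(c <- l) (al c)%:E * mu (pimg c 1) <= \int[mu]_(x in B) (g x)%:E)%E.
Proof.
move=> k1 + + + + + + + al0; elim: l B => [|c l IH] B mB mg g0 /=.
  by move=> *; rewrite big_nil; apply: integral_ge0 => x /g0; rewrite lee_fin.
move=> [gc gl] [cl dl] lB [ac al_].
have mc : measurable (pimg c 1 : set (borelRp R p)).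
  by apply: compact_measurable_borel; apply: (compact_pimg k1 gc); rewrite ler1n.
have cB : pimg c 1 `<=` B by move=> y cy; apply: lB; left.
have mBc : measurable (B `\` pimg c 1 : set (borelRp R p)) by exact: measurableD.
have lBc : pcover l `<=` B `\` pimg c 1.
  move=> y ly; split; first by apply: lB; right.
  by move=> cy; have : (pimg c 1 `&` pcover l) y by []; rewrite cl.
have mg' : measurable_fun B (EFin \o g) by exact/measurable_EFinP.
have BE : B = pimg c 1 `|` (B `\` pimg c 1) by rewrite setUDr setDv setD0; apply/esym/setUidr.
have -> : (\int[mu]_(x in B) (g x)%:E =
    \int[mu]_(x in pimg c 1) (g x)%:E + \int[mu]_(x in B `\` pimg c 1) (g x)%:E)%E.
  rewrite {1}BE ge0_integral_setU//.
  - by rewrite -BE.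
  - by move=> x; rewrite -BE => /g0; rewrite lee_fin.
  - by apply/disj_setPS => y [cy []].
rewrite big_cons; apply: leeD.
  rewrite -integral_cst//; apply: ge0_le_integral => //.
  - by move=> x _; rewrite lee_fin.
  - by apply: measurable_funS mg'.
apply: IH => //; first by apply: measurable_funS mg.
by move=> y [/g0].
Qed.

Lemma integral_le_pieces kappa rad G (g : 'rV[R]_p -> R) (al : piece R p d -> R)
    (l : seq (piece R p d)) (B : set (borelRp R p)) (K : R) : 1 < kappa ->
  measurable B -> measurable_fun B g -> (forall y, B y -> 0 <= g y <= K) ->
  pall (good_piece M kappa rad G) l -> pdisj l -> pcover l `<=` B ->
  pall (fun c => forall y, pimg c 1 y -> g y <= al c) l ->
  (\int[mu]_(x in B) (g x)%:E <=
    \sum_(c <- l) (al c)%:E * mu (pimg c 1) + K%:E * mu (B `\` pcover l))%E.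
Proof.
move=> k1; elim: l B => [|c l IH] B mB mg g0 /=.
  move=> *; rewrite big_nil add0e setD0 -integral_cst//. apply: ge0_le_integral => //.
  - by move=> x /g0/andP[? _]; rewrite lee_fin.
  - exact/measurable_EFinP.
  - by move=> x /g0/andP[_ ?]; rewrite lee_fin.
move=> [gc gl] [cl dl] lB [ac al_].
have mc : measurable (pimg c 1 : set (borelRp R p)).
  by apply: compact_measurable_borel; apply: (compact_pimg k1 gc); rewrite ler1n.
have cB : pimg c 1 `<=` B by move=> y cy; apply: lB; left.
have mBc : measurable (B `\` pimg c 1 : set (borelRp R p)) by exact: measurableD.
have lBc : pcover l `<=` B `\` pimg c 1.
  move=> y ly; split; first by apply: lB; right.
  by move=> cy; have : (pimg c 1 `&` pcover l) y by []; rewrite cl.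
have mg' : measurable_fun B (EFin \o g) by exact/measurable_EFinP.
have BE : B = pimg c 1 `|` (B `\` pimg c 1) by rewrite setUDr setDv setD0; apply/esym/setUidr.
have -> : (\int[mu]_(x in B) (g x)%:E =
    \int[mu]_(x in pimg c 1) (g x)%:E + \int[mu]_(x in B `\` pimg c 1) (g x)%:E)%E.
  rewrite {1}BE ge0_integral_setU//.
  - by rewrite -BE.
  - by move=> x; rewrite -BE => /g0/andP[? _]; rewrite lee_fin.
  - by apply/disj_setPS => y [cy []].
rewrite big_cons -[leRHS]addeA; apply: leeD.
  rewrite -integral_cst//; apply: ge0_le_integral => //.
  - by move=> x /cB/g0/andP[? _]; rewrite lee_fin.
  - by apply: measurable_funS mg'.
rewrite -setDDl; apply: IH => //; first by apply: measurable_funS mg.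
by move=> y [/g0].
Qed.

Lemma integral_bounded_fin (g : 'rV[R]_p -> R) K :
  measurable_fun (A : set (borelRp R p)) g -> (forall y, A y -> 0 <= g y <= K) ->
  (\int[mu]_(x in (A : set (borelRp R p))) (g x)%:E)%E =
  (fine (\int[mu]_(x in (A : set (borelRp R p))) (g x)%:E)%E)%:E.
Proof.
move=> mg g0; rewrite fineK// ge0_fin_numE; last first.
  by apply: integral_ge0 => x /g0/andP[? _]; rewrite lee_fin.
have mA : measurable (A : set (borelRp R p)) by exact: compact_measurable_borel.
have H : (\int[mu]_(x in (A : set (borelRp R p))) (g x)%:E <= K%:E * mu A)%E.
  rewrite -integral_cst//; apply: ge0_le_integral => //.
  - by move=> x /g0/andP[? _]; rewrite lee_fin.
  - exact/measurable_EFinP.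
  - by move=> x /g0/andP[_ ?]; rewrite lee_fin.
apply: le_lt_trans H _; rewrite -(@fineK _ (mu A)) -?EFinM ?ltry//.
by rewrite ge0_fin_numE ?measure_ge0//; exact: (mu_fin d0 CM cA AM muE).
Qed.

End PieceIntegrals.

Section PieceSums.
Variables (R : realType) (p d : nat).

Lemma pall_sum_le (F G : piece R p d -> R) l :
  pall (fun c => F c <= G c) l -> \sum_(c <- l) F c <= \sum_(c <- l) G c.
Proof.
by elim: l => [|c l IH] /=; rewrite ?big_nil// !big_cons => -[? /IH ?]; exact: lerD.
Qed.

Lemma pall_esum_le (F G : piece R p d -> \bar R) l :
  pall (fun c => (F c <= G c)%E) l -> (\sum_(c <- l) F c <= \sum_(c <- l) G c)%E.
Proof.
by elim: l => [|c l IH] /=; rewrite ?big_nil// !big_cons => -[? /IH ?]; exact: leeD.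
Qed.

Lemma powR_anti (a b r : R) : 0 < a -> a <= b -> 0 <= r -> powR b (- r) <= powR a (- r).
Proof.
move=> a0 ab r0; have b0 : 0 < b by exact: lt_le_trans ab.
by rewrite !powRN lef_pV2 ?posrE ?powR_gt0// ge0_ler_powR ?nnegrE// ltW.
Qed.

Lemma powR_near1_le2 (E e : R) : 0 < E -> 0 < e ->
  exists k, [/\ 1 < k, k <= 2 & powR k E <= 1 + e].
Proof.
move=> E0 e0; have [k k1 kE] := powR_near1 E0 e0.
exists (Num.min k 2); split; first by rewrite lt_min k1 ltr1n.
  by rewrite ge_min lexx orbT.
rewrite -kE; apply: ge0_ler_powR; rewrite ?nnegrE ?le_min ?ge_min ?lexx//.
- exact: ltW.
- by rewrite ler0n andbT; lra.
- lra.
Qed.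

End PieceSums.

(** * The weighted measure of the pieces *)

Section WeightedBounds.
Variables (R : realType) (p d : nat) (s : R) (A M : set 'rV[R]_p).
Variables (w : 'rV[R]_p * 'rV[R]_p -> R) (mu : {measure set (borelRp R p) -> \bar R}).
Variable a0 : 'rV[R]_p.
Hypotheses (d0 : (0 < d)%N) (ds : d%:R <= s) (Aa0 : A a0).
Hypotheses (CM : C1_submanifold d M) (cA : compact A) (AM : A `<=` M).
Hypothesis bd : Hd d (relbdry M A) = 0%E.
Hypothesis cw : {within A `*` A, continuous w}.
Hypothesis wge0 : forall x y, A x -> A y -> 0 <= w (x, y).
Hypothesis wpos : forall x, A x -> 0 < w (x, x).
Hypothesis muE : forall B : set (borelRp R p), measurable B -> mu B = Hd d B.

Let sig := sigma_sd s d.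
Let dR0 : 0 < d%:R :> R. Proof. by rewrite ltr0n. Qed.
Let s0 : 0 < s. Proof. exact: lt_le_trans ds. Qed.
Let r0 : 0 < d%:R / s. Proof. exact: divr_gt0. Qed.
Let sig0 : 0 < sig. Proof. by have [] := cube_asymp d0 ds. Qed.
Let mA : measurable (A : set (borelRp R p)). Proof. exact: compact_measurable_borel. Qed.

Definition wdens (x : 'rV[R]_p) : R := powR (w (x, x)) (- (d%:R / s)).

(** The weighted measure of a good piece up to a power of [kappa]: volume of the cube times the
    density at the centre. *)
Definition pweight (c : piece R p d) : R := (2 * prad c) ^+ d * wdens (pcenter c).

Lemma wdens_bounded : exists2 V, 0 < V & forall x, A x -> 0 < wdens x <= V.
Proof.
have [w0 [del [w00 del0 H]]] := weight_near_diag cA cw wpos.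
exists (powR w0 (- (d%:R / s))); first exact: powR_gt0.
move=> x Ax; rewrite powR_gt0 ?wpos//=; apply: powR_anti => //; last exact: ltW.
by apply: H => //; rewrite edistxx.
Qed.

Lemma measurable_wdens : measurable_fun (A : set (borelRp R p)) wdens.
Proof.
apply: (measurableT_comp (measurable_powR _)).
by apply: measurable_within => //; exact: within_diag.
Qed.

Let H : R := fine (\int[mu]_(x in (A : set (borelRp R p))) (wdens x)%:E)%E.

Lemma wdens_integral :
  (\int[mu]_(x in (A : set (borelRp R p))) (wdens x)%:E)%E = H%:E.
Proof.
have [V V0 HV] := wdens_bounded.
apply: (@integral_bounded_fin R p d A M mu d0 CM cA AM muE _ V measurable_wdens).
by move=> y /HV/andP[/ltW-> ->].
Qed.

Lemma wdens_integral_ge0 : 0 <= H.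
Proof.
by apply: fine_ge0; apply: integral_ge0 => x _; rewrite lee_fin; exact: powR_ge0.
Qed.

Lemma radius_exists kappa (f : 'rV[R]_p -> R) e : 1 < kappa -> 0 < e ->
  {within A, continuous f} -> exists rad : 'rV[R]_p -> R, [/\
    forall x, A x -> 0 < rad x,
    forall x y y', A x -> A y -> A y' -> edist x y < rad x -> edist x y' < rad x ->
      w (x, x) <= kappa * w (y, y'),
    forall x y y', A x -> A y -> A y' -> edist x y < rad x -> edist x y' < rad x ->
      w (y, y') <= kappa * w (x, x) &
    forall x y, A x -> A y -> edist x y < rad x -> `|f y - f x| < e].
Proof.
move=> k1 e0 cf.
have /choice[r Hr] : forall x, exists r : R, A x -> [/\ 0 < r,
    forall y y', A y -> A y' -> edist x y < r -> edist x y' < r ->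
      w (x, x) <= kappa * w (y, y') /\ w (y, y') <= kappa * w (x, x) &
    forall y, A y -> edist x y < r -> `|f y - f x| < e].
  move=> x; have [Ax|nA] := pselect (A x); last by exists 0.
  have [r1 r10 H1] := within_ratio cw Ax (wpos Ax) k1.
  have [r2 r20 H2] := within_edist cf Ax e0.
  exists (Num.min r1 r2) => _; split; first by rewrite lt_min r10.
    by move=> y y' Ay Ay'; rewrite !lt_min => /andP[? _] /andP[? _]; exact: H1.
  by move=> y Ay; rewrite lt_min => /andP[_ ?]; exact: H2.
exists r; split.
- by move=> x /Hr[].
- by move=> x y y' /Hr[_ + _] Ay Ay' xy xy' => /(_ y y' Ay Ay' xy xy')[].
- by move=> x y y' /Hr[_ + _] Ay Ay' xy xy' => /(_ y y' Ay Ay' xy xy')[].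
- by move=> x y /Hr[_ _]; exact.
Qed.

Section Pieces.
Variables (kappa : R) (rad : 'rV[R]_p -> R) (l : seq (piece R p d)).
Hypotheses (k1 : 1 < kappa) (k2 : kappa <= 2).
Hypothesis HradL : forall x y y', A x -> A y -> A y' ->
  edist x y < rad x -> edist x y' < rad x -> w (x, x) <= kappa * w (y, y').
Hypothesis HradU : forall x y y', A x -> A y -> A y' ->
  edist x y < rad x -> edist x y' < rad x -> w (y, y') <= kappa * w (x, x).
Hypotheses (gl : pall (good_piece M kappa rad A) l) (dl : pdisj l).

Let k0 : 0 < kappa. Proof. exact: lt_trans k1. Qed.

(** The exponent of [kappa] lost between [pweight] and the integral: [d] for the distortion of [Hd]
    by the chart, [d / s] for the oscillation of [w] on the piece. *)
Let E1 := d%:R + d%:R / s.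

Let kE : powR kappa E1 = kappa ^+ d * powR kappa (d%:R / s).
Proof. by rewrite powRD ?(gt_eqF k0) ?implybT// powR_mulrn// ltW. Qed.

Let piece_A (c : piece R p d) : good_piece M kappa rad A c -> A (pcenter c) /\
  forall y, pimg c 1 y -> A y /\ edist (pcenter c) y < rad (pcenter c).
Proof.
move=> gc; split; first exact: pcenter_A gc.
by move=> y /(pimg_A gc (ler1n _ 2)).
Qed.

Lemma pweight_ge0 c : good_piece M kappa rad A c -> 0 <= pweight c.
Proof.
by move=> [_ c0 _ _]; rewrite mulr_ge0 ?powR_ge0// exprn_ge0// mulr_ge0// ltW.
Qed.

Lemma pweight_sum : \sum_(c <- l) pweight c <= powR kappa E1 * H.
Proof.
pose al (c : piece R p d) := powR kappa (- (d%:R / s)) * wdens (pcenter c).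
have := integral_pieces_le (al := al) mu k1 mA measurable_wdens
  (fun y _ => powR_ge0 _ _) gl dl (good_pcover_sub gl).
rewrite wdens_integral => HI.
have {}HI : (\sum_(c <- l) (al c)%:E * mu (pimg c 1) <= H%:E)%E.
  apply: HI => [|c]; last by rewrite mulr_ge0 ?powR_ge0.
  apply: pall_impl gl => c gc y cy; have [Ac Hc] := piece_A gc.
  have [Ay xy] := Hc y cy; rewrite /al /wdens -powRM ?(ltW k0)// ?(ltW (wpos Ac))//.
  apply: powR_anti; [exact: wpos|exact: HradU|exact: ltW].
have HS : ((powR kappa (- E1) * \sum_(c <- l) pweight c)%:E <= H%:E)%E.
  apply: le_trans HI; rewrite mulr_sumr -sumEFin; apply: pall_esum_le.
  apply: pall_impl gl => c gc; have [Ac _] := piece_A gc.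
  have [_ Hm] := Hd_pimg k1 gc d0.
  have mc : measurable (pimg c 1 : set (borelRp R p)).
    by apply: compact_measurable_borel; apply: (compact_pimg k1 gc); rewrite ler1n.
  apply: (@le_trans _ _ ((al c)%:E * ((kappa^-1 * (2 * prad c)) ^+ d)%:E)%E); last first.
    apply: lee_wpmul2l; first by rewrite lee_fin mulr_ge0 ?powR_ge0.
    by rewrite muE.
  rewrite -EFinM lee_fin /al /pweight [(kappa^-1 * _) ^+ d]exprMn exprVn !powRN kE invfM.
  by rewrite le_eqVlt; apply/orP; left; apply/eqP; ring.
move: HS; rewrite lee_fin powRN ler_pdivrMl ?powR_gt0//.
Qed.

(** On a piece, [f] is at most its lower value [max 0 (f (pcenter c) - e0)] plus [2 * e0]. The lower
    value is the one by which the points in the piece are weighted in [average_lower]; [G * e]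
    covers what the pieces miss. *)
Lemma integral_le_pweight (f : 'rV[R]_p -> R) F G e e0 :
  0 <= e0 -> {within A, continuous f} -> (forall x, A x -> 0 <= f x) ->
  (forall x, A x -> f x * wdens x <= G) ->
  (forall x y, A x -> A y -> edist x y < rad x -> `|f y - f x| < e0) ->
  (mu (A `\` pcover l) <= e%:E)%E ->
  ((\int[mu]_(x in (A : set (borelRp R p))) (f x * wdens x)%:E)%E = F%:E) ->
  F <= powR kappa E1 *
    (\sum_(c <- l) (Num.max 0 (f (pcenter c) - e0) + 2 * e0) * pweight c) + G * e.
Proof.
move=> e00 cf f0 fG Hrad me FE.
have mg : measurable_fun (A : set (borelRp R p)) (fun x => f x * wdens x).
  by apply: measurable_funM; [exact: measurable_within|exact: measurable_wdens].
pose fc (c : piece R p d) := Num.max 0 (f (pcenter c) - e0) + 2 * e0.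
have fc0 c : 0 <= fc c.
  by rewrite /fc addr_ge0 ?mulr_ge0// le_max lexx.
pose al (c : piece R p d) := fc c * (powR kappa (d%:R / s) * wdens (pcenter c)).
have G0 : 0 <= G.
  by apply: le_trans (fG _ Aa0); rewrite mulr_ge0 ?powR_ge0// f0.
have HB y : A y -> 0 <= f y * wdens y <= G.
  by move=> Ay; rewrite fG// mulr_ge0 ?powR_ge0// f0.
have := integral_le_pieces (al := al) mu k1 mA mg HB gl dl (good_pcover_sub gl).
rewrite FE => HI.
have {}HI : (F%:E <= \sum_(c <- l) (al c)%:E * mu (pimg c 1) + G%:E * mu (A `\` pcover l))%E.
  apply: HI; apply: pall_impl gl => c gc y cy; have [Ac Hc] := piece_A gc.
  have [Ay xy] := Hc y cy.
  apply: ler_pM; rewrite ?f0 ?powR_ge0//.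
    have := Hrad _ _ Ac Ay xy; rewrite ltr_norml => /andP[_ fy].
    have : f (pcenter c) - e0 <= Num.max 0 (f (pcenter c) - e0) by rewrite le_max lexx orbT.
    by rewrite /fc; lra.
  have := HradL Ac Ay Ay xy xy => wy.
  have -> : powR kappa (d%:R / s) * wdens (pcenter c) =
      powR (kappa^-1 * w (pcenter c, pcenter c)) (- (d%:R / s)).
    rewrite powRM ?invr_ge0 ?(ltW k0) ?(ltW (wpos Ac))//.
    by rewrite powR_inv// opprK.
  apply: powR_anti; [by rewrite mulr_gt0 ?invr_gt0// wpos| |exact: ltW].
  by rewrite ler_pdivrMl.
rewrite -lee_fin EFinD; apply: le_trans HI _; apply: leeD; last first.
  by rewrite EFinM; apply: lee_wpmul2l.
rewrite mulr_sumr -sumEFin; apply: pall_esum_le; apply: pall_impl gl => c gc.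
have [_ c0 _ _] := gc; have [Hm _] := Hd_pimg k1 gc d0.
have mc : measurable (pimg c 1 : set (borelRp R p)).
  by apply: compact_measurable_borel; apply: (compact_pimg k1 gc); rewrite ler1n.
apply: (@le_trans _ _ ((al c)%:E * ((kappa * (2 * prad c)) ^+ d)%:E)%E).
  apply: lee_wpmul2l; last by rewrite muE.
  by rewrite lee_fin !mulr_ge0// powR_ge0.
rewrite -EFinM lee_fin /al /pweight [(kappa * _) ^+ d]exprMn kE -/(fc c).
by rewrite le_eqVlt; apply/orP; left; apply/eqP; ring.
Qed.

End Pieces.
End WeightedBounds.

(** * Lower bound for the polarization and lower bound for averages *)

Section PolarizationBounds.
Variables (R : realType) (p d : nat) (s : R) (A M : set 'rV[R]_p).
Variables (w : 'rV[R]_p * 'rV[R]_p -> R) (mu : {measure set (borelRp R p) -> \bar R}).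
Variable a0 : 'rV[R]_p.
Hypotheses (d0 : (0 < d)%N) (ds : d%:R <= s) (Aa0 : A a0).
Hypotheses (CM : C1_submanifold d M) (cA : compact A) (AM : A `<=` M).
Hypothesis bd : Hd d (relbdry M A) = 0%E.
Hypothesis cw : {within A `*` A, continuous w}.
Hypothesis wge0 : forall x y, A x -> A y -> 0 <= w (x, y).
Hypothesis wpos : forall x, A x -> 0 < w (x, x).
Hypothesis muE : forall B : set (borelRp R p), measurable B -> mu B = Hd d B.

Let sig := sigma_sd s d.
Let dR0 : 0 < d%:R :> R. Proof. by rewrite ltr0n. Qed.
Let s0 : 0 < s. Proof. exact: lt_le_trans ds. Qed.
Let r0 : 0 < d%:R / s. Proof. exact: divr_gt0. Qed.
Let sig0 : 0 < sig. Proof. by have [] := cube_asymp d0 ds. Qed.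
Let mA : measurable (A : set (borelRp R p)). Proof. exact: compact_measurable_borel. Qed.
Let H : R := fine (\int[mu]_(x in (A : set (borelRp R p))) (wdens d s w x)%:E)%E.
Let H0 : 0 <= H. Proof. exact: wdens_integral_ge0. Qed.
Let E1 := d%:R + d%:R / s.
Let E10 : 0 < E1. Proof. by rewrite addr_gt0. Qed.

Let mu_Hd kappa rad (l : seq (piece R p d)) e : 1 < kappa ->
  pall (good_piece M kappa rad A) l ->
  (mu (A `\` pcover l) <= e%:E)%E -> (Hd d (A `\` pcover l) <= e%:E)%E.
Proof.
move=> k1 gl; rewrite muE//; apply: measurableD => //.
by apply: compact_measurable_borel; exact: measurable_pcover gl.
Qed.

Lemma Pmax_lower lam : H < lam -> exists n0, forall n, (n0 <= n)%N ->
  ((sig * powR lam (- (s / d%:R)) * tau s d n)%:E <= Pmax w s A n)%E.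
Proof.
move=> Hl; have [w0 [del [w00 del0 wdiag]]] := weight_near_diag cA cw wpos.
pose C : R := 16 ^+ d * powR w0 (- (d%:R / s)).
have C0 : 0 <= C by rewrite mulr_ge0 ?powR_ge0// exprn_ge0.
have [_ h0] := hraw_cubeE R d0; set c0 := fine (hraw d (unit_cube R d)) in h0.
pose x := lam - H; have x0 : 0 < x by rewrite subr_gt0.
have H1 : 0 < H + 1 by rewrite ltr_wpDl.
have Cc : 0 <= C * c0 by rewrite mulr_ge0// ltW.
have Cc1 : 0 < C * c0 + 1 by rewrite ltr_wpDl.
(* The gap [x] is shared out: [e * H] costs at most [x / 2], and the uncovered part of [A], with
   constant [C * c0 * 2 * e'], at most [x / 4]. *)
pose e := x / (2 * (H + 1)); have e0 : 0 < e by rewrite divr_gt0// mulr_gt0.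
have eE : e * (H + 1) = x / 2 by rewrite /e; field; rewrite gt_eqF.
pose e' := x / (8 * (C * c0 + 1)); have e'0 : 0 < e' by rewrite divr_gt0// mulr_gt0.
have e'E : e' * (C * c0 + 1) = x / 8 by rewrite /e'; field; rewrite gt_eqF.
(* [2 * d + d / s] is the exponent of [kappa] lost in [cov_piece], [E1] the one lost in
   [pweight_sum]. *)
have Et0 : 0 < 2 * d%:R + d%:R / s + E1 by rewrite !addr_gt0// mulr_gt0.
have [k [k1 k2 kE]] := powR_near1_le2 Et0 e0.
have k0 : 0 < k by apply: lt_trans k1.
have cst0 : {within A, continuous (fun=> 0 : R)}.
  by apply: continuous_subspaceT => z; exact: cst_continuous.
have [rad [rad0 HL HU _]] := radius_exists cw wpos k1 ltr01 cst0.
have [l [gl dl Hl']] := vitali_cover d0 CM cA AM muE bd k1 k2 rad0 e'0.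
have := cov_total d0 ds Aa0 wge0 CM cA AM w00 del0 wdiag k1 k2 wpos HL gl e'0
  (mu_Hd k1 gl Hl').
set S := \sum_(c <- l) _; rewrite -/C -/c0 => -[_ _ cov].
have SE : S <= powR k (2 * d%:R + d%:R / s) * \sum_(c <- l) pweight s w c.
  rewrite mulr_sumr; apply: pall_sum_le; apply: pall_impl gl => c gc.
  have Ac := pcenter_A gc.
  rewrite powRM ?invr_ge0 ?(ltW k0) ?(ltW (wpos Ac))// powR_inv// opprK.
  rewrite [(k ^+ 2 * _) ^+ d]exprMn powRD ?(gt_eqF k0) ?implybT//.
  have -> : powR k (2 * d%:R) = k ^+ 2 ^+ d.
    by rewrite -exprM -powR_mulrn ?(ltW k0)// natrM.
  by rewrite /pweight /wdens le_eqVlt; apply/orP; left; apply/eqP; ring.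
have PH := pweight_sum d0 ds CM cA AM cw wpos muE k1 HU gl dl.
rewrite -/H -/E1 in PH.
have SH : S <= (1 + e) * H.
  apply: le_trans SE _; apply: (@le_trans _ _ (powR k (2 * d%:R + d%:R / s) * (powR k E1 * H))).
    by apply: ler_wpM2l => //; exact: powR_ge0.
  rewrite mulrA -powRD ?(gt_eqF k0) ?implybT//.
  exact: ler_wpM2r.
have fin : S + C * (c0 * (2 * e')) < lam.
  have -> : C * (c0 * (2 * e')) = 2 * (e' * (C * c0 + 1)) - 2 * e' by ring.
  rewrite e'E; have : e * H <= x / 2 by rewrite -eE mulrDr mulr1 lerDl ltW.
  have : lam = H + x by rewrite /x; ring.
  by rewrite mulrDl mul1r in SH; lra.
have [n0 Hn] := cov lam fin; exists n0 => n /Hn[om Aom Hom].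
by apply: le_trans (Pmax_ge _ _ Aom); apply: Ppol_ge.
Qed.

(** The pieces are disjoint, so at most one term is nonzero. *)
Lemma pieces_le_fun (f : 'rV[R]_p -> R) (fc : piece R p d -> R) l y :
  0 <= f y -> pdisj l -> pall (fun c => pimg c 1 y -> fc c <= f y) l ->
  \sum_(c <- l) fc c * (`[< pimg c 1 y >])%R%:R <= f y.
Proof.
move=> f0; have Hno m : ~ pcover m y -> \sum_(c <- m) fc c * (`[< pimg c 1 y >])%R%:R = 0.
  elim: m => [|c m IH] /=; rewrite ?big_nil// big_cons => nc.
  rewrite IH ?addr0; last by move=> cy; apply: nc; right.
  by case: asboolP => [cy|_]; [exfalso; apply: nc; left|rewrite mulr0].
elim: l => [|c l IH] /=; rewrite ?big_nil// big_cons => -[cl dl] [fcy fl].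
case: asboolP => [cy|_]; last by rewrite mulr0 add0r; exact: IH.
rewrite mulr1 Hno ?addr0; first exact: fcy.
by move=> ly; have : (pimg c 1 `&` pcover l) y by []; rewrite cl.
Qed.

(* With [f = 1] this bounds [Pmax] from above; applied to [K + f] and [K - f] it
   gives weak convergence of optimal configurations. *)
Lemma average_lower (f : 'rV[R]_p -> R) F G t e :
  {within A, continuous f} -> (forall x, A x -> 0 <= f x) ->
  (forall x, A x -> f x * wdens d s w x <= G) ->
  ((\int[mu]_(x in (A : set (borelRp R p))) (f x * wdens d s w x)%:E)%E = F%:E) ->
  0 < t -> 0 < e ->
  exists N0, forall N, (N0 <= N)%N -> forall omega : 'I_N -> 'rV[R]_p,
    configs A N omega -> ((t * tau s d N)%:E <= Ppol w s A omega)%E ->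
    powR (t / sig) (d%:R / s) * F - e <= N%:R^-1 * \sum_(j < N) f (omega j).
Proof.
move=> cf f0 fG FE t0 e0; set T := powR _ _.
have T0 : 0 < T by rewrite powR_gt0// divr_gt0.
have F0 : 0 <= F.
  rewrite -lee_fin -FE; apply: integral_ge0 => x Ax.
  by rewrite lee_fin mulr_ge0 ?powR_ge0// f0.
have G0 : 0 <= G.
  by apply: le_trans (fG _ Aa0); rewrite mulr_ge0 ?powR_ge0// f0.
(* After division by [T], the error is split into thirds: [ek] for the powers of [kappa], [em] for
   the uncovered measure, [ef] for the oscillation of [f]. *)
pose x := e / T; have x0 : 0 < x by rewrite divr_gt0.
have xE : T * x = e by rewrite /x mulrC mulfVK// gt_eqF.
pose ek := x / (3 * (F + x)).
have Fx : 0 < F + x by rewrite ltr_wpDl.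
have ek0 : 0 < ek by rewrite divr_gt0// mulr_gt0.
have ekE : ek * (F + x) = x / 3 by rewrite /ek; field; rewrite gt_eqF.
have ek1 : ek <= 1 by rewrite ler_pdivrMr ?mulr_gt0//; lra.
have G1 : 0 < G + 1 by rewrite ltr_wpDl.
pose em := x / (3 * (G + 1)); have em0 : 0 < em by rewrite divr_gt0// mulr_gt0.
have emE : em * (G + 1) = x / 3 by rewrite /em; field; rewrite gt_eqF.
have H1 : 0 < H + 1 by rewrite ltr_wpDl.
pose ef := x / (24 * (H + 1)); have ef0 : 0 < ef by rewrite divr_gt0// mulr_gt0.
have efE : ef * (H + 1) = x / 24 by rewrite /ef; field; rewrite gt_eqF.
pose E' := (2 + 2 * s) * (d%:R / s).
have E'0 : 0 < E' by rewrite mulr_gt0// addr_gt0// mulr_gt0.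
have [k [k1 k2 kE]] := powR_near1_le2 (addr_gt0 E'0 E10) ek0.
have k0 : 0 < k by apply: lt_trans k1.
have kge1 r : 0 <= r -> 1 <= powR k r.
  move=> rr; rewrite -(powRr0 k); apply: ler_powR => //; exact: ltW.
have [rad [rad0 HL HU Hf]] := radius_exists cw wpos k1 ef0 cf.
have [l [gl dl Hl']] := vitali_cover d0 CM cA AM muE bd k1 k2 rad0 em0.
have [W W0 wW] := weight_bounded cA cw.
(* A lower bound of [f] on the piece; the truncation at 0 allows multiplying it by lower bounds for
   the counts. *)
pose fc (c : piece R p d) := Num.max 0 (f (pcenter c) - ef).
have fc0 c : 0 <= fc c by rewrite le_max lexx.
pose P := \sum_(c <- l) pweight s w c.
pose S := \sum_(c <- l) fc c * pweight s w c.
have PH := pweight_sum d0 ds CM cA AM cw wpos muE k1 HU gl dl.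
rewrite -/H -/E1 -/P in PH.
have P0 : 0 <= P.
  have := @pall_sum_le R p d (fun=> 0) (pweight s w) l; rewrite big1//; apply.
  by apply: pall_impl gl => c gc; exact: pweight_ge0 gc.
have S0 : 0 <= S.
  have := @pall_sum_le R p d (fun=> 0) (fun c => fc c * pweight s w c) l; rewrite big1//; apply.
  by apply: pall_impl gl => c gc; rewrite mulr_ge0//; exact: pweight_ge0 gc.
have := integral_le_pweight d0 ds Aa0 cA cw wpos muE k1 HL gl dl (ltW ef0) cf f0 fG Hf Hl' FE.
rewrite -/E1 => HF.
have {}HF : F <= powR k E1 * (S + 2 * ef * P) + G * em.
  apply: le_trans HF _; rewrite lerD2r; apply: ler_wpM2l; first exact: powR_ge0.
  rewrite /S /P mulr_sumr -big_split/=; apply: ler_sum => c _.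
  by rewrite mulrDl.
have [N0 HN0] : exists N0, forall N, (N0 <= N)%N -> forall omega : 'I_N -> 'rV[R]_p,
    configs A N omega -> ((t * tau s d N)%:E <= Ppol w s A omega)%E ->
    pall (fun c => T * powR k (- E') * pweight s w c * N%:R <=
      #|[pred j | `[< pimg c 1 (omega j) >]]|%:R) l.
  elim: (l) gl => [|c m IH] /=; first by exists 0%N.
  move=> [gc /IH[N1 HN1]].
  have [N2 HN2] := piece_count d0 ds wge0 wpos W0 wW AM k1 HU gc t0.
  exists (maxn N1 N2) => N; rewrite geq_max => /andP[NN1 NN2] om Aom Hom.
  split; last exact: HN1.
  apply: le_trans (HN2 N NN2 om Aom Hom); rewrite le_eqVlt; apply/orP; left; apply/eqP.
  by rewrite -/sig -/T -/E' /pweight /wdens; ring.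
exists N0.+1 => N NN om Aom Hom; have NR : 0 < N%:R :> R.
  by rewrite ltr0n; exact: leq_ltn_trans NN.
have cnt := HN0 N (ltnW NN) om Aom Hom.
have sumf : T * powR k (- E') * S * N%:R <= \sum_(j < N) f (om j).
  apply: (@le_trans _ _ (\sum_(j < N) \sum_(c <- l) fc c * (`[< pimg c 1 (om j) >])%R%:R)).
    rewrite exchange_big/= /S mulr_sumr mulr_suml; apply: pall_sum_le.
    apply: pall_impl cnt => c Hc; rewrite -mulr_sumr.
    have -> : \sum_(j < N) (`[< pimg c 1 (om j) >])%R%:R =
        #|[pred j | `[< pimg c 1 (om j) >]]|%:R :> R.
      rewrite -sum1_card natr_sum [RHS]big_mkcond/=; apply: eq_bigr => j _.
      by rewrite inE; case: asboolP.
    have := ler_wpM2l (fc0 c) Hc; apply: le_trans.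
    by rewrite le_eqVlt; apply/orP; left; apply/eqP; ring.
  apply: ler_sum => j _; apply: pieces_le_fun => //; first by apply: f0; exact: Aom.
  apply: pall_impl gl => c gc cj; have Ac := pcenter_A gc.
  have [Aj xj] := pimg_A gc (ler1n _ 2) cj.
  rewrite /fc ge_max f0//=.
  have := Hf _ _ Ac Aj xj; rewrite ltr_norml => /andP[]; lra.
have avg : T * powR k (- E') * S <= N%:R^-1 * \sum_(j < N) f (om j).
  by rewrite [leRHS]mulrC ler_pdivlMr.
apply: le_trans avg; rewrite -mulrA.
suff : F - x <= powR k (- E') * S.
  by move=> /(ler_wpM2l (ltW T0)); rewrite mulrBr xE.
set a := powR k E1 in HF PH; set b := powR k E'.
have bE : powR k (- E') = b^-1 by rewrite powRN.
have a1 : 1 <= a by apply: kge1; exact: ltW.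
have b1 : 1 <= b by apply: kge1; exact: ltW.
have b0 : 0 < b by exact: lt_le_trans b1.
have ab : b * a <= 1 + ek by rewrite /a /b -powRD ?(gt_eqF k0) ?implybT.
clear - bE a1 b1 b0 ab HF PH S0 P0 F0 G0 H0 ekE ek0 ek1 emE em0 efE ef0 x0.
have a2 : a <= 2 by nra.
have PH2 : P <= 2 * H by nra.
have efP : ef * P <= x / 12.
  by have := ler_wpM2l (ltW ef0) PH2; nra.
have efP0 : 0 <= ef * P by rewrite mulr_ge0// ltW.
have GM : G * em <= x / 3 by nra.
rewrite bE [leRHS]mulrC ler_pdivlMr//.
have bS : F - a * (2 * (ef * P)) - G * em <= a * S by lra.
have aefP : a * (2 * (ef * P)) <= x / 3 by nra.
have Q1 : ek * F <= x / 3 by nra.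
have [neg|pos] := leP (F - x) 0; first by nra.
have Q2 : (b * a) * (F - x) <= (1 + ek) * (F - x) by rewrite ler_wpM2r// ltW.
have Q3 : 0 <= ek * x by rewrite mulr_ge0// ltW.
have a0' : 0 < a by lra.
rewrite -(ler_pM2l a0'); have -> : a * ((F - x) * b) = (b * a) * (F - x) by ring.
lra.
Qed.

End PolarizationBounds.

(** * Limits *)

Section Limits.
Variables (R : realType).

Lemma ecvg_sandwich (u : nat -> \bar R) L :
  (forall a, a < L -> exists n0, forall n, (n0 <= n)%N -> (a%:E <= u n)%E) ->
  (forall b, L < b -> exists n0, forall n, (n0 <= n)%N -> (u n <= b%:E)%E) ->
  u @ \oo --> L%:E.
Proof.
move=> lo up.
have key e : 0 < e -> exists n0, forall n, (n0 <= n)%N ->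
    exists2 r, u n = r%:E & `|L - r| <= e.
  move=> e0; have [|n1 H1] := lo (L - e); first lra.
  have [|n2 H2] := up (L + e); first lra.
  exists (maxn n1 n2) => n; rewrite geq_max => /andP[/H1 + /H2].
  case: (u n) => [r||]//; rewrite ?leeNy_eq ?leye_eq// !lee_fin => L1 L2.
  by exists r => //; rewrite ler_norml; apply/andP; split; lra.
apply/fine_cvgP; split.
  by have [n0 H] := key 1 ltr01; exists n0 => // n /= /H[r ->].
apply/cvgrPdist_le => e e0; have [n0 H] := key e e0.
by exists n0 => // n /= /H[r -> ].
Qed.

End Limits.

(** * The limit and the weak convergence *)

Section Asymptotics.
Variables (R : realType) (p d : nat) (s : R) (A M : set 'rV[R]_p).
Variables (w : 'rV[R]_p * 'rV[R]_p -> R) (mu : {measure set (borelRp R p) -> \bar R}).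
Variable a0 : 'rV[R]_p.
Hypotheses (d0 : (0 < d)%N) (ds : d%:R <= s) (Aa0 : A a0).
Hypotheses (CM : C1_submanifold d M) (cA : compact A) (AM : A `<=` M).
Hypothesis bd : Hd d (relbdry M A) = 0%E.
Hypothesis cw : {within A `*` A, continuous w}.
Hypothesis wge0 : forall x y, A x -> A y -> 0 <= w (x, y).
Hypothesis wpos : forall x, A x -> 0 < w (x, x).
Hypothesis muE : forall B : set (borelRp R p), measurable B -> mu B = Hd d B.

Let sig := sigma_sd s d.
Let dR0 : 0 < d%:R :> R. Proof. by rewrite ltr0n. Qed.
Let s0 : 0 < s. Proof. exact: lt_le_trans ds. Qed.
Let r0 : 0 < d%:R / s. Proof. exact: divr_gt0. Qed.
Let q0 : 0 < s / d%:R. Proof. exact: divr_gt0. Qed.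
Let sig0 : 0 < sig. Proof. by have [] := cube_asymp d0 ds. Qed.
Let mA : measurable (A : set (borelRp R p)). Proof. exact: compact_measurable_borel. Qed.
Let H : R := fine (\int[mu]_(x in (A : set (borelRp R p))) (wdens d s w x)%:E)%E.
Let H0 : 0 <= H. Proof. exact: wdens_integral_ge0. Qed.

Let rq : d%:R / s * (s / d%:R) = 1.
Proof. by rewrite mulrA mulfVK ?gt_eqF// mulfV ?gt_eqF. Qed.

(** [Pmax_lower] for [lam = (a / sig)^(-d/s)]. Comparing [(a / sig)^(d/s) * H] with 1, instead of
    [a] with the limit, also makes sense for [H = 0]. *)
Lemma Pmax_lower_rate a : 0 < a -> powR (a / sig) (d%:R / s) * H < 1 ->
  exists n0, forall n, (n0 <= n)%N -> ((a * tau s d n)%:E <= Pmax w s A n)%E.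
Proof.
move=> a_0 aH; have as0 : 0 < a / sig by rewrite divr_gt0.
have P0 : 0 < powR (a / sig) (d%:R / s) by exact: powR_gt0.
have Hl : H < powR (a / sig) (- (d%:R / s)).
  by rewrite powRN -[ltRHS]mul1r ltr_pdivlMr// mulrC.
have [n0 Hn] := Pmax_lower d0 ds Aa0 CM cA AM bd cw wge0 wpos muE Hl.
exists n0 => n /Hn; rewrite -powRrM mulrNN rq powRr1 ?(ltW as0)//.
by rewrite mulrCA mulfV ?mulr1// gt_eqF.
Qed.

Lemma Pmax_upper_rate b : 0 < b -> 1 < powR (b / sig) (d%:R / s) * H ->
  exists n0, forall n, (n0 <= n)%N -> (Pmax w s A n <= (b * tau s d n)%:E)%E.
Proof.
move=> b0 bH; have [V V0 HV] := wdens_bounded d0 ds cA cw wpos.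
have c1 : {within A, continuous (fun=> 1 : R)}.
  by apply: continuous_subspaceT => z; exact: cst_continuous.
have fG x : A x -> 1 * wdens d s w x <= V by rewrite mul1r => /HV/andP[].
have FE : ((\int[mu]_(x in (A : set (borelRp R p))) (1 * wdens d s w x)%:E)%E = H%:E).
  rewrite -(wdens_integral d0 ds CM cA AM cw wpos muE).
  by apply: eq_integral => x _; rewrite mul1r.
(* The average of [f = 1] is 1, while a configuration exceeding the rate [b] would give it at least
   [(1 + (b / sig)^(d/s) * H) / 2 > 1]. *)
pose e := (powR (b / sig) (d%:R / s) * H - 1) / 2.
have e0 : 0 < e by rewrite divr_gt0// subr_gt0.
have [N0 HN] := average_lower d0 ds Aa0 CM cA AM bd cw wge0 wpos muE c1
  (fun _ _ => ler01) fG FE b0 e0.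
exists N0.+1 => N NN; rewrite leNgt; apply/negP => /Pmax_gt_ex[om Aom Hom].
have bP : ((b * tau s d N)%:E <= Ppol w s A om)%E.
  by apply: Ppol_ge => y Ay; exact: ltW (Hom y Ay).
have := HN N (ltnW NN) om Aom bP.
have -> : N%:R^-1 * \sum_(j < N) 1 = 1 :> R.
  rewrite sumr_const card_ord mulVf// pnatr_eq0 -lt0n; exact: leq_ltn_trans NN.
by rewrite -/sig /e; lra.
Qed.

Lemma tau_quotient_lower (u : nat -> \bar R) a :
  (exists n0, forall n, (n0 <= n)%N -> ((a * tau s d n)%:E <= u n)%E) ->
  exists n0, forall n, (n0 <= n)%N -> (a%:E <= u n * ((tau s d n)^-1)%:E)%E.
Proof.
move=> [n1 H1]; have [n2 H2] := tau_gt0_ev s d0; exists (maxn n1 n2) => n.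
rewrite geq_max => /andP[/H1 + /H2[_ t0]].
by rewrite lee_pdivlMr// -EFinM.
Qed.

Lemma tau_quotient_upper (u : nat -> \bar R) a :
  (exists n0, forall n, (n0 <= n)%N -> (u n <= (a * tau s d n)%:E)%E) ->
  exists n0, forall n, (n0 <= n)%N -> (u n * ((tau s d n)^-1)%:E <= a%:E)%E.
Proof.
move=> [n1 H1]; have [n2 H2] := tau_gt0_ev s d0; exists (maxn n1 n2) => n.
rewrite geq_max => /andP[/H1 + /H2[_ t0]].
by rewrite lee_pdivrMr// -EFinM.
Qed.

Lemma wdens_integral_gt0 : (0 < Hd d A)%E -> 0 < H.
Proof.
move=> HA; have [W W0 wW] := weight_bounded cA cw.
have WA x : A x -> powR W (- (d%:R / s)) <= wdens d s w x.
  by move=> Ax; apply: powR_anti; [exact: wpos|exact: wW|exact: ltW].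
have W1 : 0 < powR W (- (d%:R / s)) by exact: powR_gt0.
rewrite -lte_fin -(wdens_integral d0 ds CM cA AM cw wpos muE).
apply: (@lt_le_trans _ _ ((powR W (- (d%:R / s)))%:E * mu A)%E).
  by apply: mule_gt0; [rewrite lte_fin|rewrite muE].
rewrite -integral_cst//; apply: ge0_le_integral => //.
- by move=> x _; rewrite lee_fin ltW.
- by apply/measurable_EFinP; exact: measurable_wdens.
Qed.

Let L := sig / powR H (s / d%:R).

Let L_powr t : 0 < H -> 0 <= t ->
  powR (t / sig) (d%:R / s) * H = powR (t / L) (d%:R / s).
Proof.
move=> Hp t0; have ts : 0 <= t / sig by rewrite divr_ge0// ltW.
have -> : t / L = t / sig * powR H (s / d%:R).
  by rewrite /L invfM invrK mulrA.
rewrite [RHS]powRM ?powR_ge0// -powRrM [s / _ * _]mulrC rq powRr1//.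
Qed.

Let L0 : 0 < H -> 0 < L.
Proof. by move=> Hp; rewrite divr_gt0// powR_gt0. Qed.

Let below t : 0 < H -> 0 < t -> t < L -> powR (t / sig) (d%:R / s) * H < 1.
Proof.
move=> Hp t0 tL; rewrite L_powr ?(ltW t0)//.
have := @gt0_ltr_powR R _ r0 (t / L) 1; rewrite powR1 !nnegrE; apply => //.
  by rewrite divr_ge0 ?(ltW t0) ?(ltW (L0 Hp)).
by rewrite ltr_pdivrMr ?mul1r ?L0.
Qed.

Let above t : 0 < H -> L < t -> 1 < powR (t / sig) (d%:R / s) * H.
Proof.
move=> Hp tL; have t0 : 0 < t by apply: lt_trans tL; exact: L0.
rewrite L_powr ?(ltW t0)//.
have := @gt0_ltr_powR R _ r0 1 (t / L); rewrite powR1 !nnegrE; apply => //.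
  by rewrite divr_ge0 ?(ltW t0) ?(ltW (L0 Hp)).
by rewrite ltr_pdivlMr ?mul1r ?L0.
Qed.

Lemma Pmax_limit :
  (fun N : nat => (Pmax w s A N * ((tau s d N)^-1)%:E)%E) @ \oo
     --> limit_value s d H%:E.
Proof.
rewrite /limit_value eqe; have [HE|Hn] := eqVneq H 0.
  apply/cvgeyPge => X; pose a := Num.max X 1.
  have a1 : 0 < a by rewrite lt_max ltr01 orbT.
  have [|n0 Hn] := tau_quotient_lower (u := Pmax w s A) (Pmax_lower_rate a1 _).
    by rewrite HE mulr0.
  exists n0 => // n /= /Hn; apply: le_trans; rewrite lee_fin.
  by rewrite le_max lexx.
have Hp : 0 < H by rewrite lt0r Hn.
rewrite /= -/sig -/L; apply: ecvg_sandwich => [a aL|b Lb].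
  (* [a] may be nonpositive; the larger of [a] and [L / 2] is positive and still below [L]. *)
  have [n0 Hn0] : exists n0, forall n, (n0 <= n)%N ->
      ((Num.max a (L / 2))%:E <= Pmax w s A n * ((tau s d n)^-1)%:E)%E.
    apply: tau_quotient_lower; have L2 := L0 Hp.
    apply: Pmax_lower_rate; first by rewrite lt_max divr_gt0 ?orbT.
    apply: below => //; first by rewrite lt_max divr_gt0 ?orbT.
    by rewrite gt_max aL /=; lra.
  by exists n0 => n /Hn0; apply: le_trans; rewrite lee_fin le_max lexx.
apply: tau_quotient_upper; apply: Pmax_upper_rate; last exact: above.
by apply: lt_trans Lb; exact: L0.
Qed.

Section WeakLimit.
Variable omega : forall N : nat, 'I_N -> 'rV[R]_p.
Arguments omega : clear implicits.
Hypothesis Aom : forall N, configs A N (omega N).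
Hypothesis opt : (fun N : nat => fine (Ppol w s A (omega N)) / fine (Pmax w s A N)) @ \oo
  --> (1 : R).
Hypothesis Hp : 0 < H.

Lemma Ppol_optimal_lower t : 0 < t -> t < L -> exists n0, forall n, (n0 <= n)%N ->
  ((t * tau s d n)%:E <= Ppol w s A (omega n))%E.
Proof.
move=> t0 tL; pose a := (t + L) / 2.
have [ta aL] : t < a /\ a < L by rewrite /a; split; lra.
have ap : 0 < a by exact: lt_trans ta.
have [n1 H1] := Pmax_lower_rate ap (below Hp ap aL).
have L1 : L < L + 1 by lra.
have [n2 H2] := Pmax_upper_rate (lt_trans (L0 Hp) L1) (above Hp L1).
have [n3 H3] := tau_gt0_ev s d0.
have ta1 : t / a < 1 by rewrite ltr_pdivrMr// mul1r.
have e0 : 0 < 1 - t / a by rewrite subr_gt0.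
have /cvgrPdist_lt/(_ _ e0)[n4 _ H4] := opt.
exists (maxn (maxn n1 n2) (maxn n3 n4)) => n.
rewrite !geq_max => /andP[/andP[/H1 P1 /H2 P2] /andP[/H3[_ T0] /H4/=]].
move: P1 P2; case: (Pmax w s A n) => [P||]//; rewrite !lee_fin => P1 _ /= P4.
have P0 : 0 < P by apply: lt_le_trans P1; exact: mulr_gt0.
have {P4} : t / a < fine (Ppol w s A (omega n)) / P.
  by move: P4; rewrite ltr_norml => /andP[_]; lra.
rewrite ltr_pdivlMr// => P5.
have P6 : t * tau s d n <= fine (Ppol w s A (omega n)).
  apply: le_trans (ltW P5).
  have -> : t * tau s d n = t / a * (a * tau s d n) by field; rewrite gt_eqF.
  by rewrite ler_wpM2l// divr_ge0// ltW.
(* [fine] vanishes at the infinities, so positivity shows that the polarization is finite. *)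
have : 0 < fine (Ppol w s A (omega n)) by apply: lt_le_trans P6; exact: mulr_gt0.
by move: P6; case: (Ppol w s A (omega n)) => [r||]//=; rewrite ?ltxx// lee_fin.
Qed.

(** Optimal sequences eventually reach every rate [t < L]; the choice [t = L * (1 - eta)^(s/d)]
    turns the factor of [average_lower] into [(1 - eta) / H]. *)
Lemma average_optimal_lower (f : 'rV[R]_p -> R) F G e :
  {within A, continuous f} -> (forall x, A x -> 0 <= f x) ->
  (forall x, A x -> f x * wdens d s w x <= G) ->
  ((\int[mu]_(x in (A : set (borelRp R p))) (f x * wdens d s w x)%:E)%E = F%:E) ->
  0 < e -> exists N0, forall N, (N0 <= N)%N ->
    F / H - e <= N%:R^-1 * \sum_(j < N) f (omega N j).
Proof.
move=> cf f0 fG FE e0.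
have F0 : 0 <= F.
  rewrite -lee_fin -FE; apply: integral_ge0 => x Ax.
  by rewrite lee_fin mulr_ge0 ?powR_ge0// f0.
pose m := F / H; have m0 : 0 <= m by rewrite divr_ge0// ltW.
have me : 0 < 2 * (m + 1) + e by rewrite addr_gt0// mulr_gt0// ltr_wpDl.
pose eta := e / (2 * (m + 1) + e).
have eta0 : 0 < eta by exact: divr_gt0.
have etaE : eta * (2 * (m + 1) + e) = e by rewrite mulfVK// gt_eqF.
have eta1 : eta < 1 by rewrite ltr_pdivrMr// mul1r; lra.
have em : eta * m <= e / 2 by nra.
pose t := L * powR (1 - eta) (s / d%:R).
have eta1' : 0 < 1 - eta by rewrite subr_gt0.
have LL := L0 Hp.
have t0 : 0 < t by rewrite mulr_gt0// powR_gt0.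
have tL : t < L.
  rewrite gtr_pMr//; have := @gt0_ltr_powR R _ q0 (1 - eta) 1.
  by rewrite powR1 !nnegrE; apply => //; [exact: ltW|lra].
have tE : powR (t / sig) (d%:R / s) = (1 - eta) / H.
  apply: (mulIf (lt0r_neq0 Hp)); rewrite L_powr ?(ltW t0)// mulfVK ?gt_eqF//.
  have -> : t / L = powR (1 - eta) (s / d%:R) by rewrite /t mulrC mulKf// gt_eqF.
  by rewrite -powRrM [s / _ * _]mulrC rq powRr1// ltW.
have e20 : 0 < e / 2 by rewrite divr_gt0.
have [n1 H1] := Ppol_optimal_lower t0 tL.
have [n2 H2] := average_lower d0 ds Aa0 CM cA AM bd cw wge0 wpos muE cf f0 fG FE t0 e20.
exists (maxn n1 n2) => N; rewrite geq_max => /andP[/H1 P1 Nn2].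
have := H2 N Nn2 _ (@Aom N) P1; rewrite -/sig tE => HH; apply: le_trans HH.
have -> : (1 - eta) / H * F = (1 - eta) * m by rewrite /m; ring.
rewrite -/m; lra.
Qed.

Lemma average_optimal_cvg (f : 'rV[R]_p -> R) : {within A, continuous f} ->
  (fun N : nat => N%:R^-1 * \sum_(j < N) f (omega N j)) @ \oo -->
    H^-1 * Rintegral mu (A : set (borelRp R p)) (fun x => f x * wdens d s w x).
Proof.
move=> cf; have [V V0 HV] := wdens_bounded d0 ds cA cw wpos.
have [K [K0 HK]] : exists K : R, 0 < K /\ forall x, A x -> `|f x| <= K.
  have /compact_bounded[B [_ HB]] := continuous_compact cf cA.
  exists (Num.max B 0 + 1); split; first by rewrite ltr_wpDl// le_max lexx orbT.
  move=> x Ax; apply: HB; last by exists x.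
  by apply: (@le_lt_trans _ _ (Num.max B 0)); rewrite ?le_max ?lexx// ltrDl.
have mw : measurable_fun (A : set (borelRp R p)) (wdens d s w) by exact: measurable_wdens.
have mf : measurable_fun (A : set (borelRp R p)) f by exact: measurable_within.
have fin (g : 'rV[R]_p -> R) K' : measurable_fun (A : set (borelRp R p)) g ->
    (forall x, A x -> `|g x| <= K') ->
    mu.-integrable (A : set (borelRp R p)) (EFin \o (fun x => g x * wdens d s w x)).
  move=> mg gK; have mgw : measurable_fun (A : set (borelRp R p)) (fun x => g x * wdens d s w x).
    exact: measurable_funM.
  apply/integrableP; split; first exact/measurable_EFinP.
  have mn : measurable_fun (A : set (borelRp R p)) (fun x => `|g x * wdens d s w x|).
    exact: measurableT_comp.
  have -> : (\int[mu]_(x in (A : set (borelRp R p))) `|(EFin \o (fun x => (g x * wdens d s w x)%R)) x|)%E =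
      (\int[mu]_(x in (A : set (borelRp R p))) (`|g x * wdens d s w x|)%:E)%E.
    by apply: eq_integral.
  rewrite (@integral_bounded_fin R p d A M mu d0 CM cA AM muE _ (K' * V) mn) ?ltry//.
  move=> y Ay; rewrite normr_ge0 normrM ler_pM// ?gK//.
  by have /andP[v0 vV] := HV y Ay; rewrite gtr0_norm.
have intE (g : 'rV[R]_p -> R) : mu.-integrable (A : set (borelRp R p)) (EFin \o g) ->
    (\int[mu]_(x in (A : set (borelRp R p))) (g x)%:E)%E =
    (Rintegral mu (A : set (borelRp R p)) g)%:E.
  by move=> ig; rewrite /Rintegral fineK//; exact: integrable_fin_num ig.
have if_ := fin f K mf HK.
have iK : mu.-integrable (A : set (borelRp R p)) (EFin \o (fun x => K * wdens d s w x)).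
  by apply: (fin (fun=> K) K) => // x _; rewrite gtr0_norm.
have HE : Rintegral mu (A : set (borelRp R p)) (fun x => K * wdens d s w x) = K * H.
  have i1 : mu.-integrable (A : set (borelRp R p)) (EFin \o wdens d s w).
    have E1 : (fun x => 1 * wdens d s w x) = wdens d s w.
      by apply/funext => x; rewrite mul1r.
    by rewrite -E1; apply: (fin (fun=> 1) 1) => // x _; rewrite normr1.
  exact: (RintegralZl K mA i1).
set I := Rintegral _ _ _.
have plus : (\int[mu]_(x in (A : set (borelRp R p))) ((f x + K) * wdens d s w x)%:E)%E = (I + K * H)%:E.
  rewrite -HE /I -RintegralD// -intE; last first.
    have := integrableD mA if_ iK; exact: eq_integrable.
  by apply: eq_integral => x _; rewrite mulrDl.
have minus : (\int[mu]_(x in (A : set (borelRp R p))) ((K - f x) * wdens d s w x)%:E)%E = (K * H - I)%:E.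
  rewrite -HE /I -RintegralB// -intE; last first.
    have := integrableB mA iK if_; exact: eq_integrable.
  by apply: eq_integral => x _; rewrite mulrBl.
have cp : {within A, continuous (fun x => f x + K)}.
  by move=> x; apply: cvgD; [exact: cf|exact: cvg_cst].
have cm : {within A, continuous (fun x => K - f x)}.
  by move=> x; apply: cvgB; [exact: cvg_cst|exact: cf].
have fK x : A x -> - K <= f x /\ f x <= K by move=> /HK; rewrite ler_norml => /andP.
have p0 x : A x -> 0 <= f x + K by move=> /fK; lra.
have m0 x : A x -> 0 <= K - f x by move=> /fK; lra.
have pG x : A x -> (f x + K) * wdens d s w x <= 2 * K * V.
  move=> Ax; have /andP[v0 vV] := HV x Ax.
  by apply: ler_pM => //; [exact: p0|exact: ltW|have := fK x Ax; lra].
have mG x : A x -> (K - f x) * wdens d s w x <= 2 * K * V.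
  move=> Ax; have /andP[v0 vV] := HV x Ax.
  by apply: ler_pM => //; [exact: m0|exact: ltW|have := fK x Ax; lra].
apply/cvgrPdist_le => e e0.
have [n1 H1] := average_optimal_lower cp p0 pG plus e0.
have [n2 H2] := average_optimal_lower cm m0 mG minus e0.
exists (maxn n1 n2).+1 => // n /= nn; have := ltnW nn; rewrite geq_max => /andP[/H1 P1 /H2 P2].
have nR : n%:R^-1 * n%:R = 1 :> R.
  by rewrite mulVf// pnatr_eq0 -lt0n; exact: leq_ltn_trans nn.
(* The constant [K] has average [K] and weighted mean [K * H / H = K]; it cancels, and the two lower
   bounds enclose the average of [f]. *)
have KE : n%:R^-1 * \sum_(j < n) K = K.
  by rewrite sumr_const card_ord -[X in _ * X]mulr_natl mulrA nR mul1r.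
rewrite big_split/= mulrDr KE in P1; rewrite sumrB mulrBr KE in P2.
have E1 : (I + K * H) / H = H^-1 * I + K by field; rewrite gt_eqF.
have E2 : (K * H - I) / H = K - H^-1 * I by field; rewrite gt_eqF.
rewrite E1 in P1; rewrite E2 in P2.
by rewrite ler_norml; apply/andP; split; lra.
Qed.

End WeakLimit.
End Asymptotics.

Theorem theorem2 (R : realType) (p d : nat) (A : set 'rV[R]_p)
    (w : 'rV[R]_p * 'rV[R]_p -> R)
    (mu : {measure set (borelRp R p) -> \bar R}) :
  (0 < d)%N -> (d <= p)%N ->
  (exists M : set 'rV[R]_p,
      C1_submanifold d M /\ A `<=` M /\ Hd d (relbdry M A) = 0%E) ->
  compact A -> A !=set0 ->
  {within A `*` A, continuous w} ->
  (forall x y, A x -> A y -> 0 <= w (x, y)) ->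
  (forall x, A x -> 0 < w (x, x)) ->
  (* mu is H_d restricted to the Borel sets of R^p *)
  (forall B : set (borelRp R p), measurable B -> mu B = Hd d B) ->
  forall s : R, d%:R <= s ->
  let Hsw : \bar R :=
    (\int[mu]_(x in A) (powR (w (x, x)) (- (d%:R / s)))%:E)%E in
  ((fun N : nat => (Pmax w s A N * ((tau s d N)^-1)%:E)%E) @ \oo
      --> limit_value s d Hsw)
  /\
  ((0 < Hd d A)%E ->
   forall omega : forall N : nat, 'I_N -> 'rV[R]_p,
     (forall N, configs A N (omega N)) ->
     ((fun N : nat => fine (Ppol w s A (omega N)) / fine (Pmax w s A N)) @ \oo
        --> (1 : R)) ->
     forall f : 'rV[R]_p -> R, {within A, continuous f} ->
       (fun N : nat => N%:R^-1 * \sum_(j < N) f (omega N j)) @ \oo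
         --> (fine Hsw)^-1 *
             Rintegral mu A (fun x => f x * powR (w (x, x)) (- (d%:R / s)))).
Proof.
move=> d0 dp [M [CM [AM bd]]] cA [a0 Aa0] cw wge0 wpos muE s ds Hsw.
have HE : Hsw = (fine Hsw)%:E by exact: (wdens_integral d0 ds CM cA AM cw wpos muE).
split; first by rewrite HE; exact: (Pmax_limit d0 ds Aa0 CM cA AM bd cw wge0 wpos muE).
move=> HdA omega Aom opt f cf.
have Hp : 0 < fine Hsw.
  exact: (wdens_integral_gt0 d0 ds CM cA AM cw wpos muE HdA).
exact: (average_optimal_cvg d0 ds Aa0 CM cA AM bd cw wge0 wpos muE Aom opt Hp cf).
Qed.
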